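(* Let $(P(t),Q(t))$ be the exact solution of the stochastic Langevin equation and $\{(P_m,Q_m)\}_{m\in\mathbb N}$ the numerical solution of the splitting method, both as described in the context. Suppose that the one-step approximation satisfies, for all $m\in\mathbb N$, $$\Big|\frac{\upsilon}{2}P_m+Q_m^3+\tau^{-1}\mathcal A^m_\tau\Big|\le C\big(|\bar P_{T_m,t_{m+1}}-P_m|^a+|\bar Q_{T_m,t_{m+1}}-Q_m|^b\big)\Theta_1^m,$$ $$\Big|P_m+\frac{\upsilon}{2}Q_m-\tau^{-1}\mathcal B^m_\tau\Big|\le C\big(|\bar P_{T_m,t_{m+1}}-P_m|^a+|\bar Q_{T_m,t_{m+1}}-Q_m|^b\big)\Theta_2^m$$ for constants $C>0$ and $a,b$ with $a\wedge b\ge 1$, where $\Theta_i^m=\Theta_i(P_m,Q_m,\bar P_{T_m,t_{m+1}},\bar Q_{T_m,t_{m+1}})$, $i=1,2$, with maps $\Theta_1,\Theta_2$ of polynomial growth. Let $p>0$ and $T>0$, and suppose in addition that $$\sup_{t_n\in[0,T]}\big(\|\tau^{-1}\mathcal A^n_\tau\|_{L^{6pa}(\Omega)}+\|\tau^{-1}\mathcal B^n_\tau\|_{L^{6pb}(\Omega)}\big)\le C.$$ Then there exist $\tilde\tau_0\in(0,1)$ and $C>0$, depending on $T$ (and possibly on $p$), such that for all $\tau\in(0,\tilde\tau_0)$, $$\sup_{t_m\in[0,T]}\big\|(P(t_m),Q(t_m))^\top-(P_m,Q_m)^\top\big\|_{L^{2p}(\Omega)}\le C\tau.$$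
   Context: Equation: the stochastic Langevin equation in $\mathbb R^2$, $dP(t)=-\upsilon P(t)\,dt-\nabla U(Q(t))\,dt+\sigma\,dW_t$, $dQ(t)=P(t)\,dt$, with $U(q)=\frac14q^4$ (so $\nabla U(q)=q^3$), constants $\upsilon>0$, $\sigma>0$, deterministic initial value $(P(0),Q(0))\in\mathbb R^2$, and $W$ a one-dimensional standard Wiener process on a filtered complete probability space $(\Omega,\mathcal F,\{\mathcal F_t\}_{t\ge0},\mathbb P)$. Hamiltonian: $H(p,q)=\frac{p^2}{2}+\frac{q^4}{4}+\frac{\upsilon}{2}pq$. Grid: $\tau\in(0,1)$ is the uniform time-step, $t_n=n\tau$, $T_n=[t_n,t_{n+1})$, $n\in\mathbb N=\{0,1,2,\dots\}$. Splitting method: $(P_0,Q_0)=(P(0),Q(0))$. Given $(P_n,Q_n)$: (1) Deterministic step: $\bar P_{T_n,t_{n+1}}=P_n+\mathcal A^n_\tau$, $\bar Q_{T_n,t_{n+1}}=Q_n+\mathcal B^n_\tau$, where $\mathcal A^n_\tau=\mathcal A_\tau(P_n,Q_n,\bar P_{T_n,t_{n+1}},\bar Q_{T_n,t_{n+1}})$ and $\mathcal B^n_\tau=\mathcal B_\tau(P_n,Q_n,\bar P_{T_n,t_{n+1}},\bar Q_{T_n,t_{n+1}})$ with measurable maps $\mathcal A_\tau,\mathcal B_\tau$. This is a one-step approximation (over time $\tau$) of the Hamiltonian system $d\bar P=-\frac{\upsilon}{2}\bar P\,dt-\bar Q^3\,dt$, $d\bar Q=\bar P\,dt+\frac{\upsilon}{2}\bar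 Q\,dt$, which is assumed to preserve the Hamiltonian, $H(\bar P_{T_n,t_{n+1}},\bar Q_{T_n,t_{n+1}})=H(P_n,Q_n)$, and to be solvable: there are measurable maps $\psi_\tau,\phi_\tau:\mathbb R^2\to\mathbb R$ with $\bar P_{T_n,t_{n+1}}=\psi_\tau(P_n,Q_n)$, $\bar Q_{T_n,t_{n+1}}=\phi_\tau(P_n,Q_n)$. (2) Stochastic step, solved exactly: $(\tilde P_{T_n,t},\tilde Q_{T_n,t})$ solves on $T_n$ (up to $t_{n+1}$) $d\tilde P=-\frac{\upsilon}{2}\tilde P\,dt+\sigma\,dW_t$, $d\tilde Q=-\frac{\upsilon}{2}\tilde Q\,dt$ with initial value $(\bar P_{T_n,t_{n+1}},\bar Q_{T_n,t_{n+1}})$ at time $t_n$. Then $(P_{n+1},Q_{n+1})=(\tilde P_{T_n,t_{n+1}},\tilde Q_{T_n,t_{n+1}})$. Conventions: $C$ denotes a generic positive constant, possibly different at each occurrence, independent of $\tau$ and of the time index; it may depend on the fixed data $\upsilon,\sigma,(P_0,Q_0)$. The maps $\Theta_1,\Theta_2$ do not depend on $\tau$ or $m$. *)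

(* Defs.v *)
From HB Require Import structures.
From mathcomp Require Import all_boot all_order all_algebra.
From mathcomp Require Import all_classical all_reals all_analysis.

Set Implicit Arguments.
Unset Strict Implicit.
Unset Printing Implicit Defensive.

Import Order.TTheory GRing.Theory Num.Theory.
Import numFieldNormedType.Exports.

Local Open Scope classical_set_scope.
Local Open Scope ring_scope.

(* Time is a real number and only times t >= 0 are constrained. A state of the
   Langevin equation is a pair (p, q): momentum first, position second. *)

Record filtration (d : measure_display) (O : measurableType d) (R : realType)
    (F : R -> set (set O)) : Prop := Filtration {
  filtration_sigma_algebra : forall t : R, 0 <= t -> sigma_algebra setT (F t) ;
  filtration_measurable : forall t : R, 0 <= t -> F t `<=` measurable ;
  filtration_nondecreasing :
    forall s t : R, 0 <= s -> s <= t -> F s `<=` F t }.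

Definition adapted (d : measure_display) (O : measurableType d) (R : realType)
    (F : R -> set (set O)) (I : set R) (X : R -> O -> R) : Prop :=
  forall t, I t -> forall B : set R, measurable B -> F t (X t @^-1` B).

Record wiener_process (d : measure_display) (O : measurableType d)
    (R : realType) (P : probability O R) (F : R -> set (set O))
    (W : R -> O -> R) : Prop := WienerProcess {
  wiener_adapted : adapted F `[0, +oo[ W ;
  wiener_init : {ae P, forall w, W 0 w = 0} ;
  wiener_continuous :
    {ae P, forall w, {within `[0, +oo[, continuous (fun t => W t w)}} ;
  (* [normal_prob m s] is parametrized by the standard deviation [s] *)
  wiener_increment_normal : forall s t : R, 0 <= s -> s < t ->
    forall B : set R, measurable B ->
      P ((fun w => W t w - W s w) @^-1` B) =
      normal_prob 0 (Num.sqrt (t - s)) B ;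
  wiener_increment_independent : forall s t : R, 0 <= s -> s < t ->
    forall (A : set O) (B : set R), F s A -> measurable B ->
      P (A `&` (fun w => W t w - W s w) @^-1` B) =
      (P A * P ((fun w => W t w - W s w)%R @^-1` B))%E }.

(* [(X, Y)] is an adapted solution with continuous paths, on the time interval
   [I] with left endpoint [t0], of
     dX = f (X, Y) dt + sigma dW,   dY = g (X, Y) dt,
     (X, Y) (t0) = (x0, y0).
   As the diffusion coefficient is constant, the Ito integral of sigma over
   [t0, t] is sigma (W t - W t0). *)
Record additive_noise_solution (d : measure_display) (O : measurableType d)
    (R : realType) (P : probability O R) (F : R -> set (set O))
    (W : R -> O -> R) (sigma : R) (f g : R * R -> R) (I : set R) (t0 : R)
    (x0 y0 : O -> R) (X Y : R -> O -> R) : Prop := AdditiveNoiseSolution {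
  solution_adapted : adapted F I X /\ adapted F I Y ;
  solution_continuous : {ae P, forall w,
    {within I, continuous (fun t => X t w)} /\
    {within I, continuous (fun t => Y t w)}} ;
  solution_eqX : {ae P, forall w, forall t, I t ->
    X t w = x0 w + \int[lebesgue_measure]_(s in `[t0, t]) f (X s w, Y s w)
            + sigma * (W t w - W t0 w)} ;
  solution_eqY : {ae P, forall w, forall t, I t ->
    Y t w = y0 w + \int[lebesgue_measure]_(s in `[t0, t]) g (X s w, Y s w)} }.

Definition langevin_solution (d : measure_display) (O : measurableType d)
    (R : realType) (P : probability O R) (F : R -> set (set O))
    (W : R -> O -> R) (upsilon sigma p0 q0 : R) (X Y : R -> O -> R) : Prop :=
  additive_noise_solution P F W sigma
    (fun x => - upsilon * x.1 - x.2 ^+ 3) (fun x => x.1)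
    `[0, +oo[ 0 (cst p0) (cst q0) X Y.

Definition hamiltonian (R : realType) (upsilon p q : R) : R :=
  p ^+ 2 / 2 + q ^+ 4 / 4 + upsilon / 2 * p * q.

Definition grid (R : realType) (tau : R) (n : nat) : R := n%:R * tau.

(* The value [A^n_tau] of a map [A] of (old state, new state) along the
   deterministic step from (P_n, Q_n) to (Pbar_n, Qbar_n). *)
Definition along_step (O : Type) (R : realType) (A : R * R -> R * R -> R)
    (Pn Qn Pbar Qbar : nat -> O -> R) (n : nat) (w : O) : R :=
  A (Pn n w, Qn n w) (Pbar n w, Qbar n w).

(* Splitting method with step size [tau]: [Pbar n], [Qbar n] is the result of
   the deterministic step on [t_n, t_{n+1}] and [Pt n], [Qt n] the solution of
   the stochastic subsystem there. *)
Record splitting_method (d : measure_display) (O : measurableType d)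
    (R : realType) (P : probability O R) (F : R -> set (set O))
    (W : R -> O -> R) (upsilon sigma p0 q0 tau : R)
    (A B : R * R -> R * R -> R) (psi phi : R * R -> R)
    (Pn Qn Pbar Qbar : nat -> O -> R) (Pt Qt : nat -> R -> O -> R) : Prop :=
  SplittingMethod {
  splitting_measurableA :
    measurable_fun setT (fun z : (R * R) * (R * R) => A z.1 z.2) ;
  splitting_measurableB :
    measurable_fun setT (fun z : (R * R) * (R * R) => B z.1 z.2) ;
  splitting_measurable_psi : measurable_fun setT psi ;
  splitting_measurable_phi : measurable_fun setT phi ;
  splitting_init : forall w, Pn 0%N w = p0 /\ Qn 0%N w = q0 ;
  splitting_one_step : forall n, {ae P, forall w,
    Pbar n w = Pn n w + along_step A Pn Qn Pbar Qbar n w /\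
    Qbar n w = Qn n w + along_step B Pn Qn Pbar Qbar n w} ;
  splitting_solvable : forall n w,
    Pbar n w = psi (Pn n w, Qn n w) /\ Qbar n w = phi (Pn n w, Qn n w) ;
  splitting_hamiltonian : forall n, {ae P, forall w,
    hamiltonian upsilon (Pbar n w) (Qbar n w) =
    hamiltonian upsilon (Pn n w) (Qn n w)} ;
  splitting_stochastic : forall n,
    additive_noise_solution P F W sigma
      (fun x => - (upsilon / 2) * x.1) (fun x => - (upsilon / 2) * x.2)
      `[grid tau n, grid tau n.+1] (grid tau n)
      (Pbar n) (Qbar n) (Pt n) (Qt n) ;
  splitting_next : forall n w,
    Pn n.+1 w = Pt n (grid tau n.+1) w /\
    Qn n.+1 w = Qt n (grid tau n.+1) w }.

Definition euclid_norm (R : realType) (x : R * R) : R :=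
  Num.sqrt (x.1 ^+ 2 + x.2 ^+ 2).

Definition polynomial_growth (R : realType) (Theta : R * R -> R * R -> R) :
    Prop :=
  exists (K : R) (k : nat), forall x y,
    `|Theta x y| <= K * (1 + euclid_norm x ^+ k + euclid_norm y ^+ k).

(* The norm of L^r of a real random variable, for finite r > 0 (r < 1 is
   allowed, and it may be infinite). *)
Definition Lr_norm (d : measure_display) (O : measurableType d) (R : realType)
    (P : probability O R) (r : R) (X : O -> R) : \bar R :=
  Lnorm P r%:E (EFin \o X).

(* Main.v *)
(* The modified Hamiltonian h = H + c is at least 1 and bounds (P_m, Q_m) and its image under
   the deterministic step polynomially, so the one-step condition bounds the
   increments by tau D h^k, on every path.

   With N = int (W_s - W_{t_m}) ds accumulated over the steps, the errors
   u = P - P_m + (v/2) sigma N and r = Q - Q_m - sigma N solve, on each step, a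
   random differential equation without noise whose forcing is O(tau), and
   E = u^2/2 + r^2/2 + r^4/4 satisfies E' <= K E + O(tau^2). Thanks to the quartic
   term, K involves only the numerical position, quadratically, and the
   Brownian path, linearly. Gronwall's lemma thus gives E = O(tau^2) as soon as
   exp(c Q_m^2), exp(c N / tau) and exp(c sup |W|) are integrable uniformly in m
   and tau, for all c. The first holds since exp(be h) is integrable for small
   be: the deterministic step preserves h, and the stochastic one is dissipative.

   No stochastic integral is needed: all exponential moments come from Markov
   chains driven by increments of W, compared step by step with a Gaussian
   integral, and are passed to the limit of a vanishing mesh with Fatou's
   lemma. *)

Require Import Defs.
From HB Require Import structures.
From mathcomp Require Import all_boot all_order all_algebra.
From mathcomp Require Import all_classical all_reals all_analysis.
From mathcomp Require Import measurable_realfun.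
From mathcomp Require Import ring lra.

Set Implicit Arguments.
Unset Strict Implicit.
Unset Printing Implicit Defensive.

Import Order.TTheory GRing.Theory Num.Theory.
Import numFieldNormedType.Exports.

Local Open Scope classical_set_scope.
Local Open Scope ring_scope.

(** * Gaussian integrals and independence *)

(** Why the shift by [N]: inside a step the exact position feels the noise through the momentum,
    while the numerical position does not feel it at all. The local discrepancy
    [sigma * int (W_s - W_{t_m}) ds] has size [tau^(3/2)], so adding absolute values over [T / tau]
    steps would only give order 1/2. The summands are independent and centred, hence their sum has
    size [tau]. In the momentum, the noise of a step is damped at rate [v] by the equation and at
    rate [v / 2] by the scheme, which explains the weight [v / 2] of [N] there. Once [N] is removed,
    what is left of order [tau] is small path by path, and absolute values suffice.

    Why small [be] is enough: Gronwall requires [exp (c Q^2)] for a prescribed and possibly large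
    [c], but [h] grows like [Q^4], so [c Q^2 <= be h + const] for every [be > 0].

    The jump made by the deterministic step at [t_m] is spread linearly over the step. This keeps
    the errors differentiable and leaves their values at the grid points unchanged. *)

Lemma integral_independent (R : realType) (d d1 d2 : measure_display)
  (O : measurableType d) (T1 : measurableType d1) (T2 : measurableType d2)
  (P : probability O R) (mu : probability T2 R) (X : O -> T1) (Y : O -> T2)
  (mX : measurable_fun setT X) (mY : measurable_fun setT Y)
  (XY : forall A B, measurable A -> measurable B ->
    P (X @^-1` A `&` Y @^-1` B) = (P (X @^-1` A) * mu B)%E)
  (g : T1 * T2 -> \bar R) (mg : measurable_fun [set: T1 * T2] g)
  (g0 : forall z, (0 <= g z)%E) :
  (\int[P]_w g (X w, Y w) = \int[P]_w \int[mu]_z g (X w, z))%E.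
Proof.
pose j (w : O) := (X w, Y w).
have mj : measurable_fun setT j by apply/measurable_fun_pairP; split.
pose XM : {mfun O >-> T1} := HB.pack X (isMeasurableFun.Build _ _ _ _ _ mX).
pose jM : {mfun O >-> (T1 * T2)%type} := HB.pack j (isMeasurableFun.Build _ _ _ _ _ mj).
transitivity (\int[distribution P jM]_z g z)%E.
  by rewrite ge0_integral_distribution.
(* Product measures are determined by rectangles, so the hypothesis [XY] identifies the joint law;
   Tonelli then integrates out the second variable. *)
transitivity (\int[distribution P XM \x mu]_z g z)%E.
  apply: eq_measure_integral => A mA _; apply/esym.
  exact: product_measure_unique.
transitivity (\int[distribution P XM]_x fubini_F mu g x)%E.
  exact: fubini_tonelli1.
rewrite ge0_integral_distribution//; first exact: measurable_fun_fubini_tonelli_F.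
by move=> w; apply: integral_ge0.
Qed.

(** A filtration consists of sets of sets, not of measurable types. Equipping the domain with
    [g_sigma_algebraType G], whose measurable sets are exactly [G], reduces the claim to
    measurability of a pair. *)
Lemma preimage_pair_sub_sigma_algebra (R : realType) (T : pointedType)
  (G : set (set T)) (hG : sigma_algebra setT G) (x y : T -> R)
  (hx : forall B : set R, measurable B -> G (x @^-1` B))
  (hy : forall B : set R, measurable B -> G (y @^-1` B))
  (A : set (R * R)) : measurable A -> G ((fun w => (x w, y w)) @^-1` A).
Proof.
have measG : @measurable _ (g_sigma_algebraType G) = G.
  by rewrite /measurable/= sigma_algebra_id.
have mx : measurable_fun setT (x : g_sigma_algebraType G -> R).
  by move=> _ B mB; rewrite setTI measG; exact: hx.
have my : measurable_fun setT (y : g_sigma_algebraType G -> R).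
  by move=> _ B mB; rewrite setTI measG; exact: hy.
have mxy : measurable_fun setT
    (fun w : g_sigma_algebraType G => (x w, y w)).
  by apply/measurable_fun_pairP; split.
by move=> mA; have := mxy measurableT _ mA; rewrite setTI measG.
Qed.

(** The Radon-Nikodym derivative of [normal_prob] and [normal_pdf] have the same integral over every
    measurable set, hence agree almost everywhere. *)
Lemma ge0_integral_normal_prob (R : realType) (m s : R) (f : R -> \bar R) :
  measurable_fun [set: R] f -> (forall x, (0 <= f x)%E) ->
  (\int[normal_prob m s]_x f x =
   \int[lebesgue_measure]_x (f x * (normal_pdf m s x)%:E))%E.
Proof.
move=> mf f0; have numu := normal_prob_dominates m s.
have mpdf : measurable_fun setT (fun x => (normal_pdf m s x)%:E).
  by apply/measurable_EFinP; exact: measurable_normal_pdf.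
have fi := Radon_Nikodym_SigmaFinite.f_integrable numu.
have mrn := measurable_int _ fi.
rewrite -(Radon_Nikodym_SigmaFinite.change_of_variables numu f0 measurableT mf).
apply: ge0_ae_eq_integral => //.
- exact: emeasurable_funM.
- exact: emeasurable_funM.
- by move=> x _; rewrite mule_ge0// Radon_Nikodym_SigmaFinite.f_ge0.
- by move=> x _; rewrite mule_ge0// lee_fin normal_pdf_ge0.
- have : ae_eq lebesgue_measure [set: R]
      (Radon_Nikodym_SigmaFinite.f (normal_prob m s) lebesgue_measure)
      (fun x => (normal_pdf m s x)%:E).
    apply: integral_ae_eq => // E _ mE.
    by rewrite -Radon_Nikodym_SigmaFinite.f_integral.
  by apply: filterS => x /(_ I) eqx _; rewrite eqx.
Qed.

Lemma gaussian_expR_quadratic (R : realType) (s al b : R) :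
  0 < s -> 2 * b * s ^+ 2 < 1 ->
  (\int[normal_prob 0 s]_x (expR (al * x + b * x ^+ 2))%:E =
   ((Num.sqrt (1 - 2 * b * s ^+ 2))^-1 *
    expR (al ^+ 2 * s ^+ 2 / (2 * (1 - 2 * b * s ^+ 2))))%:E)%E.
Proof.
move=> s0 hb; have [k kE] : exists k, k = 1 - 2 * b * s ^+ 2 by eexists.
have k0 : 0 < k by rewrite kE subr_gt0.
rewrite -kE.
have sk0 : 0 < Num.sqrt k by rewrite sqrtr_gt0.
have skE : Num.sqrt k ^+ 2 = k by rewrite sqr_sqrtr// ltW.
rewrite ge0_integral_normal_prob; last 2 first.
- apply/measurable_EFinP; apply: measurableT_comp => //.
  by apply: measurable_funD; apply: measurable_funM => //; exact: measurable_funX.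
- by move=> x; rewrite lee_fin expR_ge0.
(* Completing the square: the integrand times the density is a constant times the density of the
   normal law with mean [m'] and deviation [s']. *)
pose s' := s / Num.sqrt k; pose m' := al * s ^+ 2 / k.
have s'0 : s' != 0 by rewrite gt_eqF// divr_gt0.
transitivity (\int[lebesgue_measure]_x
  (((Num.sqrt k)^-1 * expR (al ^+ 2 * s ^+ 2 / (2 * k)))%:E *
   (normal_pdf m' s' x)%:E))%E.
  apply: eq_integral => x _; rewrite -!EFinM; congr EFin.
  rewrite !normal_pdfE ?(gt_eqF s0)//.
  have -> : normal_peak s' = normal_peak s * Num.sqrt k.
    rewrite /normal_peak.
    have -> : s ^+ 2 * pi *+ 2 = (s' ^+ 2 * pi *+ 2) * k :> R.
      rewrite -mulrnAl mulrnAl /s' expr_div_n skE mulrnAl; congr (_ *+ 2).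
      by rewrite [RHS]mulrAC divfK// gt_eqF.
    rewrite sqrtrM; last first.
      by rewrite mulrn_wge0// mulr_ge0// ?sqr_ge0// pi_ge0.
    by rewrite invfM mulfVK// gt_eqF.
  rewrite /normal_fun [in LHS]mulrCA [in RHS]mulrACA.
  rewrite [(Num.sqrt k)^-1 * _]mulrC mulfK ?gt_eqF//; congr (_ * _).
  rewrite -!expRD; congr expR; rewrite /m' /s' expr_div_n skE -[s ^+ 2 *+ 2]mulr_natr -[s ^+ 2 / k *+ 2]mulr_natr.
  have sn0 : s != 0 by rewrite gt_eqF.
  have kn0 : k != 0 by rewrite gt_eqF.
  have bE : b = (1 - k) / (2 * s ^+ 2) by rewrite kE; field.
  by rewrite bE; field; rewrite sn0 kn0.
rewrite ge0_integralZl//.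
- by rewrite integral_normal_pdf mule1.
- by apply/measurable_EFinP; exact: measurable_normal_pdf.
- by move=> x _; rewrite lee_fin normal_pdf_ge0.
Qed.

(** For [0 <= y <= 1/2] one has [1 / (1 - y) <= 1 + 2 y <= exp (2 y)], so the prefactor is at most
    [exp y]. A purely exponential bound linear in [s ^+ 2] is what multiplies well along a chain:
    [n] steps of length [h] give a bound in [n h] only. *)
Lemma gaussian_expR_quadratic_le (R : realType) (s al b : R) :
  0 < s -> 0 <= b -> 2 * b * s ^+ 2 <= 2^-1 ->
  (\int[normal_prob 0 s]_x (expR (al * x + b * x ^+ 2))%:E <=
   (expR (2 * b * s ^+ 2 + al ^+ 2 * s ^+ 2))%:E)%E.
Proof.
move=> s0 b0 hb; rewrite gaussian_expR_quadratic//; last by lra.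
rewrite lee_fin; set y := 2 * b * s ^+ 2.
have y0 : 0 <= y by rewrite /y mulr_ge0 ?sqr_ge0// mulr_ge0.
have k0 : 0 < 1 - y by rewrite /y; lra.
rewrite expRD ler_pM ?expR_ge0// ?invr_ge0 ?sqrtr_ge0//.
  rewrite invf_ple ?posrE ?expR_gt0 ?sqrtr_gt0// -expRN.
  rewrite -(@ger0_norm _ (expR (- y))) ?expR_ge0// -sqrtr_sqr ler_sqrt//.
  rewrite -expRM_natl mulrN expRN.
  rewrite invf_ple ?posrE ?expR_gt0//.
  apply: le_trans (expR_ge1Dx _); rewrite -div1r ler_pdivrMr//.
  by rewrite -[2 * b * _]/y in hb; nra.
  exact: ltW.
rewrite ler_expR ler_pdivrMr; last by rewrite mulr_gt0.
have : 0 <= al ^+ 2 * s ^+ 2 by rewrite mulr_ge0 ?sqr_ge0.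
rewrite /y in k0 y0 *; nra.
Qed.

(** * Chains driven by Wiener increments *)

Section WienerChains.
Context (R : realType) (d : measure_display) (O : measurableType d).
Context (P : probability O R) (F : R -> set (set O)) (hF : filtration F).
Context (W : R -> O -> R) (hW : wiener_process P F W).

Lemma wiener_measurable t : 0 <= t -> measurable_fun setT (W t).
Proof.
move=> t0 _ B mB; rewrite setTI; apply: (filtration_measurable hF t0).
by apply: (wiener_adapted hW) => //=; rewrite in_itv/= t0.
Qed.

Lemma adapted_le (T1 : Type) (A : set (set T1)) (X : O -> T1) (s t : R) :
  0 <= s -> s <= t -> (forall B, A B -> F s (X @^-1` B)) ->
  forall B, A B -> F t (X @^-1` B).
Proof.
by move=> s0 st h B AB; apply: (filtration_nondecreasing hF s0 st); exact: h.
Qed.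

(** The Markov property in integrated form; it replaces conditional expectations throughout. *)
Lemma wiener_integral_increment (s t : R) (X : O -> R * R)
  (g : R * R * R -> \bar R) : 0 <= s -> s < t ->
  (forall B : set (R * R), measurable B -> F s (X @^-1` B)) ->
  measurable_fun [set: R * R * R] g -> (forall z, (0 <= g z)%E) ->
  (\int[P]_w g (X w, (W t w - W s w)%R) =
   \int[P]_w \int[normal_prob 0 (Num.sqrt (t - s))]_z g (X w, z))%E.
Proof.
move=> s0 st hX mg g0.
have mX : measurable_fun setT X.
  by move=> _ B mB; rewrite setTI; apply: (filtration_measurable hF s0); exact: hX.
have t0 : 0 <= t by rewrite (le_trans s0)// ltW.
have mD : measurable_fun setT (fun w => W t w - W s w).
  by apply: measurable_funB; exact: wiener_measurable.
apply: (integral_independent (mu := normal_prob 0 (Num.sqrt (t - s)))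
  mX mD _ mg g0) => A B mA mB.
rewrite (wiener_increment_independent hW s0 st)//; last exact: hX.
by rewrite (wiener_increment_normal hW s0 st).
Qed.

(** A pair is a large enough state for the three chains in use: momentum and position, running
    maximum and current value, weighted sum and a dummy. The transition may depend on the index for
    the sake of the weights. *)
Fixpoint chain (phi : nat -> R * R * R -> R * R) (X0 : O -> R * R)
    (t0 h : R) (n : nat) (w : O) : R * R :=
  if n is k.+1 then
    phi k (chain phi X0 t0 h k w, W (t0 + k.+1%:R * h) w - W (t0 + k%:R * h) w)
  else X0 w.

Lemma chain_adapted phi X0 (t0 h : R) n : 0 <= t0 -> 0 <= h ->
  (forall k, measurable_fun setT (phi k)) ->
  (forall B : set (R * R), measurable B -> F t0 (X0 @^-1` B)) ->
  forall B : set (R * R), measurable B ->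
    F (t0 + n%:R * h) (chain phi X0 t0 h n @^-1` B).
Proof.
move=> t00 h0 mphi hX0; elim: n => [|n IH] B mB.
  by rewrite mul0r addr0; exact: hX0.
have ge0 k : 0 <= t0 + k%:R * h by rewrite addr_ge0// mulr_ge0.
have le_n : t0 + n%:R * h <= t0 + n.+1%:R * h.
  by rewrite lerD2l ler_wpM2r// ler_nat.
(* As for pairs, the later sigma-algebra is made the measurable structure of the domain, so
   adaptedness becomes measurability of a composition. *)
pose G := F (t0 + n.+1%:R * h).
have hG : sigma_algebra setT G by exact: (filtration_sigma_algebra hF).
have measG : @measurable _ (g_sigma_algebraType G) = G.
  by rewrite /measurable/= sigma_algebra_id.
have mc : measurable_fun setT
    (chain phi X0 t0 h n : g_sigma_algebraType G -> R * R).
  by move=> _ A mA; rewrite setTI measG; exact: (adapted_le (ge0 n) le_n IH).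
have mW k : (k <= n.+1)%N -> measurable_fun setT
    (W (t0 + k%:R * h) : g_sigma_algebraType G -> R).
  move=> kn _ A mA; rewrite setTI measG.
  have kle : t0 + k%:R * h <= t0 + n.+1%:R * h.
    by rewrite lerD2l ler_wpM2r// ler_nat.
  apply: (filtration_nondecreasing hF (ge0 k) kle).
  by apply: (wiener_adapted hW) => //=; rewrite in_itv/= ge0.
have : measurable_fun setT (fun w : g_sigma_algebraType G =>
    phi n (chain phi X0 t0 h n w, W (t0 + n.+1%:R * h) w - W (t0 + n%:R * h) w)).
  apply: (measurableT_comp (mphi n)); apply/measurable_fun_pairP; split => //.
  by apply: measurable_funB; exact: mW.
by move=> /(_ measurableT _ mB); rewrite setTI measG.
Qed.

Lemma chain_measurable phi X0 (t0 h : R) n : 0 <= t0 -> 0 <= h ->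
  (forall k, measurable_fun setT (phi k)) ->
  (forall B : set (R * R), measurable B -> F t0 (X0 @^-1` B)) ->
  measurable_fun setT (chain phi X0 t0 h n).
Proof.
move=> t00 h0 mphi hX0 _ B mB; rewrite setTI.
have ge0 : 0 <= t0 + n%:R * h by rewrite addr_ge0// mulr_ge0.
by apply: (filtration_measurable hF ge0); exact: chain_adapted.
Qed.

(** A discrete Lyapunov bound: the state at step [n] is independent of the next increment, so a
    one-step Gaussian inequality holding for every frozen state integrates to a factor [K]. *)
Lemma chain_le phi X0 (U : R * R -> R) (K t0 h : R) n :
  0 <= t0 -> 0 < h -> 0 <= K ->
  (forall k, measurable_fun setT (phi k)) ->
  (forall B : set (R * R), measurable B -> F t0 (X0 @^-1` B)) ->
  measurable_fun setT U -> (forall x, 0 <= U x) ->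
  (forall k x, (\int[normal_prob 0 (Num.sqrt h)]_z (U (phi k (x, z)))%:E <=
    (K * U x)%:E)%E) ->
  (\int[P]_w (U (chain phi X0 t0 h n w))%:E <=
   (K ^+ n)%:E * \int[P]_w (U (X0 w))%:E)%E.
Proof.
move=> t00 h0 K0 mphi hX0 mU U0 step; elim: n => [|n IH].
  by rewrite expr0 mul1e.
have ge0 k : 0 <= t0 + k%:R * h by rewrite addr_ge0// mulr_ge0// ltW.
have lt_n : t0 + n%:R * h < t0 + n.+1%:R * h.
  by rewrite ltrD2l ltr_pM2r// ltr_nat.
have mc : measurable_fun setT (chain phi X0 t0 h n).
  by apply: chain_measurable => //; exact: ltW.
have mUc : measurable_fun setT (fun w => (U (chain phi X0 t0 h n w))%:E).
  by apply/measurable_EFinP; exact: (measurableT_comp mU mc).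
rewrite /= (@wiener_integral_increment _ _ (chain phi X0 t0 h n)
  (fun z => (U (phi n z))%:E))//; last 3 first.
- by apply: chain_adapted => //; exact: ltW.
- by apply/measurable_EFinP; exact: (measurableT_comp mU (mphi n)).
- by move=> z; rewrite lee_fin.
have -> : t0 + n.+1%:R * h - (t0 + n%:R * h) = h.
  by rewrite -natr1; ring.
apply: (@le_trans _ _ (\int[P]_w (K%:E * (U (chain phi X0 t0 h n w))%:E))%E).
  apply: ge0_le_integral => //.
  - by move=> w _; apply: integral_ge0 => z _; rewrite lee_fin.
  - have mg : measurable_fun [set: R * R * R] (fun z => (U (phi n z))%:E).
      by apply/measurable_EFinP; exact: (measurableT_comp mU (mphi n)).
    have g0 z : (0 <= (U (phi n z))%:E)%E by rewrite lee_fin.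
    exact: (measurableT_comp (measurable_fun_fubini_tonelli_F
      (m2 := normal_prob 0 (Num.sqrt h)) _ mg g0) mc).
  - by apply: measurable_funeM.
rewrite ge0_integralZl//; last first.
  by move=> w _; rewrite lee_fin.
by rewrite exprS EFinM -muleA; apply: lee_wpmul2l; rewrite ?lee_fin.
Qed.

End WienerChains.

Lemma integral_probability_cst (R : realType) (d : measure_display)
  (T : measurableType d) (P : probability T R) (c : R) :
  (\int[P]_x c%:E = c%:E)%E.
Proof. by rewrite integral_cst// [X in (_ * X)%E](probability_setT P) mule1. Qed.

(** * One-step Gaussian estimates for the chains *)

Section WienerEstimates.
Context (R : realType).

(** The state is the pair (running maximum, current value); [eps] is 1 or -1, for the maxima of [W]
    and of [- W]. *)
Definition running_max (eps : R) (x : R * R * R) : R * R :=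
  (Num.max x.1.1 (x.1.2 + eps * x.2), x.1.2 + eps * x.2).

Lemma measurable_running_max eps : measurable_fun setT (running_max eps).
Proof.
have m2 : measurable_fun setT (fun x : R * R * R => x.1.2 + eps * x.2).
  apply: measurable_funD; first exact: (measurableT_comp measurable_snd).
  by apply: measurable_funM => //; exact: measurable_snd.
apply/measurable_fun_pairP; split => //.
apply: measurable_maxr => //.
exact: (measurableT_comp measurable_fst).
Qed.

(* A supermartingale dominating [expR (la * max)]: when a new maximum [w] is
   reached, [2 e^w <= e^m + e^(2 w - m)] by AM-GM. *)
Definition max_potential (la : R) (x : R * R) : R :=
  expR (la * x.1) + expR (la * (2 * x.2 - x.1)).

Lemma max_potential_running (la eps : R) (x : R * R) (z : R) :
  max_potential la (running_max eps (x, z)) <=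
  expR (la * x.1) + expR (la * (2 * x.2 - x.1)) * expR (2 * la * eps * z).
Proof.
case: x => m w; rewrite /max_potential /running_max /= -expRD.
set w' := w + eps * z.
have -> : la * (2 * w - m) + 2 * la * eps * z = la * (2 * w' - m).
  by rewrite /w'; ring.
case: (leP w' m) => [//|mw'].
have -> : 2 * w' - w' = w' by ring.
have := expR_gt0 (la * m); have := expR_gt0 (la * (2 * w' - m)).
have : expR (la * m) * expR (la * (2 * w' - m)) = expR (la * w') ^+ 2.
  by rewrite -expRD expr2 -expRD; congr expR; ring.
have := expR_gt0 (la * w').
set a := expR (la * m); set c := expR (la * (2 * w' - m)); set b := expR _.
move=> b0 E c0 a0.
rewrite leNgt; apply/negP => H.
have : (a + c) ^+ 2 < (b + b) ^+ 2 by rewrite ltr_pXn2r ?nnegrE//; lra.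
have : 0 <= (a - c) ^+ 2 by exact: sqr_ge0.
nra.
Qed.

(** The case [b = 0] of the quadratic bound; the factor 1/2 lost in the exponent is harmless. *)
Lemma gaussian_mgf_le (h al : R) : 0 < h ->
  (\int[normal_prob 0 (Num.sqrt h)]_z (expR (al * z))%:E <=
   (expR (al ^+ 2 * h))%:E)%E.
Proof.
move=> h0.
have shE : Num.sqrt h ^+ 2 = h by rewrite sqr_sqrtr// ltW.
have := @gaussian_expR_quadratic_le R (Num.sqrt h) al 0.
rewrite sqrtr_gt0 h0 shE mulr0 !mul0r add0r invr_ge0 ler0n.
move=> /(_ isT (lexx _) isT); apply: le_trans.
by under [X in (_ <= X)%E]eq_integral do rewrite mul0r addr0.
Qed.

Lemma max_potential_step (la eps h : R) (x : R * R) : 0 < h -> eps ^+ 2 = 1 ->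
  (\int[normal_prob 0 (Num.sqrt h)]_z
     (max_potential la (running_max eps (x, z)))%:E <=
   (expR (4 * la ^+ 2 * h) * max_potential la x)%:E)%E.
Proof.
move=> h0 eps1.
set a := expR (la * x.1); set c := expR (la * (2 * x.2 - x.1)).
have a0 : 0 <= a by exact: expR_ge0.
have c0 : 0 <= c by exact: expR_ge0.
have mexp : measurable_fun setT (fun z : R => (expR (2 * la * eps * z))%:E).
  apply/measurable_EFinP; apply: measurableT_comp => //.
apply: (@le_trans _ _ (\int[normal_prob 0 (Num.sqrt h)]_z
  (a%:E + c%:E * (expR (2 * la * eps * z))%:E))%E).
  apply: ge0_le_integral => //.
  - by move=> z _; rewrite lee_fin addr_ge0// expR_ge0.
  - apply/measurable_EFinP.
    have mU : measurable_fun setT (max_potential la).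
      apply: measurable_funD; apply: measurableT_comp => //;
        apply: measurable_funM => //.
      apply: measurable_funB => //; apply: measurable_funM => //.
    exact: (measurable_fun_pair2 x (measurableT_comp mU (measurable_running_max eps))).
  - by apply: emeasurable_funD => //; apply: measurable_funeM.
  - by move=> z _; rewrite -EFinM -EFinD lee_fin max_potential_running.
rewrite ge0_integralD//; last 2 first.
- by move=> z _; rewrite mule_ge0// lee_fin// expR_ge0.
- by apply: measurable_funeM.
rewrite (integral_probability_cst (normal_prob 0 (Num.sqrt h))).
rewrite ge0_integralZl//.
have hc : (c%:E * \int[normal_prob 0 (Num.sqrt h)]_z (expR (2 * la * eps * z))%:E
  <= c%:E * (expR (4 * la ^+ 2 * h))%:E)%E.
  apply: lee_wpmul2l; first by rewrite lee_fin.
  apply: le_trans (gaussian_mgf_le _ h0) _.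
  rewrite lee_fin ler_expR (_ : (_ * eps) ^+ 2 = 4 * la ^+ 2)//.
  by rewrite !exprMn eps1; ring.
apply: le_trans (leeD2l _ hc) _.
rewrite -EFinM -EFinD lee_fin /max_potential -/a -/c.
have K1 : 1 <= expR (4 * la ^+ 2 * h).
  by rewrite -expR0 ler_expR; apply: mulr_ge0 (ltW h0); rewrite mulr_ge0 ?sqr_ge0.
nra.
Qed.

(** The [h] of the overview. The cross term is at least [- p^2 / 4 - v^2 q^2 / 4], and
    [v^2 q^2 / 4 <= q^4 / 8 + v^4 / 8]; this is the origin of [v ^+ 4 / 8]. The extra 1 makes the
    powers of [h] increase with the exponent. *)
Definition coercive_hamiltonian (v : R) (x : R * R) : R :=
  hamiltonian v x.1 x.2 + (v ^+ 4 / 8 + 1).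

Lemma coercive_hamiltonian_ge v x :
  1 + x.1 ^+ 2 / 4 + x.2 ^+ 4 / 8 <= coercive_hamiltonian v x.
Proof.
case: x => p q; rewrite /coercive_hamiltonian /hamiltonian /=.
have := sqr_ge0 (p + v * q); have := sqr_ge0 (q ^+ 2 - v ^+ 2).
nra.
Qed.

Lemma measurable_coercive_hamiltonian v :
  measurable_fun setT (coercive_hamiltonian v).
Proof.
apply: measurable_funD => //; apply: measurable_funD.
  by apply: measurable_funD; apply: measurable_funM => //; apply: measurable_funX.
by apply: measurable_funM => //; apply: measurable_funM.
Qed.

(* Implicit Euler for the stochastic subsystem: it is driven by increments of
   [W] only and converges pathwise to the exact flow, so that the law of the
   latter is never needed. *)
Definition damped_euler (v sigma h : R) (x : R * R * R) : R * R :=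
  ((x.1.1 + sigma * x.2) / (1 + v / 2 * h), x.1.2 / (1 + v / 2 * h)).

Lemma measurable_damped_euler v sigma h :
  measurable_fun setT (damped_euler v sigma h).
Proof.
apply/measurable_fun_pairP; split; apply: measurable_funM => //.
  apply: measurable_funD; first exact: (measurableT_comp measurable_fst).
  by apply: measurable_funM => //; exact: measurable_snd.
exact: (measurableT_comp measurable_snd).
Qed.

(** Dissipation pays for the noise. With [g = 1 / (1 + v h / 2)], the energy after a step is at most
    [g^2 Hc + (1 - g^2) c] plus a linear and a quadratic term in the increment. The Gaussian
    integral turns the linear one into [al^2 h], and [(p + v q / 2)^2 <= 2 Hc] with
    [2 be sigma^2 <= v] bounds it by [be g^2 Hc v h]. Since [g^2 (1 + v h) <= 1], the total
    coefficient of [Hc] does not exceed [be]: the exponent does not deteriorate. The condition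
    [2 be sigma^2 <= 1], with [h <= 1], makes the quadratic Gaussian integral admissible. *)
Lemma damped_euler_step (v sigma be h : R) (x : R * R) :
  0 < v -> 0 < h -> h <= 1 -> 0 <= be ->
  2 * be * sigma ^+ 2 <= v -> 2 * be * sigma ^+ 2 <= 1 ->
  (\int[normal_prob 0 (Num.sqrt h)]_z
     (expR (be * coercive_hamiltonian v (damped_euler v sigma h (x, z))))%:E <=
   (expR (be * (v * (v ^+ 4 / 8 + 1) + sigma ^+ 2) * h) *
    expR (be * coercive_hamiltonian v x))%:E)%E.
Proof.
case: x => p q v0 h0 h1 be0 bev be1.
have [g gE] : exists g, g = (1 + v / 2 * h)^-1 by eexists.
have D0 : 0 < 1 + v / 2 * h by rewrite addr_gt0// mulr_gt0// divr_gt0.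
have g0 : 0 < g by rewrite gE invr_gt0.
have gD : g * (1 + v / 2 * h) = 1 by rewrite gE mulVf// gt_eqF.
have vh2 : 0 <= v / 2 * h by rewrite mulr_ge0// ltW// divr_gt0.
have g1 : g <= 1 by have := mulr_ge0 (ltW g0) vh2; lra.
have [c cE] : exists c, c = v ^+ 4 / 8 + 1 by eexists.
have c0 : 0 <= c by rewrite cE addr_ge0// divr_ge0// exprn_even_ge0.
have gg : g ^+ 2 <= 1 by rewrite expr_le1// ltW.
have g40 : g ^+ 4 <= g ^+ 2 by rewrite -[4%N]/(2 * 2)%N exprM; have := sqr_ge0 g; nra.
have [Hc HcE] : exists Hc, Hc = coercive_hamiltonian v (p, q) by eexists.
have Hge : (p + v / 2 * q) ^+ 2 <= 2 * Hc.
  rewrite HcE /coercive_hamiltonian /hamiltonian/=.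
  have := sqr_ge0 (q ^+ 2 - v ^+ 2 / 4); have := sqr_ge0 (v ^+ 2); nra.
have Hc0 : 0 <= Hc by have := sqr_ge0 (p + v / 2 * q); lra.
pose al := be * g ^+ 2 * sigma * (p + v / 2 * q).
pose b := be * sigma ^+ 2 / 2.
pose e0 := be * (g ^+ 2 * Hc + (1 - g ^+ 2) * c).
have b0 : 0 <= b by rewrite /b divr_ge0// mulr_ge0// sqr_ge0.
have sh0 : 0 < Num.sqrt h by rewrite sqrtr_gt0.
have shE : Num.sqrt h ^+ 2 = h by rewrite sqr_sqrtr// ltW.
have mexp : measurable_fun setT (fun z : R => (expR (al * z + b * z ^+ 2))%:E).
  apply/measurable_EFinP; apply: measurableT_comp => //.
  by apply: measurable_funD; apply: measurable_funM => //; exact: measurable_funX.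
rewrite -cE -HcE.
apply: (@le_trans _ _ (\int[normal_prob 0 (Num.sqrt h)]_z
  ((expR e0)%:E * (expR (al * z + b * z ^+ 2))%:E))%E).
  apply: ge0_le_integral => //.
  - apply/measurable_EFinP; apply: measurableT_comp => //.
    apply: measurable_funM => //.
    exact: (measurable_fun_pair2 (p, q) (measurableT_comp
      (measurable_coercive_hamiltonian v) (measurable_damped_euler v sigma h))).
  - by apply: measurable_funeM.
  - move=> z _; rewrite -EFinM lee_fin -expRD ler_expR /e0 /al /b.
    rewrite /damped_euler /= -gE.
    have -> : be * (g ^+ 2 * Hc + (1 - g ^+ 2) * c) +
       (be * g ^+ 2 * sigma * (p + v / 2 * q) * z + be * sigma ^+ 2 / 2 * z ^+ 2)
       = be * (g ^+ 2 * Hc + (1 - g ^+ 2) * c + g ^+ 2 * sigma * (p + v / 2 * q) * z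
               + (sigma * z) ^+ 2 / 2).
      by field.
    apply: ler_wpM2l => //; rewrite HcE /coercive_hamiltonian /hamiltonian/= -cE.
    have h2 := sqr_ge0 (sigma * z).
    have h4 : g ^+ 4 * q ^+ 4 <= g ^+ 2 * q ^+ 4.
      by rewrite ler_wpM2r// exprn_even_ge0.
    have h5 : g ^+ 2 * (sigma * z) ^+ 2 <= (sigma * z) ^+ 2.
      by rewrite ler_piMl.
    rewrite !exprMn in h5 *; nra.
rewrite ge0_integralZl//.
apply: (@le_trans _ _ ((expR e0)%:E *
  (expR (2 * b * Num.sqrt h ^+ 2 + al ^+ 2 * Num.sqrt h ^+ 2))%:E)%E).
  apply: lee_wpmul2l; first by rewrite lee_fin expR_ge0.
  apply: gaussian_expR_quadratic_le => //.
  by rewrite shE /b; have := sqr_ge0 sigma; nra.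
rewrite -EFinM lee_fin -!expRD ler_expR shE.
have alE : al ^+ 2 <= be * g ^+ 2 * Hc * v.
  have -> : al ^+ 2 = (be * g ^+ 2) * (be * sigma ^+ 2) * (g ^+ 2 * (p + v / 2 * q) ^+ 2).
    by rewrite /al; ring.
  have k1 : g ^+ 2 * (p + v / 2 * q) ^+ 2 <= 2 * Hc.
    by apply: le_trans Hge; rewrite ler_piMl// sqr_ge0.
  have k2 : 0 <= be * g ^+ 2 by rewrite mulr_ge0// sqr_ge0.
  have k3 : 0 <= be * sigma ^+ 2 by rewrite mulr_ge0// sqr_ge0.
  apply: (@le_trans _ _ (be * g ^+ 2 * (be * sigma ^+ 2) * (2 * Hc))).
    by apply: ler_wpM2l => //; exact: mulr_ge0.
  have -> : be * g ^+ 2 * (be * sigma ^+ 2) * (2 * Hc) =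
    (be * g ^+ 2 * Hc) * (2 * be * sigma ^+ 2) by ring.
  by apply: ler_wpM2l => //; exact: mulr_ge0.
have gv : g ^+ 2 * (1 + v * h) <= 1.
  have -> : 1 = g ^+ 2 * (1 + v / 2 * h) ^+ 2 :> R by rewrite -exprMn gD expr1n.
  by apply: ler_wpM2l; [exact: sqr_ge0|have := sqr_ge0 (v * h); nra].
have gc : (1 - g ^+ 2) * c <= v * h * c.
  apply: ler_wpM2r => //.
  have vh : 0 <= v * h by rewrite mulr_ge0 ?ltW.
  have : g ^+ 2 * (1 + v / 2 * h) ^+ 2 = 1 by rewrite -exprMn gD expr1n.
  have -> : v / 2 * h = v * h / 2 by rewrite mulrAC.
  have := sqr_ge0 g; move: (g ^+ 2) (v * h) vh => gs y y0 gs0 E.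
  have y1 := mulr_ge0 gs0 y0; have y2 := mulr_ge0 y1 y0.
  have y3 := mulr_ge0 y2 y0.
  have E2 : y = y * (gs * (1 + y / 2) ^+ 2) by rewrite E mulr1.
  by rewrite expr2 in E E2; lra.
have k4 : al ^+ 2 * h <= be * g ^+ 2 * Hc * v * h by rewrite ler_wpM2r// ltW.
have k5 : be * Hc * (g ^+ 2 * (1 + v * h)) <= be * Hc.
  by rewrite ler_piMr// mulr_ge0.
have k6 : be * ((1 - g ^+ 2) * c) <= be * (v * h * c) by rewrite ler_wpM2l.
rewrite /e0 /b; lra.
Qed.
End WienerEstimates.

(** * Exponential moments of the chains, uniform in the mesh *)

Section WienerExpMoments.
Context (R : realType) (d : measure_display) (O : measurableType d).
Context (P : probability O R) (F : R -> set (set O)) (hF : filtration F).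
Context (W : R -> O -> R) (hW : wiener_process P F W).

Lemma cst_adapted (t : R) (x : R * R) : 0 <= t ->
  forall B : set (R * R), measurable B -> F t ((fun=> x) @^-1` B).
Proof.
move=> t0 B _; have [h1 h2 _] := filtration_sigma_algebra hF t0.
rewrite preimage_cst; case: ifPn => _; last by [].
by rewrite -(setD0 setT); exact: h2.
Qed.

Lemma damped_euler_chain (v sigma be t0 h : R) (n : nat) (X0 : O -> R * R) :
  0 < v -> 0 < h -> h <= 1 -> 0 <= be ->
  2 * be * sigma ^+ 2 <= v -> 2 * be * sigma ^+ 2 <= 1 -> 0 <= t0 ->
  (forall B : set (R * R), measurable B -> F t0 (X0 @^-1` B)) ->
  (\int[P]_w (expR (be * coercive_hamiltonian v
      (chain W (fun=> damped_euler v sigma h) X0 t0 h n w)))%:E <=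
   (expR (be * (v * (v ^+ 4 / 8 + 1) + sigma ^+ 2) * (n%:R * h)))%:E *
   \int[P]_w (expR (be * coercive_hamiltonian v (X0 w)))%:E)%E.
Proof.
move=> v0 h0 h1 be0 bev be1 t00 hX0.
have := @chain_le R d O P F hF W hW (fun=> damped_euler v sigma h) X0
  (fun x => expR (be * coercive_hamiltonian v x))
  (expR (be * (v * (v ^+ 4 / 8 + 1) + sigma ^+ 2) * h)) t0 h n t00 h0.
rewrite -expRM_natl [n%:R * (_ * h)]mulrCA; apply => //.
- by move=> _; exact: measurable_damped_euler.
- apply: measurableT_comp => //; apply: measurable_funM => //.
  exact: measurable_coercive_hamiltonian.
- by move=> k x; exact: damped_euler_step.
Qed.

Lemma running_max_chain (la eps h : R) (n : nat) : 0 < h -> eps ^+ 2 = 1 ->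
  (\int[P]_w (expR (la * (chain W (fun=> running_max eps) (fun=> (0, 0)) 0 h n w).1))%:E
   <= (2 * expR (4 * la ^+ 2 * (n%:R * h)))%:E)%E.
Proof.
move=> h0 eps1.
have mU : measurable_fun setT (@max_potential R la).
  apply: measurable_funD; apply: measurableT_comp => //;
    apply: measurable_funM => //.
  by apply: measurable_funB => //; apply: measurable_funM => //.
have U0 x : 0 <= max_potential la x by rewrite addr_ge0// expR_ge0.
have := @chain_le R d O P F hF W hW (fun=> running_max eps) (fun=> (0, 0))
  (max_potential la) (expR (4 * la ^+ 2 * h)) 0 h n (lexx _) h0 (expR_ge0 _)
  (fun=> measurable_running_max eps) (cst_adapted (0, 0) (lexx 0)) mU U0
  (fun=> fun x => max_potential_step la x h0 eps1).
rewrite integral_probability_cst -EFinM.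
rewrite -expRM_natl [n%:R * (_ * h)]mulrCA.
have -> : max_potential la (0, 0) = 2 :> R.
  by rewrite /max_potential/= !mulr0 subr0 mulr0 expR0.
rewrite [_ * 2]mulrC.
have mc : measurable_fun setT
    (chain W (fun=> running_max eps) (fun=> (0, 0)) 0 h n).
  by apply: (chain_measurable hF hW) => //; [exact: ltW|
    move=> _; exact: measurable_running_max|exact: cst_adapted].
apply: le_trans; apply: ge0_le_integral => //.
- apply/measurable_EFinP; apply: measurableT_comp => //.
  by apply: measurable_funM => //; exact: (measurableT_comp measurable_fst mc).
- by apply/measurable_EFinP; exact: (measurableT_comp mU mc).
- by move=> w _; rewrite lee_fin lerDl expR_ge0.
Qed.

Lemma weighted_sum_chain (la c h : R) (cs : nat -> R) (n : nat) : 0 < h ->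
  (forall k, `|cs k| <= c) ->
  (\int[P]_w (expR (la * \sum_(k < n)
      cs k * (W (k.+1%:R * h) w - W (k%:R * h) w)))%:E
   <= (expR (la ^+ 2 * c ^+ 2 * (n%:R * h)))%:E)%E.
Proof.
move=> h0 hc.
(* The first component accumulates the sum; the second is a dummy. *)
pose phi k (x : R * R * R) := (x.1.1 + cs k * x.2, 0 : R).
have chE w : (chain W phi (fun=> (0, 0)) 0 h n w).1 =
    \sum_(k < n) cs k * (W (k.+1%:R * h) w - W (k%:R * h) w).
  elim: n => [|n IH]; first by rewrite big_ord0.
  by rewrite big_ord_recr /= IH !add0r.
have mphi k : measurable_fun setT (phi k).
  apply: measurable_fun_pair => //; apply: measurable_funD.
    exact: (measurableT_comp measurable_fst).
  by apply: measurable_funM => //; exact: measurable_snd.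
have := @chain_le R d O P F hF W hW phi (fun=> (0, 0))
  (fun x => expR (la * x.1)) (expR (la ^+ 2 * c ^+ 2 * h)) 0 h n (lexx _) h0
  (expR_ge0 _) mphi (cst_adapted (0, 0) (lexx 0)).
rewrite integral_probability_cst /= mulr0 expR0 mule1.
rewrite -expRM_natl [n%:R * (_ * h)]mulrCA.
under eq_integral do rewrite chE; apply => //.
- by apply: measurableT_comp => //; apply: measurable_funM.
- move=> k x; under eq_integral do rewrite /= mulrDr expRD EFinM.
  have mexp : measurable_fun setT (fun z : R => (expR (la * (cs k * z)))%:E).
    apply/measurable_EFinP; apply: measurableT_comp => //.
    by apply: measurable_funM => //; apply: measurable_funM.
  rewrite ge0_integralZl//.
  rewrite [X in (_ <= X%:E)%E]mulrC EFinM; apply: lee_wpmul2l; first by rewrite lee_fin expR_ge0.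
  under eq_integral do rewrite mulrA.
  apply: le_trans (gaussian_mgf_le _ h0) _.
  rewrite lee_fin ler_expR exprMn; apply: (ler_wpM2r (ltW h0)).
  apply: ler_wpM2l; first exact: sqr_ge0.
  by rewrite -(real_normK (num_real (cs k))) lerXn2r ?nnegrE// (le_trans _ (hc 0%N)).
Qed.

End WienerExpMoments.

(** * Analysis on paths *)

Section PathAnalysis.
Context (R : realType).
Implicit Types (a b t : R) (f g : R -> R).

(** Paths are only continuous within an interval. Composing with this retraction onto [[a, b]] gives
    functions continuous on the whole line, to which the calculus lemmas below apply directly. *)
Definition clip a b t : R := Num.max a (Num.min b t).

Lemma clip_itv a b t : a <= b -> a <= clip a b t <= b.
Proof. by move=> ab; rewrite /clip le_max lexx/= ge_max ab ge_min lexx. Qed.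

Lemma clip_id a b t : a <= t <= b -> clip a b t = t.
Proof. by move=> /andP[a_t tb]; rewrite /clip (min_idPr _)// (max_idPr _). Qed.

Lemma clip_continuous a b f : a <= b -> {within `[a, b], continuous f} ->
  continuous (f \o clip a b).
Proof.
move=> ab /subspace_continuousP cf t.
have cab : `[a, b]%classic (clip a b t) by rewrite /= in_itv/= clip_itv.
have clipc : clip a b @ t --> clip a b t.
  apply: (@continuous_max _ _ (cst a)); first exact: cst_continuous.
  by apply: (@continuous_min _ _ (cst b) id); [exact: cst_continuous|exact: cvg_id].
apply: (@cvg_comp _ _ _ (clip a b) f (nbhs t)
  (within `[a, b]%classic (nbhs (clip a b t)))); last exact: cf.
move=> A hA; have /= h := clipc _ hA.
by apply: (@filterS _ (nbhs t) _ _ _ _ h) => s; apply; rewrite in_itv/= clip_itv.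
Qed.

Lemma heine_cantor a b f (e : R) : continuous f -> 0 < e ->
  exists2 del, 0 < del & forall s t, a <= s <= b -> `|t - s| < del ->
    `|f t - f s| < e.
Proof.
move=> cf e0.
have /compact_near_coveringP cov := @segment_compact R a b.
have h : forall x, `[a, b]%classic x -> \forall x' \near x & i \near 0^'+,
    forall t, `|t - x'| < i -> `|f t - f x'| < e.
  move=> x _.
  have e2 : 0 < e / 2 by rewrite divr_gt0.
  have [/= r r0 hr] : exists2 r, 0 < r & forall y, `|x - y| < r -> `|f x - f y| < e / 2.
    have := cf x; move/cvgrPdist_lt => /(_ _ e2).
    by rewrite -nbhs_ballE => -[r /= r0 hr]; exists r => // y xy; apply: hr.
  exists (ball x (r / 2), [set del | del < r / 2]); first split => /=.
  - by apply: nbhsx_ballx; rewrite divr_gt0.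
  - by apply: nbhs_right_lt; rewrite divr_gt0.
  - move=> [y del] /= [xy dr] t ty.
    have h1 : `|f x - f y| < e / 2 by apply: hr; apply: lt_trans xy _; lra.
    have h2 : `|f x - f t| < e / 2.
      apply: hr; have -> : x - t = (x - y) - (t - y) by ring.
      apply: le_lt_trans (ler_normB _ _) _.
      have xy' : `|x - y| < r / 2 := xy.
      lra.
    have -> : f t - f y = (f x - f y) - (f x - f t) by ring.
    apply: le_lt_trans (ler_normB _ _) _; lra.
have H := cov R (0^'+) (fun del s => forall t, `|t - s| < del ->
    `|f t - f s| < e) _ h.
have : \forall del \near 0^'+, 0 < del /\ `[a, b] `<=` (fun s => forall t : R,
    `|t - s| < del -> `|f t - f s| < e).
  near=> del; split; first by near: del; exact: nbhs_right_gt.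
  by near: del; exact: H.
move=> /filter_ex [del [del0 hdel]]; exists del => // s t sab ts.
by apply: hdel => //=; rewrite in_itv.
Unshelve. all: by end_near. Qed.

Lemma continuous_integrable_itv a b f : continuous f ->
  lebesgue_measure.-integrable `[a, b] (EFin \o f).
Proof.
move=> cf; apply: continuous_compact_integrable; first exact: segment_compact.
exact: continuous_subspaceT.
Qed.

Lemma primitive_exists a f : continuous f -> exists J : R -> R,
  (forall t, a <= t -> is_derive t 1 J (f t)) /\
  (forall s t, a <= s <= t ->
    \int[lebesgue_measure]_(x in `[s, t]) f x = J t - J s).
Proof.
(* Starting the integral at [a - 1] makes [a] an interior point, so the primitive has a two-sided
   derivative at [a] too. *)
move=> cf; exists (fun t => \int[lebesgue_measure]_(s in `[a - 1, t]) f s); split.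
  move=> t a_t.
  have t1 : t < t + 1 by rewrite ltrDl.
  have at1 : a - 1 < t by lra.
  have [dJ <-] := continuous_FTC1_closed t1
    (@continuous_integrable_itv (a - 1) (t + 1) f cf) at1 (cf t).
  by rewrite derive1E; exact: DeriveDef.
move=> s t /andP[a_s s_t].
rewrite Rintegral_itvB ?bnd_simp//; last by lra.
  rewrite Rintegral_itv_obnd_cbnd//.
  apply: integrableS (@continuous_integrable_itv s t f cf) => //.
  exact: subset_itv_oc_cc.
exact: continuous_integrable_itv.
Qed.

Lemma eq_Rintegral_clip a b t f : a <= t <= b ->
  \int[lebesgue_measure]_(s in `[a, t]) f s =
  \int[lebesgue_measure]_(s in `[a, t]) (f \o clip a b) s.
Proof.
move=> /andP[a_t tb]; apply: eq_Rintegral => s; rewrite inE/= in_itv/=.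
by move=> /andP[as_ st]; rewrite clip_id// as_ (le_trans st).
Qed.

Lemma Rintegral_clip_bound a t f (M : R) : a <= t -> continuous f ->
  (forall s, a <= s <= t -> `|f s| <= M) ->
  `|\int[lebesgue_measure]_(s in `[a, t]) f s| <= M * (t - a).
Proof.
move=> a_t cf hM.
have intf := @continuous_integrable_itv a t f cf.
apply: le_trans (le_normr_Rintegral _ intf) _ => //.
have -> : M * (t - a) = \int[lebesgue_measure]_(s in `[a, t]) (cst M s).
  rewrite Rintegral_cst//= lebesgue_measure_itv/= lte_fin.
  case: ltP => [_|]; first by rewrite -EFinD.
  by move=> ta; have -> : t = a by [apply/le_anti; rewrite a_t ta]; rewrite subrr.
apply: le_Rintegral => //.
- apply: (@continuous_integrable_itv a t (fun s => `|f s|)) => s.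
  by apply: continuous_comp; [exact: cf|exact: norm_continuous].
- by apply: (@continuous_integrable_itv a t (cst M)); exact: cst_continuous.
Qed.

Lemma gronwall_derive a b (V dV : R -> R) (K F : R) : a <= b -> 0 <= K -> 0 <= F ->
  (forall t, a <= t <= b -> is_derive t 1 V (dV t)) ->
  (forall t, a <= t <= b -> dV t <= K * V t + F) ->
  V b <= expR (K * (b - a)) * (V a + F * (b - a)).
Proof.
move=> ab K0 F0 hV hdV.
(* [G] is nonincreasing: its derivative is at most [F * (exp (- K (t - a)) - 1)], which is
   nonpositive because [K] and [F] are nonnegative. *)
pose G t := expR (- K * (t - a)) * V t - F * (t - a).
pose dG t := expR (- K * (t - a)) * (dV t - K * V t) - F.
have hG t : a <= t <= b -> is_derive t 1 G (dG t).
  move=> tab; have := hV t tab => Vt.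
  have h1 : is_derive t 1 (fun t => - K * (t - a)) (- K).
    by apply: is_derive_eq; rewrite subr0 scaler1.
  have h2 : is_derive t 1 (fun t => expR (- K * (t - a)))
      (- K * expR (- K * (t - a))).
    rewrite mulrC; exact: (@is_derive1_comp _ expR (fun t => - K * (t - a))).
  rewrite /G /dG; apply: is_derive_eq.
  rewrite subr0 /GRing.scale/=; ring.
have [c cab] : exists2 c, c \in `[a, b]%R & G b - G a = dG c * (b - a).
  apply: (@MVT_segment R G dG a b ab).
    by move=> x /subset_itv_oo_cc; rewrite in_itv/= => /hG.
  apply/subspace_continuousP => x /=; rewrite in_itv/= => /hG [dGx _].
  apply: cvg_within_filter.
  by apply: differentiable_continuous; exact/derivable1_diffP.
rewrite in_itv/= in cab.
have dGc : dG c <= 0.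
  have e1 : expR (- K * (c - a)) <= 1.
    rewrite -expR0 ler_expR mulNr oppr_le0 mulr_ge0// subr_ge0.
    by case/andP: cab.
  have := hdV c cab; have := expR_gt0 (- K * (c - a)); rewrite /dG.
  set E := expR _ in e1 *; move=> E0 hc; nra.
move=> E; have : G b <= G a.
  by rewrite -subr_le0 E mulr_le0_ge0// subr_ge0.
rewrite /G subrr !mulr0 subr0 expR0 mul1r => h.
have -> : K * (b - a) = - (- K * (b - a)) by rewrite mulNr opprK.
rewrite expRN mulrC ler_pdivlMr ?expR_gt0// mulrC; lra.
Qed.
End PathAnalysis.

(** * Limits of vanishing mesh *)

(** The limit agrees almost surely with a measurable upper limit, so completeness of [P] makes it
    measurable; Fatou's lemma then carries over the bounds. This serves for path functionals whose
    measurability is not visible from their definition. *)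
Lemma ae_limit_integral_le (R : realType) (d : measure_display)
  (O : measurableType d) (P : probability O R) (cP : measure_is_complete P)
  (u : nat -> O -> R) (f : O -> R) :
  (forall n, measurable_fun setT (u n)) ->
  {ae P, forall w, u n w @[n --> \oo] --> f w} ->
  measurable_fun setT f /\
  forall (g : R -> R) (C : R), continuous g -> (forall x, 0 <= g x) ->
    (forall n, (\int[P]_w (g (u n w))%:E <= C%:E)%E) ->
    (\int[P]_w (g (f w))%:E <= C%:E)%E.
Proof.
move=> mu uf.
have mf : measurable_fun setT f.
  apply/measurable_EFinP.
  apply: (ae_measurable_fun cP (f := fun w => limn_esup (fun n => (u n w)%:E))).
    apply: filterS uf => w uw _.
    have : (u n w)%:E @[n --> \oo] --> (f w)%:E by apply: cvg_EFin => //; exact: nearW.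
    by case/cvg_limn_einf_sup => _ ->.
  by apply: measurable_fun_limn_esup => n; apply/measurable_EFinP.
split => // g C cg g0 hC.
have mg : measurable_fun setT g by exact: continuous_measurable_fun.
have mgu n : measurable_fun setT (fun w => (g (u n w))%:E).
  by apply/measurable_EFinP; exact: measurableT_comp.
have -> : (\int[P]_w (g (f w))%:E =
    \int[P]_w limn_einf (fun n => (g (u n w))%:E))%E.
  apply: ge0_ae_eq_integral => //.
  - by apply/measurable_EFinP; exact: measurableT_comp.
  - rewrite (_ : (fun w => _) = (fun w => - limn_esup (fun n => - (g (u n w))%:E))%E).
      apply: measurableT_comp => //; apply: measurable_fun_limn_esup => n.
      exact: measurableT_comp.
    apply/funext => w; rewrite -limn_einfN; congr limn_einf.
    by apply/funext => n; rewrite /= opprK.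
  - by move=> w _; rewrite lee_fin.
  - move=> w _; rewrite limn_einf_lim; apply: lime_ge.
      exact: is_cvg_einfs.
    apply: nearW => n; apply: le_ereal_inf_tmp => _ [k _ <-].
    by rewrite lee_fin.
  - apply: filterS uf => w uw _.
    have gu : g (u n w) @[n --> \oo] --> g (f w) by apply: cvg_comp uw _; exact: cg.
    have : (g (u n w))%:E @[n --> \oo] --> (g (f w))%:E.
      by apply: cvg_EFin => //; exact: nearW.
    by case/cvg_limn_einf_sup => -> _.
apply: le_trans (fatou P measurableT _ _) _ => //.
  by move=> n w _; rewrite lee_fin.
rewrite limn_einf_lim; apply: lime_le; first exact: is_cvg_einfs.
apply: nearW => n; apply: le_trans (hC n).
by apply: ereal_inf_lbound; exists n => /=.
Qed.

Lemma cvg_dominated_by (R : realType) (u : nat -> R) (l c : R) :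
  0 <= c ->
  (forall e : R, 0 < e -> \forall n \near \oo, `|u n - l| <= c * e) ->
  u @ \oo --> l.
Proof.
move=> c0 h; apply/cvgrPdist_lt => e e0.
have e1 : 0 < e / (c + 1) by rewrite divr_gt0// ltr_wpDl.
apply: filterS (h _ e1) => n hn; rewrite distrC; apply: le_lt_trans hn _.
rewrite mulrA ltr_pdivrMr ?ltr_wpDl// mulrC ltr_pM2l//; lra.
Qed.

Lemma near_mesh_lt (R : realType) (T del : R) : 0 < del ->
  \forall n \near \oo, T / n.+1%:R < del.
Proof.
move=> del0; near=> n.
rewrite ltr_pdivrMr// -ltr_pdivrMl// mulrC.
apply: lt_trans (_ : n%:R < _); last by rewrite ltr_nat.
near: n; exact: nbhs_infty_gtr.
Unshelve. all: by end_near. Qed.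

(** Each implicit step adds at most [v / 2 * h * e], where [e] is the oscillation of [Z] over one
    mesh, and the denominator, being at least 1, does not amplify earlier errors. The driver [g] is
    [sigma * W] for the momentum and 0 for the position. *)
Lemma ou_euler_error (R : realType) (a b v e : R) (Z g : R -> R) (z0 : R)
  (z : nat -> R) (K : nat) (h := (b - a) / K%:R) :
  a <= b -> 0 < v -> 0 <= e -> (0 < K)%N -> continuous Z ->
  (forall t, a <= t <= b ->
    Z t = z0 + \int[lebesgue_measure]_(s in `[a, t]) (- (v / 2) * Z s)
             + (g t - g a)) ->
  (forall s t, a <= s <= b -> a <= t <= b -> `|t - s| <= h -> `|Z t - Z s| <= e) ->
  z 0%N = z0 ->
  (forall j, z j.+1 =
    (z j + (g (a + j.+1%:R * h) - g (a + j%:R * h))) / (1 + v / 2 * h)) ->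
  `|z K - Z b| <= v / 2 * (b - a) * e.
Proof.
move=> ab v0 e0 K0 cZ ZE osc z00 zS.
have K0' : 0 < K%:R :> R by rewrite ltr0n.
have h0 : 0 <= h by rewrite /h divr_ge0 ?subr_ge0// ltW.
have vh : 0 <= v / 2 * h by rewrite mulr_ge0// divr_ge0// ltW.
have hK : a + K%:R * h = b by rewrite /h mulrC divfK ?gt_eqF// addrC subrK.
have [J [dJ JE]] := @primitive_exists R a (fun s => - (v / 2) * Z s)
  (fun x => cvgM (cvg_cst _) (cZ x)).
have sj j : (j <= K)%N -> a <= a + j%:R * h <= b.
  by move=> jK; rewrite lerDl mulr_ge0// -hK lerD2l ler_wpM2r// ler_nat.
have hE j : a + j.+1%:R * h - (a + j%:R * h) = h by rewrite -natr1; ring.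
suff H j : (j <= K)%N -> `|z j - Z (a + j%:R * h)| <= j%:R * (v / 2 * h * e).
  have := H K (leqnn K); rewrite hK => /le_trans; apply.
  by rewrite -[X in _ <= _ * (X - _) * _]hK; lra.
elim: j => [|j IH] jK.
  rewrite !mul0r addr0 z00 ZE ?lexx//.
  by rewrite set_itv1 Rintegral_set1 subrr !addr0 subrr normr0.
have {}IH := IH (ltnW jK).
set s := a + j%:R * h in IH *; set t := a + j.+1%:R * h.
have sab : a <= s <= b by apply: sj; exact: ltnW.
have tab : a <= t <= b by exact: sj.
have st : t - s = h by exact: hE.
have le_st : s <= t by rewrite -subr_ge0 st.
have [c cst Jc] : exists2 c, c \in `[s, t]%R & J t - J s = - (v / 2) * Z c * (t - s).
  apply: (@MVT_segment R J (fun s => - (v / 2) * Z s) s t le_st).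
    move=> x; rewrite in_itv/= => /andP[sx _]; apply: dJ.
    by apply: le_trans (ltW sx); case/andP: sab.
  apply/subspace_continuousP => x /=; rewrite in_itv/= => /andP[sx _].
  have [dJx _] : is_derive x 1 J (- (v / 2) * Z x).
    by apply: dJ; apply: le_trans sx; case/andP: sab.
  apply: cvg_within_filter.
  by apply: differentiable_continuous; exact/derivable1_diffP.
have cst' : s <= c <= t by move: cst; rewrite in_itv.
have osc_c : `|Z t - Z c| <= e.
  apply: osc => //; first by lra.
  by rewrite ger0_norm ?subr_ge0; lra.
have Zst : Z t = Z s - v / 2 * h * Z c + (g t - g s).
  rewrite (ZE t)// (ZE s)// !JE ?lexx//=; [|by case/andP: sab|by case/andP: tab].
  have -> : J t = J s - v / 2 * h * Z c by rewrite -st; lra.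
  by ring.
rewrite zS -/t -/s.
have D0 : 0 < 1 + v / 2 * h by lra.
(* Both recursions contain the same [g t - g s], which cancels; what remains is the old error and
   the quadrature error of replacing [Z c] by [Z t]. *)
have -> : (z j + (g t - g s)) / (1 + v / 2 * h) - Z t =
    ((z j - Z s) - v / 2 * h * (Z t - Z c)) / (1 + v / 2 * h).
  have E : g t - g s = Z t - Z s + v / 2 * h * Z c by rewrite Zst; ring.
  have [D DE] : exists D, D = 1 + v / 2 * h by eexists.
  have vhE : v / 2 * h = D - 1 by rewrite DE; ring.
  have Dn0 : D != 0 by rewrite DE gt_eqF.
  by rewrite -DE E vhE; field.
rewrite normrM normfV (gtr0_norm D0) ler_pdivrMr//.
apply: le_trans (ler_normB _ _) _; rewrite normrM (ger0_norm vh).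
have k1 : v / 2 * h * `|Z t - Z c| <= v / 2 * h * e by rewrite ler_wpM2l.
have k2 : 0 <= v / 2 * h * e by rewrite mulr_ge0.
have k3 : 0 <= j.+1%:R * (v / 2 * h * e) by rewrite mulr_ge0.
apply: (@le_trans _ _ (j.+1%:R * (v / 2 * h * e))); last first.
  by rewrite ler_peMr// lerDl.
have -> : j.+1%:R = j%:R + 1 :> R by rewrite natr1.
rewrite mulrDl mul1r; lra.
Qed.

Lemma coercive_hamiltonian_cvg (R : realType) (v p q : R) (x : nat -> R * R) :
  (x n).1 @[n --> \oo] --> p -> (x n).2 @[n --> \oo] --> q ->
  coercive_hamiltonian v (x n) @[n --> \oo] --> coercive_hamiltonian v (p, q).
Proof.
move=> xp xq; rewrite /coercive_hamiltonian /hamiltonian.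
have X k (y : nat -> R) (l : R) : y @ \oo --> l -> (y n ^+ k) @[n --> \oo] --> l ^+ k.
  by move=> yl; apply: (cvg_comp _ (fun z => z ^+ k) yl); exact: exprn_continuous.
apply: cvgD; last exact: cvg_cst.
apply: cvgD; first apply: cvgD.
- by apply: cvgM; [exact: X|exact: cvg_cst].
- by apply: cvgM; [exact: X|exact: cvg_cst].
- by apply: cvgM => //; apply: cvgM => //; exact: cvg_cst.
Qed.

(** * Exponential moments of the stochastic flow and of the running supremum *)

Section Moments.
Context (R : realType) (d : measure_display) (O : measurableType d).
Context (P : probability O R) (cP : measure_is_complete P).
Context (F : R -> set (set O)) (hF : filtration F).
Context (W : R -> O -> R) (hW : wiener_process P F W).

(** The bound for the Euler chain depends on the mesh only through [n h = b - a], so it survives the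
    limit; [b - a <= 1] keeps every mesh at most 1. *)
Lemma ou_exp_moment (v sigma be a b C : R) (X0 Y0 : O -> R) (X Y : R -> O -> R) :
  0 < v -> 0 <= be -> 2 * be * sigma ^+ 2 <= v -> 2 * be * sigma ^+ 2 <= 1 ->
  0 <= a -> a < b -> b - a <= 1 ->
  (forall B : set (R * R), measurable B -> F a ((fun w => (X0 w, Y0 w)) @^-1` B)) ->
  additive_noise_solution P F W sigma
    (fun x => - (v / 2) * x.1) (fun x => - (v / 2) * x.2) `[a, b] a X0 Y0 X Y ->
  (\int[P]_w (expR (be * coercive_hamiltonian v (X0 w, Y0 w)))%:E <= C%:E)%E ->
  (\int[P]_w (expR (be * coercive_hamiltonian v (X b w, Y b w)))%:E <=
   (expR (be * (v * (v ^+ 4 / 8 + 1) + sigma ^+ 2) * (b - a)) * C)%:E)%E.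
Proof.
move=> v0 be0 bev be1 a0 ab ba1 hX0 [_ cXY eqX eqY] hC.
have ab' : a <= b by exact: ltW.
pose h n : R := (b - a) / n.+1%:R.
have h0 n : 0 < h n by rewrite divr_gt0// subr_gt0.
have h1 n : h n <= 1.
  by rewrite ler_pdivrMr// mul1r (le_trans ba1)// ler1n.
have hn n : n.+1%:R * h n = b - a by rewrite mulrC divfK.
pose c n w := chain W (fun=> damped_euler v sigma (h n))
  (fun w => (X0 w, Y0 w)) a (h n) n.+1 w.
have mc n : measurable_fun setT (c n).
  apply: (chain_measurable hF hW) => //; first exact: ltW.
  by move=> _; exact: measurable_damped_euler.
pose u n w := be * coercive_hamiltonian v (c n w).
have mu n : measurable_fun setT (u n).
  apply: measurable_funM => //.
  exact: (measurableT_comp (measurable_coercive_hamiltonian v) (mc n)).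
have cu : {ae P, forall w, u n w @[n --> \oo] -->
    be * coercive_hamiltonian v (X b w, Y b w)}.
  have cW := wiener_continuous hW.
  apply: filterS (filterI (filterI cW cXY) (filterI eqX eqY)) => w [[cWw [cXw cYw]] [eqXw eqYw]].
  apply: cvgMr; apply: coercive_hamiltonian_cvg.
  + pose Z := (fun t => X t w) \o clip a b.
    have cZ : continuous Z by exact: clip_continuous.
    apply: (@cvg_dominated_by _ _ _ (v / 2 * (b - a))).
      by rewrite mulr_ge0 ?subr_ge0// divr_ge0// ltW.
    move=> e e0; have [del del0 hdel] := @heine_cantor R a b Z e cZ e0.
    apply: filterS (near_mesh_lt (b - a) del0) => n hdn.
    have -> : X b w = Z b by rewrite /Z/= clip_id// lexx ab'.
    apply: (@ou_euler_error R a b v e Z (fun t => sigma * W t w) (X0 w)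
      (fun j => (chain W (fun=> damped_euler v sigma (h n))
        (fun w => (X0 w, Y0 w)) a (h n) j w).1) n.+1) => //; first exact: ltW.
    * move=> t tab; have tI : `[a, b]%classic t by rewrite /= in_itv.
      rewrite {1}/Z/= clip_id// (eqXw t tI).
      rewrite mulrBr; congr (_ + _ + _).
      by rewrite (eq_Rintegral_clip (fun s => - (v / 2) * X s w) tab).
    * by move=> s t sab tab st; apply/ltW/hdel => //; exact: le_lt_trans hdn.
    * by move=> j; rewrite -mulrBr.
  + pose Z := (fun t => Y t w) \o clip a b.
    have cZ : continuous Z by exact: clip_continuous.
    apply: (@cvg_dominated_by _ _ _ (v / 2 * (b - a))).
      by rewrite mulr_ge0 ?subr_ge0// divr_ge0// ltW.
    move=> e e0; have [del del0 hdel] := @heine_cantor R a b Z e cZ e0.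
    apply: filterS (near_mesh_lt (b - a) del0) => n hdn.
    have -> : Y b w = Z b by rewrite /Z/= clip_id// lexx ab'.
    apply: (@ou_euler_error R a b v e Z (fun=> 0) (Y0 w)
      (fun j => (chain W (fun=> damped_euler v sigma (h n))
        (fun w => (X0 w, Y0 w)) a (h n) j w).2) n.+1) => //; first exact: ltW.
    * move=> t tab; have tI : `[a, b]%classic t by rewrite /= in_itv.
      rewrite {1}/Z/= clip_id// (eqYw t tI).
      rewrite subrr addr0; congr (_ + _).
      by rewrite (eq_Rintegral_clip (fun s => - (v / 2) * Y s w) tab).
    * by move=> s t sab tab st; apply/ltW/hdel => //; exact: le_lt_trans hdn.
    * by move=> j; rewrite subrr addr0.
have [_] := ae_limit_integral_le cP mu cu.
move=> /(_ (@expR R)); apply.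
- exact: continuous_expR.
- by move=> x; exact: expR_ge0.
- move=> n; apply: le_trans (damped_euler_chain hF hW n.+1 v0 (h0 n) (h1 n)
    be0 bev be1 a0 hX0) _.
  by rewrite hn EFinM; apply: lee_wpmul2l => //; rewrite lee_fin expR_ge0.
Qed.

(** The first component is the least nonnegative upper bound of the values on the grid; this is all
    that is needed to compare it with the supremum of the path. *)
Lemma running_max_spec (eps h : R) n w :
  let c := chain W (fun=> running_max eps) (fun=> (0, 0)) 0 h n w in
  [/\ c.2 = eps * (W (n%:R * h) w - W 0 w), 0 <= c.1,
    (forall i, (i <= n)%N -> eps * (W (i%:R * h) w - W 0 w) <= c.1) &
    (forall M, 0 <= M -> (forall i, (i <= n)%N ->
      eps * (W (i%:R * h) w - W 0 w) <= M) -> c.1 <= M)].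
Proof.
elim: n => [|n [c2 c1 cge cle]] /=.
  rewrite mul0r subrr mulr0; split => //.
  by move=> i; rewrite leqn0 => /eqP ->; rewrite mul0r subrr mulr0.
rewrite !add0r c2 -mulrDr.
have -> : W (n%:R * h) w - W 0 w + (W (n.+1%:R * h) w - W (n%:R * h) w) =
  W (n.+1%:R * h) w - W 0 w by ring.
split => //.
- by rewrite le_max c1.
- move=> i; rewrite leq_eqVlt => /predU1P[->|]; first by rewrite le_max lexx orbT.
  by rewrite ltnS => /cge h1; rewrite le_max h1.
- move=> M M0 hM; rewrite ge_max hM// andbT; apply: cle => // i i_n.
  by apply: hM; exact: leqW.
Qed.

Lemma wiener_sup_exp_moment (T : R) : 0 < T -> exists S : O -> R,
  [/\ measurable_fun setT S, (forall w, 0 <= S w),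
    {ae P, forall w, forall t, 0 <= t <= T -> `|W t w - W 0 w| <= S w} &
    forall la, 0 <= la ->
      (\int[P]_w (expR (la * S w))%:E <= (4 * expR (4 * la ^+ 2 * T))%:E)%E].
Proof.
move=> T0.
pose h n : R := T / n.+1%:R.
have h0 n : 0 < h n by rewrite divr_gt0.
have hn n : n.+1%:R * h n = T by rewrite mulrC divfK.
pose c eps n w := (chain W (fun=> running_max eps) (fun=> (0, 0)) 0 (h n) n.+1 w).1.
have mc eps n : measurable_fun setT (c eps n).
  apply: (measurableT_comp measurable_fst); apply: (chain_measurable hF hW) => //.
  - exact: ltW.
  - by move=> _; exact: measurable_running_max.
  - exact: (cst_adapted hF).
pose f n w := Num.max (c 1 n w) (c (-1) n w).
have mf n : measurable_fun setT (f n) by exact: measurable_maxr.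
pose M w := limn (f ^~ w).
have key : {ae P, forall w, f n w @[n --> \oo] --> M w /\
    forall t, 0 <= t <= T -> `|W t w - W 0 w| <= M w}.
  apply: filterS (wiener_continuous hW) => w cWw.
  have cW : {within `[0, T], continuous (fun t => W t w)}.
    by apply: continuous_subspaceW cWw => x /=; rewrite !in_itv/= => /andP[->].
  pose Z t := `|W (clip 0 T t) w - W 0 w|.
  have cZ : continuous Z.
    move=> x; apply: cvg_norm; apply: cvgB; last exact: cvg_cst.
    exact: (clip_continuous (ltW T0) cW).
  have [m mT hm] := EVT_max (ltW T0) (continuous_subspaceT cZ).
  rewrite in_itv/= in mT.
  have Zle t : 0 <= t <= T -> `|W t w - W 0 w| <= Z m.
    by move=> tT; have := hm t; rewrite in_itv/= tT /Z clip_id//; apply.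
  have Zm0 : 0 <= Z m by exact: normr_ge0.
  have fM : f n w @[n --> \oo] --> Z m.
    apply: (@cvg_dominated_by _ _ _ 1) => // e e0.
    have [del del0 hdel] := @heine_cantor R 0 T Z e cZ e0.
    apply: filterS (near_mesh_lt T del0) => n hdn; rewrite mul1r.
    have [_ c1 cge cle] := running_max_spec 1 (h n) n.+1 w.
    have [_ c1' cge' cle'] := running_max_spec (-1) (h n) n.+1 w.
    have grid_T i : (i <= n.+1)%N -> 0 <= i%:R * h n <= T.
      move=> i_n; rewrite mulr_ge0 ?(ltW (h0 n))//= -(hn n).
      by rewrite ler_wpM2r ?(ltW (h0 n))// ler_nat.
    have fle : f n w <= Z m.
      rewrite ge_max; apply/andP; split; [apply: cle|apply: cle'] => //.
      - by move=> i i_n; rewrite mul1r; apply: le_trans (ler_norm _) (Zle _ (grid_T i i_n)).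
      - move=> i i_n; rewrite mulN1r.
        by apply: le_trans (ler_norm _) _; rewrite normrN; exact: Zle (grid_T i i_n).
    have fge : Z m - e <= f n w.
      (* The last grid point before the maximizer [m] lies within one mesh of it. *)
      pose i := Num.truncn (m / h n).
      have m0 : 0 <= m by case/andP: mT.
      have /andP[i1 i2] : i%:R <= m / h n < i.+1%:R.
        by apply: truncn_itv; rewrite divr_ge0// ltW.
      have i_n : (i <= n.+1)%N.
        rewrite -(ler_nat R); apply: le_trans i1 _.
        by rewrite ler_pdivrMr// hn; case/andP: mT.
      rewrite ler_pdivlMr// in i1; rewrite ltr_pdivrMr// in i2.
      have : `|Z m - Z (i%:R * h n)| < e.
        apply: hdel; first exact: grid_T.
        apply: lt_trans hdn; rewrite ger0_norm ?subr_ge0//.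
        by rewrite ltrBlDl; move: i2; rewrite -natr1 mulrDl mul1r.
      have : Z (i%:R * h n) <= f n w.
        rewrite {1}/Z clip_id; last exact: grid_T.
        have := cge i i_n; have := cge' i i_n; rewrite mulN1r mul1r => h1 h2.
        rewrite ler_norml lerNl; apply/andP; split; rewrite le_max; apply/orP.
          by right.
        by left.
      by move=> h1 h2; have := ler_norm (Z m - Z (i%:R * h n)); lra.
    by rewrite ler_norml; apply/andP; split; lra.
  have ME : M w = Z m by exact: cvg_lim fM.
  by rewrite ME.
have f0 n w : 0 <= f n w.
  by rewrite le_max; have [_ -> _ _] := running_max_spec 1 (h n) n.+1 w.
have [mM hM] := @ae_limit_integral_le R d O P cP f M mf
  (filterS (fun w (H : _ /\ _) => H.1) key).
(* Where the grid maxima fail to converge, [limn] is a default value; the maximum with 0 ensures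
   nonnegativity on every path. *)
exists (fun w => Num.max 0 (M w)); split.
- exact: measurable_maxr.
- by move=> w; rewrite le_max lexx.
- apply: filterS key => w [_ hw] t tT.
  by rewrite le_max hw ?orbT.
move=> la la0.
have max0 : {ae P, forall w, expR (la * Num.max 0 (M w)) = expR (la * M w)}.
  apply: filterS key => w [fM _]; congr (expR (la * _)); apply/max_idPr.
  by rewrite -(cvg_lim _ fM)//; apply: limr_ge; [apply/cvg_ex; exists (M w)|exact: nearW].
rewrite (_ : (\int[P]_w _ = \int[P]_w (expR (la * M w))%:E)%E); last first.
  apply: ge0_ae_eq_integral => //.
  - apply/measurable_EFinP; apply: measurableT_comp => //.
    by apply: measurable_funM => //; exact: measurable_maxr.
  - apply/measurable_EFinP; apply: measurableT_comp => //.
    exact: measurable_funM.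
  - by apply: filterS max0 => w -> _.
apply: (hM (fun x => expR (la * x))).
- by move=> x; apply: continuous_comp; [exact: mulrl_continuous|exact: continuous_expR].
- by move=> x; exact: expR_ge0.
move=> n.
have mec eps : measurable_fun setT (fun w => (expR (la * c eps n w))%:E).
  apply/measurable_EFinP; apply: measurableT_comp => //.
  exact: measurable_funM.
apply: (@le_trans _ _ (\int[P]_w ((expR (la * c 1 n w))%:E +
    (expR (la * c (-1) n w))%:E))%E).
  apply: ge0_le_integral => //.
  - apply/measurable_EFinP; apply: measurableT_comp => //.
    exact: measurable_funM.
  - exact: emeasurable_funD.
  - move=> w _; rewrite -EFinD lee_fin /f.
    case: (leP (c 1 n w) (c (-1) n w)) => _; [rewrite lerDr|rewrite lerDl];
      exact: expR_ge0.
rewrite ge0_integralD//.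
have e1 : (1 : R) ^+ 2 = 1 by rewrite expr1n.
have e2 : (-1 : R) ^+ 2 = 1 by rewrite sqrrN expr1n.
apply: le_trans (leeD (running_max_chain hF hW la n.+1 (h0 n) e1)
  (running_max_chain hF hW la n.+1 (h0 n) e2)) _.
rewrite -EFinD lee_fin hn; lra.
Qed.
End Moments.

(** * The time integral of the Wiener increments *)

(** Abel summation: the left Riemann sum of [W - W_{t_m}] over a step becomes a weighted sum of
    independent increments, the form covered by [weighted_sum_chain]. *)
Lemma sum_block_by_parts (R : realType) (w : nat -> R) (n : nat) :
  \sum_(j < n) (n - j.+1)%:R * (w j.+1 - w j) = \sum_(j < n) (w j - w 0%N).
Proof.
elim: n => [|n IH]; first by rewrite !big_ord0.
rewrite big_ord_recr/= subnn mul0r addr0 big_ord_recr/= -IH.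
have -> : w n - w 0%N = \sum_(j < n) (w j.+1 - w j).
  by rewrite -(big_mkord predT (fun j => w j.+1 - w j)) telescope_sumr.
rewrite -big_split/=; apply: eq_bigr => -[j jn] _ /=.
by rewrite subSS -(subnSK jn) -natr1 mulrDl mul1r.
Qed.

Lemma block_area_error (R : realType) (h e : R) (w J : nat -> R) (n : nat) :
  (forall j, (j < n)%N -> `|J j.+1 - J j - h * w j| <= h * e) ->
  `|h * \sum_(j < n) (n - j.+1)%:R * (w j.+1 - w j) -
    (J n - J 0%N - n%:R * h * w 0%N)| <= n%:R * h * e.
Proof.
rewrite sum_block_by_parts; elim: n => [|n IH] H.
  by rewrite big_ord0 mulr0 !mul0r subrr subr0 subrr normr0.
have {}IH := IH (fun j jn => H j (ltnW jn)).
have {}H := H n (ltnSn n).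
rewrite big_ord_recr/= mulrDr.
set S := h * _ in IH *.
have -> : n.+1%:R = n%:R + 1 :> R by rewrite natr1.
have -> : S + h * (w n - w 0%N) - (J n.+1 - J 0%N - (n%:R + 1) * h * w 0%N) =
  (S - (J n - J 0%N - n%:R * h * w 0%N)) - (J n.+1 - J n - h * w n) by ring.
apply: le_trans (ler_normB _ _) _; lra.
Qed.

Lemma sum_ord_blocks (R : realType) (F : nat -> R) (m K : nat) :
  \sum_(i < m * K) F i = \sum_(k < m) \sum_(j < K) F (k * K + j)%N.
Proof.
elim: m => [|m IH]; first by rewrite mul0n !big_ord0.
by rewrite mulSnr big_split_ord/= IH big_ord_recr.
Qed.

Section Area.
Context (R : realType) (d : measure_display) (O : measurableType d).
Context (P : probability O R) (cP : measure_is_complete P).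
Context (F : R -> set (set O)) (hF : filtration F).
Context (W : R -> O -> R) (hW : wiener_process P F W).

(** The process [N] of the overview at time [t_m]. Each summand is a centred Gaussian of variance
    [tau^3 / 3]. *)
Definition area (tau : R) (m : nat) (w : O) : R :=
  \sum_(k < m) (\int[lebesgue_measure]_(s in `[grid tau k, grid tau k.+1]) W s w
                - tau * W (grid tau k) w).

(** Every step is cut into [n + 1] pieces and all Riemann sums are merged into one sum over
    [i = k (n + 1) + j]. The weight depends on [j], recovered as a remainder, so a single chain runs
    through all steps. *)
Lemma area_approx (tau : R) (m : nat) (w : O) : 0 < tau ->
  {within `[0, +oo[, continuous (fun t => W t w)} ->
  (tau / n.+1%:R) * (\sum_(i < m * n.+1) (n.+1 - (i %% n.+1).+1)%:R *
     (W (i.+1%:R * (tau / n.+1%:R)) w - W (i%:R * (tau / n.+1%:R)) w))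
  @[n --> \oo] --> area tau m w.
Proof.
move=> tau0 cW; pose T := m%:R * tau.
have T0 : 0 <= T by rewrite mulr_ge0// ltW.
have cWT : {within `[0, T], continuous (fun t => W t w)}.
  by apply: continuous_subspaceW cW => x /=; rewrite !in_itv/= => /andP[->].
pose Z := (fun t => W t w) \o clip 0 T.
have cZ : continuous Z by exact: clip_continuous.
have ZE t : 0 <= t <= T -> W t w = Z t by move=> tT; rewrite /Z/= clip_id.
have [J [dJ JE]] := @primitive_exists R 0 Z cZ.
have gT k : (k <= m)%N -> 0 <= grid tau k <= T.
  by move=> km; rewrite /grid /T mulr_ge0 ?(ltW tau0)//= ler_wpM2r ?(ltW tau0)// ler_nat.
have areaE : area tau m w =
    \sum_(k < m) (J (grid tau k.+1) - J (grid tau k) - tau * Z (grid tau k)).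
  apply: eq_bigr => -[k km] _ /=; rewrite -ZE ?gT//; last exact: ltnW.
  congr (_ - _); have /andP[k0 kT] := gT _ (ltnW km); have /andP[_ k1T] := gT _ km.
  have kk : grid tau k <= grid tau k.+1.
    by rewrite /grid ler_wpM2r ?(ltW tau0)// ler_nat.
  rewrite -JE ?k0//; apply: eq_Rintegral => s; rewrite inE/= in_itv/= => /andP[s1 s2].
  by rewrite -ZE// (le_trans k0)//= (le_trans s2).
apply: (@cvg_dominated_by _ _ _ T) => // e e0.
have [del del0 hdel] := @heine_cantor R 0 T Z e cZ e0.
apply: filterS (near_mesh_lt tau del0) => n hn.
set h := tau / n.+1%:R in hn *.
have h0 : 0 < h by rewrite divr_gt0.
have hK : n.+1%:R * h = tau by rewrite mulrC divfK.
have gE k : grid tau k = (k * n.+1)%:R * h by rewrite natrM -mulrA hK.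
rewrite (sum_ord_blocks (fun i => (n.+1 - (i %% n.+1).+1)%:R *
  (W (i.+1%:R * h) w - W (i%:R * h) w))) mulr_sumr areaE -sumrB.
apply: le_trans (ler_norm_sum _ _ _) _.
have -> : T * e = \sum_(k < m) (tau * e).
  by rewrite sumr_const card_ord -mulrnAl /T mulr_natl.
apply: ler_sum => -[k km] _ /=.
have gridT i : (i <= m * n.+1)%N -> 0 <= i%:R * h <= T.
  move=> im; rewrite mulr_ge0 ?(ltW h0)//= /T -hK mulrA -natrM.
  by rewrite ler_wpM2r ?(ltW h0)// ler_nat.
have kj j : (j <= n.+1)%N -> (k * n.+1 + j <= m * n.+1)%N.
  move=> jn; apply: (@leq_trans (k.+1 * n.+1)); first by rewrite mulSnr leq_add2l.
  by rewrite leq_mul2r km orbT.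
have H : `|h * \sum_(j < n.+1) (n.+1 - j.+1)%:R *
    (Z ((k * n.+1 + j.+1)%:R * h) - Z ((k * n.+1 + j)%:R * h)) -
    (J ((k * n.+1 + n.+1)%:R * h) - J ((k * n.+1 + 0)%:R * h) -
     n.+1%:R * h * Z ((k * n.+1 + 0)%:R * h))| <= n.+1%:R * h * e.
  apply: (block_area_error (w := fun j => Z ((k * n.+1 + j)%:R * h))
    (J := fun j => J ((k * n.+1 + j)%:R * h))) => j jn.
  set s := _%:R * h; set t := _%:R * h.
  have st : s - t = h by rewrite /s /t addnS -natr1; ring.
  have t_s : t <= s by rewrite -subr_ge0 st ltW.
  have /andP[t0 tT] : 0 <= t <= T by apply: gridT; apply: kj; exact: ltnW.
  have [c cst ->] : exists2 c, c \in `[t, s]%R & J s - J t = Z c * (s - t).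
    apply: (@MVT_segment R J Z t s t_s).
      move=> x; rewrite in_itv/= => /andP[tx _]; apply: dJ.
      exact: le_trans (ltW tx).
    apply/subspace_continuousP => x /=; rewrite in_itv/= => /andP[tx _].
    have [dJx _] : is_derive x 1 J (Z x) by apply: dJ; exact: le_trans tx.
    apply: cvg_within_filter.
    by apply: differentiable_continuous; exact/derivable1_diffP.
  rewrite in_itv/= in cst; case/andP: cst => tc cs.
  have : `|Z c - Z t| < e.
    apply: hdel; first by rewrite t0 tT.
    by apply: le_lt_trans hn; rewrite ger0_norm ?subr_ge0//; lra.
  rewrite st (_ : Z c * h - h * Z t = h * (Z c - Z t)); last by ring.
  by rewrite normrM gtr0_norm// ler_pM2l// => /ltW.
rewrite hK addn0 -mulSnr -!gE in H.
apply: le_trans H; rewrite le_eqVlt; apply/orP; left; apply/eqP.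
congr `|h * _ - _|; apply: eq_bigr => -[j jn] _ /=.
rewrite modnMDl modn_small// addnS; congr (_ * _).
by rewrite -!ZE// ?addnS; apply: gridT; rewrite -?addnS; apply: kj; rewrite // ltnW.
Qed.

(** All weights are at most [tau], which produces the factor [tau ^+ 2]: [area / tau] has
    exponential moments bounded in terms of [m tau] alone. This is where order one is gained over
    order 1/2. *)
Lemma area_exp_moment (tau : R) (m : nat) : 0 < tau ->
  measurable_fun setT (area tau m) /\
  forall la, (\int[P]_w (expR (la * area tau m w))%:E <=
    (expR (la ^+ 2 * tau ^+ 2 * (m%:R * tau)))%:E)%E.
Proof.
move=> tau0; pose h n : R := tau / n.+1%:R.
have h0 n : 0 < h n by rewrite divr_gt0.
have hn n : n.+1%:R * h n = tau by rewrite mulrC divfK.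
pose cs n i : R := h n * (n.+1 - (i %% n.+1).+1)%:R.
pose u n w := \sum_(i < m * n.+1) cs n i * (W (i.+1%:R * h n) w - W (i%:R * h n) w).
have mu n : measurable_fun setT (u n).
  apply: measurable_sum => i; apply: measurable_funM => //.
  by apply: measurable_funB; apply: (wiener_measurable hF hW);
    rewrite mulr_ge0// ltW.
have cu : {ae P, forall w, u n w @[n --> \oo] --> area tau m w}.
  apply: filterS (wiener_continuous hW) => w cw.
  rewrite (_ : u ^~ w = fun n => h n * (\sum_(i < m * n.+1)
    (n.+1 - (i %% n.+1).+1)%:R * (W (i.+1%:R * h n) w - W (i%:R * h n) w))).
    exact: (@area_approx tau m w tau0 cw).
  by apply/funext => n; rewrite mulr_sumr; apply: eq_bigr => i _; rewrite /cs mulrA.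
have [ma hM] := ae_limit_integral_le cP mu cu.
split => // la; apply: (hM (fun x => expR (la * x))).
- by move=> x; apply: continuous_comp; [exact: mulrl_continuous|exact: continuous_expR].
- by move=> x; exact: expR_ge0.
- move=> n.
  have hcs k : `|cs n k| <= tau.
    have c0 : 0 <= cs n k by rewrite /cs mulr_ge0// ltW.
    rewrite (ger0_norm c0) -(hn n) /cs mulrC.
    by rewrite ler_wpM2r ?(ltW (h0 n))// ler_nat leq_subr.
  apply: le_trans (weighted_sum_chain hF hW la (m * n.+1) (h0 n) hcs) _.
  by rewrite natrM -[_ * _ * h n]mulrA hn.
Qed.
End Area.

(** * The error along one step *)

Section OneStep.
Context (R : realType).

(** The quartic term is the potential of the equation evaluated at the error: along the dynamics its
    derivative [r^3 u] cancels the term [- u r^3] of the expanded cubic. *)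
Definition error_energy (u r : R) : R := u * u / 2 + r * r / 2 + r * r * (r * r) / 4.

(* The cubic is expanded as [(c + y + r)^3 - q^3] with [c + y = q + z]; [y] is
   the (unbounded) Gaussian shift and may enter the Gronwall rate only
   linearly, so [y^2 u r] is absorbed by the quartic term of the energy. *)
Lemma error_energy_derive_le (v u r q z c y f1 f2 G rho yb : R) :
  0 <= v -> q + z = c + y -> `|c| <= rho -> `|y| <= yb -> `|y| <= G ->
  `|z| <= G -> `|f1| <= G -> `|f2| <= G ->
  u * (- v * u - ((q + z + r) ^+ 3 - q ^+ 3) + f1) + (r + r * (r * r)) * (u + f2) <=
  (10 + 9 * rho ^+ 2 + 6 * yb) * error_energy u r +
  (324 * G ^+ 8 + 2 * G ^+ 2 + 25 * (G * (q ^+ 2 + G ^+ 2)) ^+ 2 + G ^+ 4).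
Proof.
move=> v0 E hc hy hyG hz hf1 hf2.
have G0 : 0 <= G by exact: le_trans (normr_ge0 _) hz.
have rho0 : 0 <= rho by exact: le_trans (normr_ge0 _) hc.
have yb0 : 0 <= yb by exact: le_trans (normr_ge0 _) hy.
(* This is [(q + z)^3 - q^3]; it does not involve the error and counts as forcing. *)
pose ka := z * (3 * q ^+ 2 + 3 * q * z + z ^+ 2).
have hka : ka ^+ 2 <= 25 * (G * (q ^+ 2 + G ^+ 2)) ^+ 2.
  have z2 : z ^+ 2 <= G ^+ 2 by rewrite -real_normK ?num_real// lerXn2r ?nnegrE.
  have k1 : `|3 * q ^+ 2 + 3 * q * z + z ^+ 2| <= 5 * (q ^+ 2 + G ^+ 2).
    have := sqr_ge0 (q + z); have := sqr_ge0 (q - z); have := sqr_ge0 q.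
    have := sqr_ge0 z => a1 a2 a3 a4.
    by rewrite ler_norml; apply/andP; split; nra.
  have k2 : `|ka| <= G * (5 * (q ^+ 2 + G ^+ 2)).
    by rewrite /ka normrM; apply: ler_pM.
  rewrite -[ka ^+ 2]real_normK ?num_real//.
  apply: le_trans (_ : (G * (5 * (q ^+ 2 + G ^+ 2))) ^+ 2 <= _).
    by rewrite lerXn2r ?nnegrE// (le_trans _ k2).
  by rewrite le_eqVlt; apply/orP; left; apply/eqP; ring.
have V1 : u ^+ 2 / 2 <= error_energy u r.
  by rewrite /error_energy; have := sqr_ge0 r; have := sqr_ge0 (r ^+ 2); lra.
have V2 : r ^+ 2 / 2 <= error_energy u r.
  by rewrite /error_energy; have := sqr_ge0 u; have := sqr_ge0 (r ^+ 2); lra.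
have V3 : r ^+ 4 / 4 <= error_energy u r.
  rewrite /error_energy; have := sqr_ge0 r; have := sqr_ge0 u.
  by rewrite (_ : r * r * (r * r) = r ^+ 4); [lra|ring].
have V4 : u ^+ 2 / 2 + r ^+ 2 / 2 + r ^+ 4 / 4 = error_energy u r.
  by rewrite /error_energy; ring.
have V0 : 0 <= error_energy u r by apply: le_trans V1; rewrite divr_ge0// sqr_ge0.
move: V1 V2 V3 V4 V0; set V := error_energy u r => V1 V2 V3 V4 V0.
have t1 : - (3 * c * u * r ^+ 2) <= (3 + 3 * rho ^+ 2) * V.
  have a1 : `|3 * c * u * r ^+ 2| <= 3 * rho * (u ^+ 2 / 2 + r ^+ 4 / 2).
    rewrite -!mulrA [`|_|]normrM (@ger0_norm _ 3)//; apply: ler_wpM2l => //.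
    rewrite normrM; apply: ler_pM => //.
    have := sqr_ge0 (u - r ^+ 2); have := sqr_ge0 (u + r ^+ 2).
    by rewrite ler_norml => *; apply/andP; split; lra.
  have a2 : rho * (u ^+ 2 / 2 + r ^+ 4 / 2) <= rho * (2 * V).
    by rewrite ler_wpM2l//; have := sqr_ge0 r; have := sqr_ge0 u; lra.
  have a3 : 6 * rho * V <= (3 + 3 * rho ^+ 2) * V.
    by rewrite ler_wpM2r//; have := sqr_ge0 (rho - 1); lra.
  have := ler_norm (- (3 * c * u * r ^+ 2)); rewrite normrN; lra.
have t2 : - (3 * y * u * r ^+ 2) <= 6 * yb * V.
  have a1 : `|3 * y * u * r ^+ 2| <= 3 * yb * (u ^+ 2 / 2 + r ^+ 4 / 2).
    rewrite -!mulrA [`|_|]normrM (@ger0_norm _ 3)//; apply: ler_wpM2l => //.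
    rewrite normrM; apply: ler_pM => //.
    have := sqr_ge0 (u - r ^+ 2); have := sqr_ge0 (u + r ^+ 2).
    by rewrite ler_norml => *; apply/andP; split; lra.
  have a2 : yb * (u ^+ 2 / 2 + r ^+ 4 / 2) <= yb * (2 * V).
    by rewrite ler_wpM2l//; have := sqr_ge0 r; have := sqr_ge0 u; lra.
  have := ler_norm (- (3 * y * u * r ^+ 2)); rewrite normrN; lra.
have abs_ur : `|u * r| <= V.
  have := sqr_ge0 (u - r); have := sqr_ge0 (u + r); have := sqr_ge0 (r ^+ 2).
  by rewrite ler_norml => *; apply/andP; split; lra.
have t3 : u * r * (1 - 3 * (c + y) ^+ 2) <= (1 + 6 * rho ^+ 2) * V + V + 324 * G ^+ 8.
  have c2 : c ^+ 2 <= rho ^+ 2 by rewrite -real_normK ?num_real// lerXn2r ?nnegrE.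
  have y2 : y ^+ 2 <= G ^+ 2 by rewrite -real_normK ?num_real// lerXn2r ?nnegrE.
  have a1 : `|1 - 3 * (c + y) ^+ 2| <= (1 + 6 * rho ^+ 2) + 6 * G ^+ 2.
    have := sqr_ge0 (c + y); have := sqr_ge0 (c - y) => b1 b2.
    by rewrite ler_norml; apply/andP; split; nra.
  have a2 : `|u * r| * (1 + 6 * rho ^+ 2) <= V * (1 + 6 * rho ^+ 2).
    by rewrite ler_wpM2r// addr_ge0// mulr_ge0// sqr_ge0.
  (* Young's inequality twice, first on [u r], then on [18 G^4 r^2] against [r^4 / 4]; hence
     [324 = 18^2]. *)
  have a3 : 6 * G ^+ 2 * `|u * r| <= V + 324 * G ^+ 8.
    have b1 : 6 * G ^+ 2 * `|u * r| <= u ^+ 2 / 2 + 18 * G ^+ 4 * r ^+ 2.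
      have := sqr_ge0 (u - 6 * G ^+ 2 * r); have := sqr_ge0 (u + 6 * G ^+ 2 * r).
      by case: (ger0P (u * r)) => _ *; lra.
    have b2 := sqr_ge0 (r ^+ 2 / 2 - 18 * G ^+ 4).
    have b3 := sqr_ge0 r.
    have -> : G ^+ 8 = (G ^+ 4) ^+ 2 by rewrite -exprM.
    lra.
  apply: le_trans (ler_norm _) _; rewrite normrM.
  apply: le_trans (ler_wpM2l (normr_ge0 _) a1) _; lra.
have t4 : u * (f1 - ka) <= V + G ^+ 2 + 25 * (G * (q ^+ 2 + G ^+ 2)) ^+ 2.
  have f12 : f1 ^+ 2 <= G ^+ 2 by rewrite -real_normK ?num_real// lerXn2r ?nnegrE.
  have := sqr_ge0 (u - (f1 - ka)); have := sqr_ge0 (f1 + ka); lra.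
have f22 : f2 ^+ 2 <= G ^+ 2 by rewrite -real_normK ?num_real// lerXn2r ?nnegrE.
have t5 : r * f2 <= V + G ^+ 2 / 2 by have := sqr_ge0 (r - f2); lra.
have t6 : r * (r * r) * f2 <= 3 * V + G ^+ 4 / 4.
  have f24 : f2 ^+ 4 <= G ^+ 4.
    by rewrite -[4%N]/(2 * 2)%N !exprM lerXn2r ?nnegrE ?sqr_ge0.
  have b1 := sqr_ge0 (r * (r - f2)); have b2 := sqr_ge0 (r ^+ 2 - f2 ^+ 2).
  have b3 := sqr_ge0 (r ^+ 2); have b4 := sqr_ge0 (f2 ^+ 2).
  have -> : r * (r * r) * f2 = r ^+ 2 * (r * f2) by ring.
  lra.
(* The terms in [u r^3] have cancelled and the rest is covered by [t1] to [t6]. Their rates add up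
   to [10 + 9 rho^2 + 6 yb]. *)
have -> : u * (- v * u - ((q + z + r) ^+ 3 - q ^+ 3) + f1) +
    (r + r * (r * r)) * (u + f2) =
  - (v * u ^+ 2) + u * r * (1 - 3 * (c + y) ^+ 2) - 3 * c * u * r ^+ 2
  - 3 * y * u * r ^+ 2 + u * (f1 - ka) + r * f2 + r * (r * r) * f2.
  have -> : c = q + z - y by rewrite E; ring.
  by rewrite /ka; ring.
have := mulr_ge0 v0 (sqr_ge0 u); have := sqr_ge0 G.
have := sqr_ge0 (G ^+ 2); have -> : (G ^+ 2) ^+ 2 = G ^+ 4 by rewrite -exprM.
lra.
Qed.
End OneStep.

Section OneStepPath.
Context (R : realType).

(** At a point where [|Z|] is maximal, the integral is at most half of that maximum because
    [v (b - a) <= 1], so it is absorbed on the left. *)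
Lemma damped_path_bound (v a b w : R) (Z g : R -> R) (z0 : R) :
  0 < v -> a <= b -> v * (b - a) <= 1 -> continuous Z ->
  (forall t, a <= t <= b -> `|g t| <= w) ->
  (forall t, a <= t <= b ->
    Z t = z0 + \int[lebesgue_measure]_(s in `[a, t]) (- (v / 2) * Z s) + g t) ->
  forall t, a <= t <= b -> `|Z t| <= 2 * (`|z0| + w).
Proof.
move=> v0 ab vab cZ hg ZE.
have cN : continuous (fun t => `|Z t|).
  by move=> x; apply: continuous_comp; [exact: cZ|exact: norm_continuous].
have [m mab hm] := EVT_max ab (continuous_subspaceT cN).
rewrite in_itv/= in mab.
have hZ t : a <= t <= b -> `|Z t| <= `|Z m| by move=> tab; apply: hm; rewrite in_itv.
suff h : `|Z m| <= 2 * (`|z0| + w) by move=> t /hZ /le_trans; apply.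
have /andP[am mb] := mab.
have cI : continuous (fun s => - (v / 2) * Z s).
  by move=> x; apply: cvgM; [exact: cvg_cst|exact: cZ].
have I : `|\int[lebesgue_measure]_(s in `[a, m]) (- (v / 2) * Z s)| <=
    v / 2 * `|Z m| * (m - a).
  apply: Rintegral_clip_bound => // s /andP[as_ sm].
  have v2 : 0 <= v / 2 by rewrite divr_ge0// ltW.
  rewrite normrM normrN (ger0_norm v2); apply: (ler_wpM2l v2).
  by apply: hZ; rewrite as_ (le_trans sm).
have I2 : v / 2 * `|Z m| * (m - a) <= `|Z m| / 2.
  have k1 : v * (m - a) <= 1 by apply: le_trans vab; apply: (ler_wpM2l (ltW v0)); lra.
  have := ler_wpM2l (normr_ge0 (Z m)) k1; lra.
have Zm : `|Z m| <= `|z0| + `|Z m| / 2 + w.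
  rewrite {1}(ZE m mab); apply: le_trans (ler_normD _ _) _.
  apply: lerD; last exact: hg.
  by apply: le_trans (ler_normD _ _) _; rewrite lerD2l (le_trans I).
lra.
Qed.

(** One number dominating every small quantity of a step: the jump of the deterministic step, the
    time integrals of the stochastic flow, [sigma N] and the consistency errors [EA], [EB]. The
    factor [(1 + v) ^+ 2] dominates all their coefficients. *)
Definition step_size_bound (v sigma tau w p q Pb Qb N0 EA EB : R) : R :=
  (1 + v) ^+ 2 * (`|Pb - p| + `|Qb - q| + tau * (2 * (`|Pb| + sigma * w)) +
    tau * (2 * `|Qb|) + sigma * (`|N0| + tau * w)) + EA + EB.

Lemma drift_coefficients_le (v th : R) (L := (1 + v) ^+ 2) :
  0 < v -> 0 <= th <= 1 ->
  [/\ `|th| <= L, `|v / 2 - v * th| <= L, `|v ^+ 2 / 4| <= L,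
      `|v ^+ 2 / 2| <= L & `|v / 2| <= L].
Proof.
move=> v0 /andP[th0 th1]; have v2 := sqr_ge0 v.
have vt1 : v * th <= v by rewrite ler_piMr// ltW.
have vt0 : 0 <= v * th by rewrite mulr_ge0// ltW.
by rewrite /L; split; rewrite ler_norml; apply/andP; split; nra.
Qed.

Lemma norm_lincomb5_le (L c1 c2 c3 c4 c5 x1 x2 x3 x4 x5 y1 y2 y3 y4 y5 : R) :
  `|c1| <= L -> `|c2| <= L -> `|c3| <= L -> `|c4| <= L -> `|c5| <= L ->
  `|x1| <= y1 -> `|x2| <= y2 -> `|x3| <= y3 -> `|x4| <= y4 -> `|x5| <= y5 ->
  `|c1 * x1 + c2 * x2 + c3 * x3 + c4 * x4 + c5 * x5| <=
  L * (y1 + y2 + y3 + y4 + y5).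
Proof.
have le_M c x y : `|c| <= L -> `|x| <= y -> `|c * x| <= L * y.
  by move=> ? ?; rewrite normrM; apply: ler_pM.
move=> ? ? ? ? ? ? ? ? ? ?; rewrite !mulrDr.
do 4 (apply: le_trans (ler_normD _ _) _; apply: lerD; last exact: le_M).
exact: le_M.
Qed.

(** The difference [X - Pt] contains no noise, but its derivative still sees [W - W a] through the
    two damping rates, and that of [Y - Qt] sees it through [X]. The derivatives of the shifts by
    [N] cancel exactly these contributions. The energy inequality then holds along the whole step,
    and Gronwall's lemma applies on [[a, b]]. *)
Lemma one_step_error (v sigma tau a w p q Pb Qb N0 EA EB : R)
  (X Y Pt Qt W : R -> R) (b := a + tau)
  (N1 := N0 + (\int[lebesgue_measure]_(s in `[a, b]) W s - tau * W a))
  (G := step_size_bound v sigma tau w p q Pb Qb N0 EA EB) :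
  0 < v -> 0 <= sigma -> 0 < tau -> v * tau <= 1 -> 
  continuous X -> continuous Y -> continuous Pt -> continuous Qt -> continuous W ->
  (forall t, a <= t <= b -> X t = X a +
     \int[lebesgue_measure]_(s in `[a, t]) (- v * X s - Y s ^+ 3) +
     sigma * (W t - W a)) ->
  (forall t, a <= t <= b -> Y t = Y a + \int[lebesgue_measure]_(s in `[a, t]) X s) ->
  (forall t, a <= t <= b -> Pt t = Pb +
     \int[lebesgue_measure]_(s in `[a, t]) (- (v / 2) * Pt s) + sigma * (W t - W a)) ->
  (forall t, a <= t <= b -> Qt t = Qb +
     \int[lebesgue_measure]_(s in `[a, t]) (- (v / 2) * Qt s)) ->
  (forall t, a <= t <= b -> `|W t - W a| <= w) ->
  `|v / 2 * p + q ^+ 3 + tau^-1 * (Pb - p)| <= EA ->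
  `|p + v / 2 * q - tau^-1 * (Qb - q)| <= EB ->
  error_energy (X b - Pt b + v / 2 * sigma * N1) (Y b - Qt b - sigma * N1) <=
  expR ((10 + 9 * (`|q| + `|Qb - q| + 2 * `|Qb|) ^+ 2 +
         6 * (sigma * (`|N0| + tau * w))) * tau) *
  (error_energy (X a - p + v / 2 * sigma * N0) (Y a - q - sigma * N0) +
   (324 * G ^+ 8 + 2 * G ^+ 2 + 25 * (G * (q ^+ 2 + G ^+ 2)) ^+ 2 + G ^+ 4) * tau).
Proof.
move=> v0 s0 tau0 vtau cX cY cP cQ cW EX EY EP EQ hw hEA hEB.
have tn0 : tau != 0 by rewrite gt_eqF.
have ab : a <= b by rewrite /b lerDl ltW.
have ba : b - a = tau by rewrite /b addrC addKr.
have w0 : 0 <= w by apply: le_trans (normr_ge0 _) (hw a _); rewrite lexx ab.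
have cf1 : continuous (fun s => - v * X s - Y s ^+ 3).
  move=> x; apply: cvgB; first by apply: cvgM; [exact: cvg_cst|exact: cX].
  by apply: (cvg_comp _ (fun z => z ^+ 3) (cY x)); exact: exprn_continuous.
have [J1 [dJ1 JE1]] := primitive_exists a cf1.
have [J2 [dJ2 JE2]] := primitive_exists a cX.
have [J3 [dJ3 JE3]] := primitive_exists a cP.
have [J4 [dJ4 JE4]] := primitive_exists a cQ.
have [J5 [dJ5 JE5]] := primitive_exists a cW.
have intZ (f : R -> R) t : continuous f ->
    \int[lebesgue_measure]_(s in `[a, t]) (- (v / 2) * f s) =
    - (v / 2) * \int[lebesgue_measure]_(s in `[a, t]) f s.
  by move=> cf; rewrite RintegralZl//; exact: continuous_integrable_itv.
have le_a t : a <= t <= b -> a <= a <= t by move=> /andP[-> _]; rewrite lexx.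
pose IP t := J3 t - J3 a; pose IQ t := J4 t - J4 a.
pose nu t := J5 t - J5 a - (t - a) * W a.
have PtE t : a <= t <= b -> Pt t = Pb - v / 2 * IP t + sigma * (W t - W a).
  by move=> tab; rewrite (EP t tab) intZ// (JE3 _ _ (le_a t tab)) /IP; ring.
have QtE t : a <= t <= b -> Qt t = Qb - v / 2 * IQ t.
  by move=> tab; rewrite (EQ t tab) intZ// (JE4 _ _ (le_a t tab)) /IQ; ring.
pose A := Pb - p; pose B := Qb - q.
pose N t := N0 + nu t.
(* Primitives make the differentiability visible; [uE] recovers the meaning. The term in [A]
   vanishes at [b] and turns [Pb] into [p] at [a], so the values at both ends are those of the
   scheme. *)
pose u t := X a - Pb + (J1 t - J1 a) + v / 2 * IP t + A * (1 - (t - a) / tau)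
  + v / 2 * sigma * N t.
pose r t := Y a - Qb + (J2 t - J2 a) + v / 2 * IQ t + B * (1 - (t - a) / tau)
  - sigma * N t.
have uE t : a <= t <= b ->
    u t = X t - Pt t + A * (1 - (t - a) / tau) + v / 2 * sigma * N t.
  move=> tab; rewrite (PtE t tab) (EX t tab) (JE1 _ _ (le_a t tab)) /u; ring.
have rE t : a <= t <= b ->
    r t = Y t - Qt t + B * (1 - (t - a) / tau) - sigma * N t.
  move=> tab; rewrite (QtE t tab) (EY t tab) (JE2 _ _ (le_a t tab)) /r; ring.
have MP t : a <= t <= b -> `|Pt t| <= 2 * (`|Pb| + sigma * w).
  apply: (@damped_path_bound v a b (sigma * w) Pt (fun t => sigma * (W t - W a)));
    rewrite ?ba// => {}t tab.
  by rewrite normrM (ger0_norm s0) ler_wpM2l// hw.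
have MQ t : a <= t <= b -> `|Qt t| <= 2 * `|Qb|.
  rewrite -[`|Qb|]addr0.
  apply: (@damped_path_bound v a b 0 Qt (fun=> 0)); rewrite ?ba// => {}t tab.
    by rewrite normr0.
  by rewrite addr0 EQ.
have leT (M : R) t : 0 <= M -> a <= t <= b -> M * (t - a) <= tau * M.
  by move=> M0 tab; rewrite mulrC ler_wpM2r// -ba; lra.
have hIP t : a <= t <= b -> `|IP t| <= tau * (2 * (`|Pb| + sigma * w)).
  move=> tab; rewrite /IP -(JE3 _ _ (le_a t tab)).
  apply: le_trans (leT _ t _ tab); last by rewrite mulr_ge0// addr_ge0// mulr_ge0.
  apply: Rintegral_clip_bound => //; first by case/andP: tab.
  by move=> s /andP[s1 s2]; apply: MP; rewrite s1 (le_trans s2)//; case/andP: tab.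
have hIQ t : a <= t <= b -> `|IQ t| <= tau * (2 * `|Qb|).
  move=> tab; rewrite /IQ -(JE4 _ _ (le_a t tab)).
  apply: le_trans (leT _ t _ tab); last by rewrite mulr_ge0.
  apply: Rintegral_clip_bound => //; first by case/andP: tab.
  by move=> s /andP[s1 s2]; apply: MQ; rewrite s1 (le_trans s2)//; case/andP: tab.
have hN t : a <= t <= b -> `|N t| <= `|N0| + tau * w.
  move=> tab; apply: le_trans (ler_normD _ _) _; rewrite lerD2l.
  have -> : nu t = \int[lebesgue_measure]_(s in `[a, t]) (W s - W a).
    rewrite RintegralB//; [|exact: continuous_integrable_itv|
      by apply: continuous_integrable_itv; exact: cst_continuous].
    rewrite (JE5 _ _ (le_a t tab)) Rintegral_cst//= lebesgue_measure_itv/= lte_fin /nu.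
    case: ltP => [_|ta]; first by rewrite -EFinD/= [W a * _]mulrC.
    have -> : t = a by apply/le_anti; rewrite ta; case/andP: tab.
    by rewrite !subrr mul0r /= mulr0.
  apply: le_trans (leT _ t w0 tab).
  apply: Rintegral_clip_bound; first by case/andP: tab.
    by move=> x; apply: cvgB; [exact: cW|exact: cvg_cst].
  by move=> s /andP[s1 s2]; apply: hw; rewrite s1 (le_trans s2)//; case/andP: tab.
pose epsA := v / 2 * p + q ^+ 3 + tau^-1 * A.
pose epsB := p + v / 2 * q - tau^-1 * B.
pose th t := (t - a) / tau.
(* What remains of the derivatives after the error terms and the noise are removed: combinations of
   [A], [B], [IP], [IQ], [sigma N] and the consistency errors only. *)
pose f1 t := - (v / 2) * A + v ^+ 2 / 4 * IP t + v * A * (1 - th t) +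
  v ^+ 2 / 2 * sigma * N t - epsA.
pose f2 t := A * th t - v / 2 * IP t - v / 2 * sigma * N t + v / 2 * B -
  v ^+ 2 / 4 * IQ t + epsB.
pose z t := B * th t - v / 2 * IQ t + sigma * N t.
pose du t := - v * X t - Y t ^+ 3 + v / 2 * Pt t - tau^-1 * A +
  v / 2 * sigma * (W t - W a).
pose dr t := X t + v / 2 * Qt t - tau^-1 * B - sigma * (W t - W a).
have duE t : a <= t <= b ->
    du t = - v * u t - ((q + z t + r t) ^+ 3 - q ^+ 3) + f1 t.
  move=> tab.
  have XE : X t = u t + Pt t - A * (1 - th t) - v / 2 * sigma * N t.
    by rewrite uE// /th; ring.
  have YE : Y t = q + z t + r t by rewrite rE// QtE// /z /B /th; ring.
  rewrite /du YE XE PtE// /f1 /epsA /A. field; exact: tn0.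
have drE t : a <= t <= b -> dr t = u t + f2 t.
  move=> tab.
  have XE : X t = u t + Pt t - A * (1 - th t) - v / 2 * sigma * N t.
    by rewrite uE// /th; ring.
  rewrite /dr XE PtE// QtE// /f2 /epsB /A /B. field; exact: tn0.
pose V t := error_energy (u t) (r t).
pose dV t := u t * du t + (r t + r t * (r t * r t)) * dr t.
have hV t : a <= t <= b -> is_derive t 1 V (dV t).
  move=> /andP[a_t _].
  have h1 := dJ1 t a_t; have h2 := dJ2 t a_t; have h3 := dJ3 t a_t.
  have h4 := dJ4 t a_t; have h5 := dJ5 t a_t.
  have hIP' : is_derive t 1 IP (Pt t).
    by rewrite /IP; apply: is_derive_eq; rewrite subr0.
  have hIQ' : is_derive t 1 IQ (Qt t).
    by rewrite /IQ; apply: is_derive_eq; rewrite subr0.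
  have hN' : is_derive t 1 N (W t - W a).
    by rewrite /N /nu; apply: is_derive_eq; rewrite /GRing.scale/=; ring.
  have hu : is_derive t 1 u (du t).
    by rewrite /u; apply: is_derive_eq; rewrite /du /GRing.scale/=; ring.
  have hr : is_derive t 1 r (dr t).
    by rewrite /r; apply: is_derive_eq; rewrite /dr /GRing.scale/=; ring.
  by rewrite /V /error_energy; apply: is_derive_eq; rewrite /dV /GRing.scale/=; field.
have th01 t : a <= t <= b -> 0 <= th t <= 1.
  move=> /andP[a_t t_b]; apply/andP; split.
    by rewrite /th divr_ge0 ?subr_ge0// ltW.
  by rewrite /th ler_pdivrMr// mul1r -ba lerD2r.
have EA0 : 0 <= EA by exact: le_trans hEA.
have EB0 : 0 <= EB by exact: le_trans hEB.
have tau0' := ltW tau0.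
have sw0 : 0 <= sigma * w by exact: mulr_ge0.
have n00 : `|0 : R| <= (1 + v) ^+ 2 by rewrite normr0 sqr_ge0.
have n01 : `|1 : R| <= (1 + v) ^+ 2.
  by rewrite normr1 -[leLHS](expr1n _ 2) lerXn2r ?nnegrE// ?lerDl ?addr_ge0 ?(ltW v0).
have hsN t : a <= t <= b -> `|sigma * N t| <= sigma * (`|N0| + tau * w).
  by move=> tab; rewrite normrM (ger0_norm s0); apply: (ler_wpM2l s0); exact: hN.
have leG (x e1 e2 y : R) : `|x| <= y -> `|e1| <= EA -> `|e2| <= EB ->
    `|x - e1 + e2| <= y + EA + EB.
  move=> h1 h2 h3; apply: le_trans (ler_normD _ _) (lerD _ h3).
  exact: le_trans (ler_normB _ _) (lerD h1 h2).
have nA0 : `|0 : R| <= EA by rewrite normr0.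
have nB0 : `|0 : R| <= EB by rewrite normr0.
have hz t : a <= t <= b -> `|z t| <= G.
  move=> tab; have [k1 k2 k3 k4 k5] := drift_coefficients_le v0 (th01 t tab).
  (* Zero coefficients bring the four quantities to one shape, so that a single estimate gives the
     same bound [G] for all. *)
  have -> : z t = 0 * A + th t * B + 0 * IP t + (- (v / 2)) * IQ t + 1 * (sigma * N t)
    - 0 + 0 by rewrite /z; ring.
  apply: leG => //; apply: norm_lincomb5_le => //; rewrite ?normrN//;
    [exact: hIP|exact: hIQ|exact: hsN].
have hf1 t : a <= t <= b -> `|f1 t| <= G.
  move=> tab; have [k1 k2 k3 k4 k5] := drift_coefficients_le v0 (th01 t tab).
  have -> : f1 t = (v / 2 - v * th t) * A + 0 * B + v ^+ 2 / 4 * IP t + 0 * IQ t +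
    v ^+ 2 / 2 * (sigma * N t) - epsA + 0 by rewrite /f1; field.
  apply: leG => //; apply: norm_lincomb5_le => //;
    [exact: hIP|exact: hIQ|exact: hsN].
have hf2 t : a <= t <= b -> `|f2 t| <= G.
  move=> tab; have [k1 k2 k3 k4 k5] := drift_coefficients_le v0 (th01 t tab).
  have -> : f2 t = th t * A + v / 2 * B + (- (v / 2)) * IP t +
    (- (v ^+ 2 / 4)) * IQ t + (- (v / 2)) * (sigma * N t) - 0 + epsB.
    by rewrite /f2; field.
  apply: leG => //; apply: norm_lincomb5_le => //; rewrite ?normrN//;
    [exact: hIP|exact: hIQ|exact: hsN].
have v2 : 0 <= v / 2 by rewrite divr_ge0// ltW.
(* The part of the position without the Gaussian shift: it alone enters the rate quadratically. *)
have hc t : a <= t <= b ->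
    `|q + B * th t - v / 2 * IQ t| <= `|q| + `|Qb - q| + 2 * `|Qb|.
  move=> tab; have /andP[th0 th1] := th01 t tab.
  apply: le_trans (ler_normB _ _) _; apply: lerD.
    apply: le_trans (ler_normD _ _) _; rewrite lerD2l normrM (ger0_norm th0).
    by rewrite ler_piMr.
  rewrite normrM (ger0_norm v2).
  apply: le_trans (ler_wpM2l v2 (hIQ t tab)) _.
  rewrite mulrA ler_piMl ?mulr_ge0// mulrAC ler_pdivrMr// mul1r.
  by rewrite (le_trans vtau)// ler1n.
have GN t : a <= t <= b -> `|sigma * N t| <= G.
  move=> tab; have -> : sigma * N t = 0 * A + 0 * B + 0 * IP t + 0 * IQ t +
    1 * (sigma * N t) - 0 + 0 by ring.
  by apply: leG => //; apply: norm_lincomb5_le => //;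
    [exact: hIP|exact: hIQ|exact: hsN].
have nab : a <= a <= b by rewrite lexx.
have G0 : 0 <= G by exact: le_trans (normr_ge0 _) (hz a nab).
have nbb : a <= b <= b by rewrite ab lexx.
have := @gronwall_derive R a b V dV
  (10 + 9 * (`|q| + `|Qb - q| + 2 * `|Qb|) ^+ 2 + 6 * (sigma * (`|N0| + tau * w)))
  (324 * G ^+ 8 + 2 * G ^+ 2 + 25 * (G * (q ^+ 2 + G ^+ 2)) ^+ 2 + G ^+ 4) ab _ _ hV _.
rewrite ba.
have -> : V b = error_energy (X b - Pt b + v / 2 * sigma * N1) (Y b - Qt b - sigma * N1).
  rewrite /V uE// rE// ba divff// subrr !mulr0 !addr0 /N /nu /N1.
  by rewrite (JE5 _ _ nab) ?nbb// ba.
have -> : V a = error_energy (X a - p + v / 2 * sigma * N0) (Y a - q - sigma * N0).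
  by rewrite /V /u /r /N /nu /IP /IQ !subrr !mul0r /A /B; congr error_energy; ring.
apply.
- apply: addr_ge0; first by apply: addr_ge0 => //; apply: mulr_ge0 => //; exact: sqr_ge0.
  by apply: mulr_ge0 => //; apply: (mulr_ge0 s0); apply: addr_ge0 => //; exact: mulr_ge0.
- apply: addr_ge0; last exact: exprn_ge0.
  apply: addr_ge0; last exact: mulr_ge0 (ler0n _ 25) (sqr_ge0 _).
  exact: addr_ge0 (mulr_ge0 (ler0n _ 324) (exprn_ge0 8 G0))
    (mulr_ge0 (ler0n _ 2) (exprn_ge0 2 G0)).
- move=> t tab; rewrite /dV duE// drE//.
  apply: (@error_energy_derive_le R v (u t) (r t) q (z t)
    (q + B * th t - v / 2 * IQ t) (sigma * N t) (f1 t) (f2 t)); first exact: ltW;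
    [|exact: hc|exact: hsN|exact: GN|exact: hz|exact: hf1|exact: hf2].
  by rewrite /z; ring.
Qed.
End OneStepPath.

(** * Consistency of the deterministic step *)

Section Consistency.
Context (R : realType).

Lemma powR_le_linear (x M a : R) (k : nat) : 0 <= x -> x <= M -> 1 <= M ->
  1 <= a -> a <= k.+1%:R -> x `^ a <= x * M ^+ k.
Proof.
move=> x0 xM M1 a1 ak.
have M0 : 0 <= M by exact: le_trans M1.
move: x0; rewrite le_eqVlt => /predU1P[<-|x0].
  by rewrite mul0r powR0// gt_eqF//; lra.
have -> : a = 1 + (a - 1) by ring.
rewrite powRD ?(gt_eqF x0) ?implybT// powRr1 ?(ltW x0)//.
apply: ler_wpM2l; first exact: ltW.
apply: (@le_trans _ _ (M `^ (a - 1))).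
  by apply: ge0_ler_powR; rewrite ?nnegrE ?(ltW x0)//; lra.
by rewrite -powR_mulrn//; apply: ler_powR => //; rewrite -natr1 in ak; lra.
Qed.

Lemma coercive_hamiltonian_abs_le (v : R) (x : R * R) :
  [/\ 1 <= coercive_hamiltonian v x, `|x.1| <= 2 * coercive_hamiltonian v x &
      `|x.2| <= 2 * coercive_hamiltonian v x].
Proof.
have := coercive_hamiltonian_ge v x; set h := coercive_hamiltonian v x => H.
have p2 := sqr_ge0 x.1; have q4 : 0 <= x.2 ^+ 4 by rewrite exprn_even_ge0.
have h1 : 1 <= h by lra.
have h2 : h <= h ^+ 2 by rewrite expr2 ler_peMl//; lra.
split => //.
  rewrite -(@ler_pXn2r _ 2) ?nnegrE//; last by lra.
  by rewrite real_normK ?num_real// exprMn; lra.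
rewrite -(@ler_pXn2r _ 4) ?nnegrE//; last by lra.
have -> : `|x.2| ^+ 4 = x.2 ^+ 4 by rewrite -normrX ger0_norm.
have h4 : h ^+ 2 <= h ^+ 4 by rewrite -[4%N]/(2 + 2)%N exprD ler_peMl//; lra.
by rewrite exprMn; lra.
Qed.

Lemma euclid_norm_le (p q M : R) : `|p| <= M -> `|q| <= M ->
  0 <= euclid_norm (p, q) <= 2 * M.
Proof.
move=> pM qM; have M0 : 0 <= M by exact: le_trans pM.
rewrite /euclid_norm sqrtr_ge0/= -(@ger0_norm _ (2 * M)) ?mulr_ge0//.
rewrite -sqrtr_sqr; apply: ler_wsqrtr.
have : p ^+ 2 <= M ^+ 2 by rewrite -real_normK ?num_real// lerXn2r ?nnegrE.
have : q ^+ 2 <= M ^+ 2 by rewrite -real_normK ?num_real// lerXn2r ?nnegrE.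
by have := sqr_ge0 M; rewrite exprMn; lra.
Qed.

Lemma polynomial_growth_hamiltonian (v : R) (Theta : R * R -> R * R -> R) :
  polynomial_growth Theta -> exists (D : R) (k : nat), 0 <= D /\
  forall x y, coercive_hamiltonian v y = coercive_hamiltonian v x ->
    `|Theta x y| <= D * coercive_hamiltonian v x ^+ k.
Proof.
move=> [K [k hK]]; exists (`|K| * (1 + 2 * 4 ^+ k)), k; split.
  by rewrite mulr_ge0// addr_ge0// mulr_ge0// exprn_ge0.
move=> x y yx; have [h1 p1 q1] := coercive_hamiltonian_abs_le v x.
have [_ p2 q2] := coercive_hamiltonian_abs_le v y; rewrite yx in p2 q2.
set h := coercive_hamiltonian v x in h1 p1 q1 p2 q2 *.
have h0 : 0 <= h by exact: le_trans h1.
apply: le_trans (hK x y) _; apply: (@le_trans _ _ (`|K| *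
    (1 + euclid_norm x ^+ k + euclid_norm y ^+ k))).
  apply: ler_wpM2r; last exact: ler_norm.
  by rewrite !addr_ge0// exprn_ge0// sqrtr_ge0.
rewrite -mulrA; apply: ler_wpM2l => //.
have hk : 1 <= h ^+ k by exact: exprn_ege1.
have ek z : `|z.1| <= 2 * h -> `|z.2| <= 2 * h -> euclid_norm z ^+ k <= 4 ^+ k * h ^+ k.
  move=> z1 z2; rewrite -exprMn; have := euclid_norm_le z1 z2.
  rewrite (_ : (z.1, z.2) = z); last by case: z {z1 z2}.
  move=> /andP[e0 e1]; apply: lerXn2r; rewrite ?nnegrE ?mulr_ge0//.
  by apply: le_trans e1 _; lra.
by have := ek x p1 q1; have := ek y p2 q2; lra.
Qed.

(** Exactly one power of the increment is kept, as [a] and [b] are at least 1. All else is bounded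
    by a power of [h], which controls both states since it takes the same value at them. *)
Lemma remainder_le (v C a b : R) (Theta : R * R -> R * R -> R) :
  0 < C -> 1 <= a -> 1 <= b -> polynomial_growth Theta ->
  exists (D : R) (k : nat), 0 <= D /\ forall p q Pb Qb,
    coercive_hamiltonian v (Pb, Qb) = coercive_hamiltonian v (p, q) ->
    C * (`|Pb - p| `^ a + `|Qb - q| `^ b) * Theta (p, q) (Pb, Qb) <=
    D * coercive_hamiltonian v (p, q) ^+ k * (`|Pb - p| + `|Qb - q|).
Proof.
move=> C0 a1 b1 /(polynomial_growth_hamiltonian v)[D [k [D0 hD]]].
pose n := maxn (Num.truncn a) (Num.truncn b).
have an : a <= n.+1%:R.
  by apply: le_trans (ltW (truncnS_gt a)) _; rewrite ler_nat ltnS leq_maxl.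
have bn : b <= n.+1%:R.
  by apply: le_trans (ltW (truncnS_gt b)) _; rewrite ler_nat ltnS leq_maxr.
exists (C * 4 ^+ n * D), (n + k)%N; split.
  by rewrite !mulr_ge0// ?exprn_ge0// ltW.
move=> p q Pb Qb E; have [h1 p1 q1] := coercive_hamiltonian_abs_le v (p, q).
have [_ p2 q2] := coercive_hamiltonian_abs_le v (Pb, Qb).
have hT := hD (p, q) (Pb, Qb) E; rewrite E in p2 q2.
set h := coercive_hamiltonian v (p, q) in h1 p1 q1 p2 q2 hT *; rewrite /= in p1 q1 p2 q2.
have h0 : 0 <= h by exact: le_trans h1.
have A4 : `|Pb - p| <= 4 * h by apply: le_trans (ler_normB _ _) _; lra.
have B4 : `|Qb - q| <= 4 * h by apply: le_trans (ler_normB _ _) _; lra.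
have h41 : 1 <= 4 * h by lra.
have PA := powR_le_linear (normr_ge0 _) A4 h41 a1 an.
have PB := powR_le_linear (normr_ge0 _) B4 h41 b1 bn.
have PAB : `|Pb - p| `^ a + `|Qb - q| `^ b <=
    (`|Pb - p| + `|Qb - q|) * (4 * h) ^+ n by rewrite mulrDl lerD.
have PAB0 : 0 <= `|Pb - p| `^ a + `|Qb - q| `^ b by rewrite addr_ge0// powR_ge0.
apply: (@le_trans _ _ (C * (`|Pb - p| `^ a + `|Qb - q| `^ b) * (D * h ^+ k))).
  apply: ler_wpM2l; first by rewrite mulr_ge0// ltW.
  exact: le_trans (ler_norm _) hT.
apply: (@le_trans _ _ (C * ((`|Pb - p| + `|Qb - q|) * (4 * h) ^+ n) * (D * h ^+ k))).
  apply: ler_wpM2r; first by rewrite mulr_ge0// exprn_ge0.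
  by apply: ler_wpM2l => //; exact: ltW.
by rewrite exprMn exprD le_eqVlt; apply/orP; left; apply/eqP; ring.
Qed.

(* Since the flow stays on an energy level, a large step [tau] forces
   [tau^-1 <= 4 D h^k], and then the increments are bounded by [8 h]. *)
Lemma step_consistency (v C1 C2 a b : R) (Theta1 Theta2 : R * R -> R * R -> R) :
  0 < v -> 0 < C1 -> 0 < C2 -> 1 <= a -> 1 <= b ->
  polynomial_growth Theta1 -> polynomial_growth Theta2 ->
  exists (D : R) (k : nat), 0 <= D /\ forall tau p q Pb Qb, 0 < tau ->
    coercive_hamiltonian v (Pb, Qb) = coercive_hamiltonian v (p, q) ->
    `|v / 2 * p + q ^+ 3 + tau^-1 * (Pb - p)| <=
      C1 * (`|Pb - p| `^ a + `|Qb - q| `^ b) * Theta1 (p, q) (Pb, Qb) ->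
    `|p + v / 2 * q - tau^-1 * (Qb - q)| <=
      C2 * (`|Pb - p| `^ a + `|Qb - q| `^ b) * Theta2 (p, q) (Pb, Qb) ->
    [/\ `|Pb - p| + `|Qb - q| <= tau * (D * coercive_hamiltonian v (p, q) ^+ k),
      `|v / 2 * p + q ^+ 3 + tau^-1 * (Pb - p)| <=
        tau * (D * coercive_hamiltonian v (p, q) ^+ k) &
      `|p + v / 2 * q - tau^-1 * (Qb - q)| <=
        tau * (D * coercive_hamiltonian v (p, q) ^+ k)].
Proof.
move=> v0 C10 C20 a1 b1 hT1 hT2.
have [D1 [k1 [D10 H1]]] := remainder_le v C10 a1 b1 hT1.
have [D2 [k2 [D20 H2]]] := remainder_le v C20 a1 b1 hT2.
pose k := maxn k1 k2; pose D := D1 + D2.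
have D0 : 0 <= D by exact: addr_ge0.
(* The first summand serves the case where [2 D h^k s] is at most half of [s / tau] and is absorbed;
   the second is [4 D h^k * 8 h] for a large step. *)
pose E := 2 * (10 + 2 * v) + 32 * D.
have E0 : 0 <= E by rewrite /E; lra.
exists (E * (1 + D)), (k + (k + 3))%N; split; first by rewrite mulr_ge0// addr_ge0.
move=> tau p q Pb Qb tau0 Hpq hA hB.
have {hA}hA := le_trans hA (H1 _ _ _ _ Hpq).
have {hB}hB := le_trans hB (H2 _ _ _ _ Hpq).
have [h1 p1 q1] := coercive_hamiltonian_abs_le v (p, q).
have [_ p2 q2] := coercive_hamiltonian_abs_le v (Pb, Qb); rewrite Hpq in p2 q2.
set h := coercive_hamiltonian v (p, q) in h1 p1 q1 p2 q2 hA hB *.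
rewrite /= in p1 q1 p2 q2.
have h0 : 0 <= h by exact: le_trans h1.
set s := `|Pb - p| + `|Qb - q| in hA hB *.
have s0 : 0 <= s by exact: addr_ge0.
have s8 : s <= 8 * h.
  have := ler_normB Pb p; have := ler_normB Qb q; rewrite /s; lra.
have hkk j : (j <= k)%N -> h ^+ j <= h ^+ k by move=> jk; exact: ler_weXn2l.
have hk0 j : 0 <= h ^+ j by exact: exprn_ge0.
have {}hA : `|v / 2 * p + q ^+ 3 + tau^-1 * (Pb - p)| <= D * h ^+ k * s.
  apply: le_trans hA _; apply: (ler_wpM2r s0); apply: ler_pM => //; last first.
    exact: hkk (leq_maxl _ _).
  by rewrite /D lerDl.
have {}hB : `|p + v / 2 * q - tau^-1 * (Qb - q)| <= D * h ^+ k * s.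
  apply: le_trans hB _; apply: (ler_wpM2r s0); apply: ler_pM => //; last first.
    exact: hkk (leq_maxr _ _).
  by rewrite /D lerDr.
have q3 : `|q ^+ 3| <= 8 * h ^+ 3.
  rewrite normrX (_ : 8 = 2 ^+ 3 :> R); last by ring.
  by rewrite -exprMn; apply: lerXn2r; rewrite ?nnegrE// mulr_ge0.
have h3 : h <= h ^+ 3 by rewrite -[leLHS]expr1; exact: ler_weXn2l.
have ti0 : 0 < tau^-1 by rewrite invr_gt0.
have v2 : 0 <= v / 2 by rewrite divr_ge0// ltW.
have sA : tau^-1 * `|Pb - p| <= v * h + 8 * h ^+ 3 + D * h ^+ k * s.
  rewrite -(gtr0_norm ti0) -normrM.
  have -> : tau^-1 * (Pb - p) = (v / 2 * p + q ^+ 3 + tau^-1 * (Pb - p)) -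
    (v / 2 * p + q ^+ 3) by ring.
  apply: le_trans (ler_normB _ _) _; rewrite addrC; apply: lerD => //.
  apply: le_trans (ler_normD _ _) _; apply: lerD => //.
  rewrite normrM (ger0_norm v2); apply: le_trans (ler_wpM2l v2 p1) _; lra.
have sB : tau^-1 * `|Qb - q| <= 2 * h + v * h + D * h ^+ k * s.
  rewrite -(gtr0_norm ti0) -normrM.
  have -> : tau^-1 * (Qb - q) = (p + v / 2 * q) -
    (p + v / 2 * q - tau^-1 * (Qb - q)) by ring.
  apply: le_trans (ler_normB _ _) _; apply: lerD => //.
  apply: le_trans (ler_normD _ _) _; apply: lerD => //.
  rewrite normrM (ger0_norm v2); apply: le_trans (ler_wpM2l v2 q1) _; lra.
have vh3 : v * h <= v * h ^+ 3 by apply: ler_wpM2l => //; exact: ltW.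
have sAB : tau^-1 * s <= (10 + 2 * v) * h ^+ 3 + 2 * (D * h ^+ k * s).
  by have -> : tau^-1 * s = tau^-1 * `|Pb - p| + tau^-1 * `|Qb - q|;
    [rewrite -mulrDr|lra].
have hk3 : h ^+ 3 <= h ^+ (k + 3) by apply: ler_weXn2l => //; rewrite leq_addl.
have hk1 : h ^+ k * h <= h ^+ (k + 3).
  by rewrite -exprSr; apply: ler_weXn2l => //; rewrite -addn1 leq_add2l.
have v10 : 0 <= 10 + 2 * v by lra.
have sE : s <= tau * (E * h ^+ (k + 3)).
  rewrite -ler_pdivrMl//.
  have r1 : 2 * (10 + 2 * v) * h ^+ 3 <= 2 * (10 + 2 * v) * h ^+ (k + 3).
    by apply: ler_wpM2l => //; rewrite mulr_ge0.
  have r2 : D * (h ^+ k * h) <= D * h ^+ (k + 3) by exact: ler_wpM2l.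
  have r3 : 0 <= D * h ^+ (k + 3) by exact: mulr_ge0.
  have r4 : 0 <= (10 + 2 * v) * h ^+ (k + 3) by exact: mulr_ge0.
  have r5 : 0 <= (10 + 2 * v) * h ^+ 3 by exact: mulr_ge0.
  have [small|large] := leP (4 * (D * h ^+ k)) tau^-1.
    have := ler_wpM2r s0 small; rewrite /E; lra.
  have l1 : tau^-1 * s <= 4 * (D * h ^+ k) * s by apply: ler_wpM2r => //; exact: ltW.
  have l2 : 4 * (D * h ^+ k) * s <= 4 * (D * h ^+ k) * (8 * h).
    by apply: ler_wpM2l => //; rewrite !mulr_ge0.
  rewrite /E; lra.
have sE2 : D * h ^+ k * s <= tau * (E * (1 + D) * h ^+ (k + (k + 3))).
  apply: le_trans (ler_wpM2l _ sE) _; first exact: mulr_ge0.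
  have -> : D * h ^+ k * (tau * (E * h ^+ (k + 3))) =
    tau * (D * (E * h ^+ (k + (k + 3)))) by rewrite [in RHS]exprD; ring.
  apply: ler_wpM2l; first exact: ltW.
  have : 0 <= E * h ^+ (k + (k + 3)) by exact: mulr_ge0.
  lra.
split; [|exact: le_trans hA sE2|exact: le_trans hB sE2].
apply: le_trans sE _; apply: ler_wpM2l; first exact: ltW.
apply: ler_pM => //.
  by rewrite mulrDr mulr1 lerDl mulr_ge0.
by apply: ler_weXn2l => //; rewrite leq_addl.
Qed.
End Consistency.

(** * Recursion for the error *)

Section Recursion.
Context (R : realType).

Lemma pow_le_expR (b : R) (n : nat) : 0 < b ->
  exists2 C : R, 0 <= C & forall x, 0 <= x -> x ^+ n <= C * expR (b * x).
Proof.
move=> b0; pose N : R := n.+1%:R; have N0 : 0 < N by rewrite ltr0n.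
exists ((N / b) ^+ n); first by rewrite exprn_ge0// divr_ge0// ltW.
move=> x x0.
have y0 : 0 <= b * x / N by rewrite divr_ge0 ?(ltW N0)// mulr_ge0// ltW.
have xE : x = N / b * (b * x / N) by field; rewrite !gt_eqF.
have le1 : x <= N / b * expR (b * x / N).
  rewrite {1}xE; apply: ler_wpM2l; first by rewrite divr_ge0// ltW.
  by apply: le_trans (expR_ge1Dx _); rewrite lerDr.
apply: (@le_trans _ _ ((N / b * expR (b * x / N)) ^+ n)).
  by rewrite lerXn2r ?nnegrE// mulr_ge0 ?expR_ge0// divr_ge0// ltW.
rewrite exprMn; apply: ler_wpM2l; first by rewrite exprn_ge0// divr_ge0// ltW.
rewrite -expRM_natl ler_expR.
have : n%:R * (b * x / N) <= N * (b * x / N).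
  by apply: ler_wpM2r => //; rewrite ler_nat.
by move/le_trans; apply; rewrite mulrC divfK// gt_eqF.
Qed.

(** Jensen's inequality by summing the tangent inequalities at the mean, whose linear parts
    cancel. *)
Lemma expR_mean_le (m : nat) (x : nat -> R) : (0 < m)%N ->
  expR ((\sum_(j < m) x j) / m%:R) <= (\sum_(j < m) expR (x j)) / m%:R.
Proof.
move=> m0; have m0' : 0 < m%:R :> R by rewrite ltr0n.
set s := _ / _.
have hj j : expR s * (1 + (x j - s)) <= expR (x j).
  have -> : expR (x j) = expR s * expR (x j - s) by rewrite -expRD subrKC.
  by apply: ler_wpM2l; [exact: expR_ge0|exact: expR_ge1Dx].
rewrite ler_pdivlMr//.
apply: le_trans (_ : \sum_(j < m) expR s * (1 + (x j - s)) <= _); last first.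
  by apply: ler_sum => j _.
rewrite -mulr_sumr big_split/= sumrB !sumr_const card_ord -[s *+ m]mulr_natr.
by rewrite /s divfK ?gt_eqF// subrr addr0.
Qed.

(** Multiplying the inequality for [n] by [x] leaves the surplus [(n + 1) s^n (x - s)^2]. *)
Lemma expr_tangent_le (n : nat) (s x : R) : 0 <= s -> 0 <= x ->
  s ^+ n.+1 + n.+1%:R * s ^+ n * (x - s) <= x ^+ n.+1.
Proof.
move=> s0 x0; elim: n => [|n IH]; first by rewrite !expr1 expr0 !mul1r; lra.
have := ler_wpM2l x0 IH; rewrite -exprS; apply: le_trans.
have sn : 0 <= s ^+ n by exact: exprn_ge0.
have : 0 <= n.+1%:R * s ^+ n * (x - s) ^+ 2 by rewrite mulr_ge0 ?sqr_ge0// mulr_ge0.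
have -> : n.+2%:R = n.+1%:R + 1 :> R by rewrite natr1.
by rewrite !exprS; move: (s ^+ n) (n.+1%:R : R) => a b; nra.
Qed.

Lemma expr_mean_le (m n : nat) (x : nat -> R) : (0 < m)%N -> (0 < n)%N ->
  (forall j, (j < m)%N -> 0 <= x j) ->
  ((\sum_(j < m) x j) / m%:R) ^+ n <= (\sum_(j < m) x j ^+ n) / m%:R.
Proof.
move=> m0 n0 x0; have m0' : 0 < m%:R :> R by rewrite ltr0n.
case: n n0 => [//|n] _.
set s := _ / _.
have s0 : 0 <= s by rewrite divr_ge0// sumr_ge0// => j _; exact: x0.
rewrite ler_pdivlMr//.
apply: le_trans (_ : \sum_(j < m) (s ^+ n.+1 + n.+1%:R * s ^+ n * (x j - s)) <= _);
  last by apply: ler_sum => j _; apply: expr_tangent_le => //; exact: x0.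
rewrite big_split/= -mulr_sumr sumrB !sumr_const card_ord -[s *+ m]mulr_natr.
by rewrite -[s ^+ _ *+ m]mulr_natr /s divfK ?gt_eqF// subrr mulr0 addr0.
Qed.

Lemma gronwall_recursion (tau : R) (E K F : nat -> R) (m : nat) :
  0 <= tau -> E 0%N = 0 -> (forall j, (j < m)%N -> 0 <= K j) ->
  (forall j, (j < m)%N -> 0 <= F j) ->
  (forall j, (j < m)%N -> E j.+1 <= expR (K j * tau) * (E j + F j * tau)) ->
  E m <= expR (tau * \sum_(j < m) K j) * (tau * \sum_(j < m) F j).
Proof.
move=> tau0 E0; elim: m => [|m IH] K0 F0 HE.
  by rewrite !big_ord0 E0 !mulr0.
have {}IH := IH (fun j jm => K0 j (ltnW jm)) (fun j jm => F0 j (ltnW jm))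
  (fun j jm => HE j (ltnW jm)).
apply: le_trans (HE m (ltnSn m)) _.
rewrite !big_ord_recr/= [tau * (_ + K m)]mulrDr expRD.
rewrite [tau * K m]mulrC [expR _ * expR _]mulrC -mulrA.
apply: ler_wpM2l; first exact: expR_ge0.
rewrite mulrDr mulrDr [tau * F m]mulrC; apply: lerD => //.
rewrite ler_peMl//; first by rewrite mulr_ge0// F0.
rewrite -[leLHS]expR0 ler_expR mulr_ge0// sumr_ge0// => j _.
by apply: K0; rewrite ltnS ltnW.
Qed.

(* Jensen turns the exponential of the accumulated rate and the power of the
   accumulated forcing into means over the steps, whose expectation only
   involves one step at a time. *)
Lemma error_moment_bound (T be c0 del D : R) (ka n : nat) :
  0 < T -> 0 < be -> 0 <= c0 -> 0 <= D -> (0 < n)%N ->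
  2 * n%:R * T * del <= be ->
  exists C c : R, [/\ 0 <= C, 0 <= c &
  forall (tau S : R) (m : nat) (h ze E K F : nat -> R),
    0 < tau -> (0 < m)%N -> m%:R * tau <= T -> 0 <= S ->
    (forall j, 0 <= h j) -> (forall j, 0 <= ze j) -> E 0%N = 0 -> 0 <= E m ->
    (forall j, (j < m)%N -> E j.+1 <= expR (K j * tau) * (E j + F j * tau)) ->
    (forall j, (j < m)%N -> 0 <= K j <= c0 + del * h j + c0 * (ze j + S)) ->
    (forall j, (j < m)%N -> 0 <= F j <= tau ^+ 2 * (D * (h j + S + ze j) ^+ ka)) ->
    (E m / tau ^+ 2) ^+ n <=
      C * ((\sum_(j < m) expR (be * h j + c * (ze j + S))) / m%:R)].
Proof.
move=> T0 be0 c00 D0 n0 hdel.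
have [Cp Cp0 hCp] := pow_le_expR (ka * (2 * n))%N be0.
(* Large enough for both uses: [2 n T c0] comes from the rate raised to the power [2 n], and [be]
   from bounding a power of [h + S + ze] by an exponential. *)
pose c := be + 2 * n%:R * T * c0.
pose C1 := expR (2 * n%:R * T * c0).
pose C2 := (T * D) ^+ (2 * n) * Cp.
have nT0 : 0 <= 2 * n%:R * T by rewrite !mulr_ge0// ltW.
have C20 : 0 <= C2 by rewrite mulr_ge0// exprn_ge0// mulr_ge0// ltW.
exists (C1 + C2), c; split; first by rewrite addr_ge0// expR_ge0.
  by rewrite addr_ge0 ?mulr_ge0// ltW.
move=> tau S m h ze E K F tau0 m0 mT S0 h0 ze0 E0 Em0 HE HK HF.
have m0' : 0 < m%:R :> R by rewrite ltr0n.
have K0 j : (j < m)%N -> 0 <= K j by move=> /HK/andP[].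
have F0 j : (j < m)%N -> 0 <= F j by move=> /HF/andP[].
have H := gronwall_recursion (ltW tau0) E0 K0 F0 HE.
pose y j := D * (h j + S + ze j) ^+ ka.
have L0 j : 0 <= h j + S + ze j by rewrite !addr_ge0.
have y0 j : 0 <= y j by rewrite mulr_ge0// exprn_ge0.
have t2 : 0 < tau ^+ 2 by rewrite exprn_gt0.
have sumF : tau * (\sum_(j < m) F j) <= tau ^+ 2 * (T * ((\sum_(j < m) y j) / m%:R)).
  have s1 : \sum_(j < m) F j <= tau ^+ 2 * \sum_(j < m) y j.
    by rewrite mulr_sumr; apply: ler_sum => j _; case/andP: (HF j (ltn_ord j)).
  apply: le_trans (ler_wpM2l (ltW tau0) s1) _.
  rewrite mulrCA; apply: ler_wpM2l; first exact: ltW.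
  rewrite mulrA ler_pdivlMr// mulrAC; apply: ler_wpM2r; first exact: sumr_ge0.
  by rewrite mulrC.
set X := expR (tau * \sum_(j < m) K j) in H.
set Y := T * ((\sum_(j < m) y j) / m%:R) in sumF.
have X0 : 0 <= X by exact: expR_ge0.
have Y0 : 0 <= Y by rewrite mulr_ge0 ?(ltW T0)// divr_ge0// sumr_ge0.
have EXY : E m / tau ^+ 2 <= X * Y.
  rewrite ler_pdivrMr//; apply: le_trans H _; rewrite -mulrA [Y * _]mulrC.
  exact: ler_wpM2l.
(* Separates the Gronwall factor from the forcing without Hölder's inequality; this doubling of the
   exponent is the 2 in the condition on [del]. *)
have XYn : (E m / tau ^+ 2) ^+ n <= X ^+ (2 * n) + Y ^+ (2 * n).
  apply: (@le_trans _ _ ((X * Y) ^+ n)).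
    have Et0 : 0 <= E m / tau ^+ 2 by rewrite divr_ge0// ltW.
    have XY0 : 0 <= X * Y by exact: mulr_ge0.
    by apply: lerXn2r; rewrite ?nnegrE.
  rewrite exprMn !(mulnC 2%N) !exprM.
  have a0 := exprn_ge0 n X0; have b0 := exprn_ge0 n Y0.
  have := sqr_ge0 (X ^+ n - Y ^+ n); have := sqr_ge0 (X ^+ n + Y ^+ n); lra.
apply: le_trans XYn _; rewrite mulrDl; apply: lerD.
  rewrite /X -expRM_natl.
  have le1 : (2 * n)%:R * (tau * \sum_(j < m) K j) <=
      (\sum_(j < m) (2 * n%:R * T * K j)) / m%:R.
    rewrite -mulr_sumr ler_pdivlMr// natrM mulrA mulrAC; apply: ler_wpM2r.
      by rewrite sumr_ge0// => j _; apply: K0.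
    by rewrite -!mulrA; do 2 (apply: ler_wpM2l => //); rewrite mulrC.
  apply: (@le_trans _ _ (expR ((\sum_(j < m) (2 * n%:R * T * K j)) / m%:R))).
    by rewrite ler_expR.
  apply: le_trans (expR_mean_le (fun j => 2 * n%:R * T * K j) m0) _.
  rewrite mulrA; apply: ler_wpM2r; first by rewrite invr_ge0 ltW.
  rewrite mulr_sumr; apply: ler_sum => j _.
  rewrite /C1 -expRD ler_expR.
  have /andP[_ Kj] := HK j (ltn_ord j).
  apply: le_trans (ler_wpM2l nT0 Kj) _; rewrite /c.
  have d1 := ler_wpM2r (h0 j) hdel.
  have d2 : 0 <= be * (ze j + S) by rewrite mulr_ge0 ?addr_ge0// ltW.
  lra.
rewrite /Y exprMn.
have n20 : (0 < 2 * n)%N by rewrite muln_gt0.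
apply: (@le_trans _ _ (T ^+ (2 * n) * ((\sum_(j < m) y j ^+ (2 * n)) / m%:R))).
  apply: ler_wpM2l; first by rewrite exprn_ge0// ltW.
  by apply: expr_mean_le => // j _.
rewrite mulrA [leRHS]mulrA; apply: ler_wpM2r; first by rewrite invr_ge0 ltW.
rewrite !mulr_sumr; apply: ler_sum => j _.
rewrite /y exprMn -exprM /C2 exprMn mulrA -!mulrA.
apply: ler_wpM2l; first by rewrite exprn_ge0// ltW.
apply: ler_wpM2l; first by rewrite exprn_ge0.
apply: le_trans (hCp _ (L0 j)) _; apply: ler_wpM2l => //.
rewrite ler_expR /c.
have d2 : 0 <= 2 * n%:R * T * c0 * (ze j + S) by rewrite !mulr_ge0 ?addr_ge0// ltW.
lra.
Qed.
End Recursion.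

(** * Rate and forcing of a step in terms of the modified Hamiltonian *)

Section StepConstants.
Context (R : realType).

(** The coefficient [del] of [h] can be arbitrarily small because [x^2 <= e x^4 + 1 / (4 e)] and [h]
    controls fourth powers of the positions. *)
Lemma step_rate_le (v sigma del : R) : 0 <= sigma -> 0 < del ->
  exists2 c0 : R, 0 <= c0 & forall tau S p q Pb Qb N : R, 0 < tau -> tau <= 1 ->
    0 <= S -> coercive_hamiltonian v (Pb, Qb) = coercive_hamiltonian v (p, q) ->
    0 <= 10 + 9 * (`|q| + `|Qb - q| + 2 * `|Qb|) ^+ 2 +
      6 * (sigma * (`|N| + tau * (2 * S))) <=
    c0 + del * coercive_hamiltonian v (p, q) + c0 * (`|N| / tau + S).
Proof.
(* Here 9 is the coefficient in the rate, [13 = 2^2 + 3^2] comes from Cauchy-Schwarz, and 16 is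
   twice the 8 of [x^4 <= 8 h], for two positions. *)
move=> s0 del0; pose e := del / (9 * 13 * 16).
have e0 : 0 < e by rewrite divr_gt0// !mulr_gt0.
pose c1 := 10 + 9 * 13 * 2 / (4 * e).
have c10 : 0 <= c1 by rewrite addr_ge0// divr_ge0// !mulr_ge0// ltW.
exists (c1 + 12 * sigma); first by rewrite addr_ge0// mulr_ge0.
move=> tau S p q Pb Qb N tau0 tau1 S0 E.
have q4 := coercive_hamiltonian_ge v (p, q).
have Q4 := coercive_hamiltonian_ge v (Pb, Qb); rewrite E in Q4.
set h := coercive_hamiltonian v (p, q) in q4 Q4 *; rewrite /= in q4 Q4.
have hx (x y : R) : 1 + y ^+ 2 / 4 + x ^+ 4 / 8 <= h -> x ^+ 2 <= 8 * e * h + (4 * e)^-1.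
  move=> xh; have : x ^+ 4 <= 8 * h by have := sqr_ge0 y; lra.
  move=> /(ler_wpM2l (ltW e0)) x4.
  have -> : 8 * e * h = e * (8 * h) by ring.
  apply: le_trans (_ : e * x ^+ 4 + (4 * e)^-1 <= _); last by rewrite lerD2r.
  have : 0 <= (4 * e)^-1 * (2 * e * x ^+ 2 - 1) ^+ 2.
    by rewrite mulr_ge0 ?sqr_ge0// invr_ge0 mulr_ge0// ltW.
  have -> : (4 * e)^-1 * (2 * e * x ^+ 2 - 1) ^+ 2 =
    e * x ^+ 4 + (4 * e)^-1 - x ^+ 2 by field; rewrite gt_eqF.
  by rewrite subr_ge0.
have hq := hx _ _ q4; have hQ := hx _ _ Q4.
have B1 : `|q| + `|Qb - q| + 2 * `|Qb| <= 2 * `|q| + 3 * `|Qb|.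
  have := ler_normB Qb q; lra.
have B2 : (`|q| + `|Qb - q| + 2 * `|Qb|) ^+ 2 <= 13 * (q ^+ 2 + Qb ^+ 2).
  apply: (@le_trans _ _ ((2 * `|q| + 3 * `|Qb|) ^+ 2)).
    by apply: lerXn2r; rewrite ?nnegrE ?addr_ge0// mulr_ge0.
  have := sqr_ge0 (3 * `|q| - 2 * `|Qb|).
  rewrite -(real_normK (num_real q)) -(real_normK (num_real Qb)); lra.
have N1 : `|N| <= `|N| / tau by rewrite ler_pdivlMr// ler_piMr.
have S1 : tau * (2 * S) <= 2 * S by rewrite ler_piMl// mulr_ge0.
have N0 : 0 <= `|N| / tau by rewrite divr_ge0// ltW.
have S2 : sigma * (`|N| + tau * (2 * S)) <= sigma * (2 * (`|N| / tau + S)).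
  by apply: ler_wpM2l => //; lra.
have NS0 : 0 <= `|N| / tau + S by rewrite addr_ge0.
have c1NS : 0 <= c1 * (`|N| / tau + S) by exact: mulr_ge0.
apply/andP; split.
  apply: addr_ge0; last first.
    by apply: mulr_ge0 => //; apply: mulr_ge0 => //; rewrite addr_ge0// !mulr_ge0// ltW.
  by apply: addr_ge0 => //; apply: mulr_ge0 => //; exact: sqr_ge0.
have eh : 9 * 13 * 16 * e * h = del * h by rewrite /e; field.
have -> : 10 = c1 - 9 * 13 * 2 * (4 * e)^-1 by rewrite /c1; ring.
lra.
Qed.

(** Each term contains [G^2], which supplies [tau^2]; the remaining factors are bounded by powers of
    [M]. The constant is [427 = 324 + 2 + 25 * 4 + 1]. *)
Lemma forcing_le (M G q tau : R) : 1 <= M -> 0 <= tau -> tau <= 1 ->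
  0 <= G -> G <= tau * M -> `|q| <= M ->
  324 * G ^+ 8 + 2 * G ^+ 2 + 25 * (G * (q ^+ 2 + G ^+ 2)) ^+ 2 + G ^+ 4 <=
  tau ^+ 2 * (427 * M ^+ 8).
Proof.
move=> M1 t0 t1 G0 GM qM; have M0 : 0 <= M by exact: le_trans M1.
have GM' : G <= M by apply: le_trans GM _; rewrite ler_piMl.
have MX k : (k <= 8)%N -> M ^+ k <= M ^+ 8 by move=> ?; exact: ler_weXn2l.
have G2 : G ^+ 2 <= tau ^+ 2 * M ^+ 2.
  by rewrite -exprMn lerXn2r ?nnegrE// mulr_ge0.
have GX k : G ^+ k <= M ^+ k by rewrite lerXn2r ?nnegrE.
have G2X k (y : R) : (k + 2 <= 8)%N -> 0 <= y -> y <= M ^+ k ->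
    G ^+ 2 * y <= tau ^+ 2 * M ^+ 8.
  move=> k8 y0 yM; apply: (@le_trans _ _ (tau ^+ 2 * M ^+ 2 * M ^+ k)).
    by apply: ler_pM => //; exact: sqr_ge0.
  rewrite -mulrA -exprD; apply: ler_wpM2l; first exact: sqr_ge0.
  by apply: MX; rewrite addnC.
have a1 : G ^+ 8 <= tau ^+ 2 * M ^+ 8.
  by rewrite -[8%N]/(2 + 6)%N exprD; apply: (G2X 6); rewrite ?exprn_ge0.
have a2 : G ^+ 2 <= tau ^+ 2 * M ^+ 8.
  by rewrite -[leLHS]mulr1; apply: (G2X 0); rewrite ?expr0.
have a3 : G ^+ 4 <= tau ^+ 2 * M ^+ 8.
  by rewrite -[4%N]/(2 + 2)%N exprD; apply: (G2X 2); rewrite ?exprn_ge0.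
have q2 : q ^+ 2 <= M ^+ 2 by rewrite -real_normK ?num_real// lerXn2r ?nnegrE.
have a4 : (G * (q ^+ 2 + G ^+ 2)) ^+ 2 <= 4 * (tau ^+ 2 * M ^+ 8).
  have -> : (G * (q ^+ 2 + G ^+ 2)) ^+ 2 =
    4 * (G ^+ 2 * ((q ^+ 2 + G ^+ 2) / 2) ^+ 2) by field.
  rewrite ler_pM2l//; apply: (G2X 4) => //; first exact: sqr_ge0.
  have -> : M ^+ 4 = (M ^+ 2) ^+ 2 by rewrite -exprM.
  apply: lerXn2r; rewrite ?nnegrE.
  - by rewrite divr_ge0// addr_ge0// sqr_ge0.
  - exact: sqr_ge0.
  - have := GX 2; lra.
lra.
Qed.

Lemma step_forcing_le (v sigma D : R) (k : nat) : 0 < v -> 0 <= sigma -> 0 <= D ->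
  exists (D' : R) (ka : nat), 0 <= D' /\ forall tau S p q Pb Qb N : R,
    0 < tau -> tau <= 1 -> 0 <= S ->
    coercive_hamiltonian v (Pb, Qb) = coercive_hamiltonian v (p, q) ->
    let h := coercive_hamiltonian v (p, q) in
    `|Pb - p| + `|Qb - q| <= tau * (D * h ^+ k) ->
    forall G, G = step_size_bound v sigma tau (2 * S) p q Pb Qb N
      (tau * (D * h ^+ k)) (tau * (D * h ^+ k)) ->
    0 <= 324 * G ^+ 8 + 2 * G ^+ 2 + 25 * (G * (q ^+ 2 + G ^+ 2)) ^+ 2 + G ^+ 4 <=
    tau ^+ 2 * (D' * (h + S + `|N| / tau) ^+ ka).
Proof.
(* Term by term from [step_size_bound]; [2 * D] accounts for the two consistency errors, and the
   last 2 makes [D1 * Y] dominate 1 and [|q|]. *)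
move=> v0 s0 D0; pose D1 := (1 + v) ^+ 2 * (D + 8 + 7 * sigma) + 2 * D + 2.
have L0 : 0 <= (1 + v) ^+ 2 by exact: sqr_ge0.
have D10 : 2 <= D1.
  have : 0 <= (1 + v) ^+ 2 * (D + 8 + 7 * sigma).
    by apply: mulr_ge0 => //; rewrite !addr_ge0// mulr_ge0.
  rewrite /D1; lra.
have D1ge0 : 0 <= D1 by exact: le_trans D10.
exists (427 * D1 ^+ 8), (k.+1 * 8)%N; split.
  by apply: mulr_ge0; [exact: ler0n|exact: exprn_ge0].
move=> tau S p q Pb Qb N tau0 tau1 S0 E h hAB G GE.
have [h1 p1 q1] := coercive_hamiltonian_abs_le v (p, q).
have [_ p2 q2] := coercive_hamiltonian_abs_le v (Pb, Qb); rewrite E in p2 q2.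
rewrite -/h /= in h1 p1 q1 p2 q2.
have t0 := ltW tau0.
have N0 : 0 <= `|N| / tau by rewrite divr_ge0.
pose La := h + S + `|N| / tau.
have La1 : 1 <= La by rewrite /La; lra.
have La0 : 0 <= La by exact: le_trans La1.
have h0 : 0 <= h by exact: le_trans h1.
have LaX : La <= La ^+ k.+1 by rewrite -[leLHS]expr1; exact: ler_weXn2l.
have hX : h ^+ k <= La ^+ k.+1.
  apply: (@le_trans _ _ (La ^+ k)); last exact: ler_weXn2l.
  by apply: lerXn2r; rewrite ?nnegrE//; rewrite /La; lra.
set Y := La ^+ k.+1 in LaX hX.
have hk0 : 0 <= h ^+ k by exact: exprn_ge0.
have Dh0 : 0 <= D * h ^+ k by exact: mulr_ge0.
have DhY : D * h ^+ k <= D * Y by exact: ler_wpM2l.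
have hL : h <= La by rewrite /La; lra.
have SL : S <= La by rewrite /La; lra.
have NL : `|N| / tau <= La by rewrite /La; lra.
have GM : G <= tau * (D1 * Y).
  have NE : `|N| = tau * (`|N| / tau) by rewrite mulrC divfK// gt_eqF.
  rewrite GE /step_size_bound {1}NE.
  apply: (@le_trans _ _ (tau * ((1 + v) ^+ 2 * (D * h ^+ k + 2 * (`|Pb| + sigma * (2 * S)) +
     2 * `|Qb| + sigma * (`|N| / tau + 2 * S)) + 2 * (D * h ^+ k)))).
    have := ler_wpM2l L0 hAB; lra.
  apply: (ler_wpM2l t0); rewrite /D1.
  have sS : sigma * S <= sigma * Y by apply: ler_wpM2l => //; lra.
  have sN : sigma * (`|N| / tau) <= sigma * Y by apply: ler_wpM2l => //; lra.
  have : (1 + v) ^+ 2 * (D * h ^+ k + 2 * (`|Pb| + sigma * (2 * S)) +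
     2 * `|Qb| + sigma * (`|N| / tau + 2 * S)) <=
     (1 + v) ^+ 2 * ((D + 8 + 7 * sigma) * Y) by apply: ler_wpM2l => //; lra.
  have Y0 : 0 <= Y by lra.
  lra.
have G0 : 0 <= G.
  have tD : 0 <= tau * (D * h ^+ k) by exact: mulr_ge0.
  rewrite GE /step_size_bound; apply: addr_ge0 => //; apply: addr_ge0 => //.
  apply: mulr_ge0 => //.
  have sS : 0 <= sigma * (2 * S) by rewrite !mulr_ge0.
  rewrite !addr_ge0// ?mulr_ge0// ?addr_ge0// ?mulr_ge0//.
apply/andP; split.
  apply: addr_ge0; last exact: exprn_ge0.
  apply: addr_ge0; last exact: mulr_ge0 (ler0n _ 25) (sqr_ge0 _).
  exact: addr_ge0 (mulr_ge0 (ler0n _ 324) (exprn_ge0 8 G0))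
    (mulr_ge0 (ler0n _ 2) (exprn_ge0 2 G0)).
have -> : 427 * D1 ^+ 8 * (h + S + `|N| / tau) ^+ (k.+1 * 8) = 427 * (D1 * Y) ^+ 8.
  have YE : Y ^+ 8 = La ^+ (k.+1 * 8) by rewrite /Y exprM.
  by rewrite [in RHS]exprMn YE; exact: (esym (mulrA 427 (D1 ^+ 8) _)).
have Y1 : 1 <= Y by lra.
have D1Y : 2 * Y <= D1 * Y by apply: ler_wpM2r => //; lra.
by apply: forcing_le => //; lra.
Qed.
End StepConstants.

(** * The splitting method *)

Section Splitting.
Context (R : realType) (d : measure_display) (O : measurableType d).
Context (P : probability O R) (cP : measure_is_complete P).
Context (F : R -> set (set O)) (hF : filtration F).
Context (W : R -> O -> R) (hW : wiener_process P F W).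
Context (v sigma p0 q0 tau : R) (v0 : 0 < v) (s0 : 0 < sigma).
Context (tau0 : 0 < tau) (tau1 : tau <= 1).
Context (A B : R * R -> R * R -> R) (psi phi : R * R -> R).
Context (Pn Qn Pbar Qbar : nat -> O -> R) (Pt Qt : nat -> R -> O -> R).
Context (hS : splitting_method P F W v sigma p0 q0 tau A B psi phi
  Pn Qn Pbar Qbar Pt Qt).

Let t0 : 0 <= tau := ltW tau0.

Lemma gridS n : grid tau n.+1 = grid tau n + tau.
Proof. by rewrite /grid -natr1; ring. Qed.

Lemma grid_ge0 n : 0 <= grid tau n.
Proof. by rewrite /grid mulr_ge0. Qed.

Lemma grid_leS n : grid tau n <= grid tau n.+1.
Proof. by rewrite gridS lerDl. Qed.

Lemma splitting_adapted n (C : set (R * R)) : measurable C ->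
  F (grid tau n) ((fun w => (Pn n w, Qn n w)) @^-1` C).
Proof.
case: n C => [|n] C mC.
  have -> : (fun w => (Pn 0%N w, Qn 0%N w)) = fun=> (p0, q0).
    by apply/funext => w; have [-> ->] := splitting_init hS w.
  exact: (cst_adapted hF (p0, q0) (grid_ge0 0)).
have [[aP aQ] _ _ _] := splitting_stochastic hS n.
have tI : `[grid tau n, grid tau n.+1]%classic (grid tau n.+1).
  by rewrite /= in_itv/= lexx grid_leS.
apply: preimage_pair_sub_sigma_algebra mC.
- exact: (filtration_sigma_algebra hF (grid_ge0 n.+1)).
- move=> B' mB; rewrite (_ : Pn n.+1 = Pt n (grid tau n.+1)); first exact: aP.
  by apply/funext => w; have [-> _] := splitting_next hS n w.
- move=> B' mB; rewrite (_ : Qn n.+1 = Qt n (grid tau n.+1)); first exact: aQ.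
  by apply/funext => w; have [_ ->] := splitting_next hS n w.
Qed.

Lemma splitting_bar_adapted n (C : set (R * R)) : measurable C ->
  F (grid tau n) ((fun w => (Pbar n w, Qbar n w)) @^-1` C).
Proof.
move=> mC; have mpsi : measurable_fun setT (fun x : R * R => (psi x, phi x)).
  apply: measurable_fun_pair; first exact: (splitting_measurable_psi hS).
  exact: (splitting_measurable_phi hS).
have -> : (fun w => (Pbar n w, Qbar n w)) =
    (fun x => (psi x, phi x)) \o (fun w => (Pn n w, Qn n w)).
  by apply/funext => w /=; have [-> ->] := splitting_solvable hS n w.
rewrite comp_preimage; apply: splitting_adapted.
by rewrite -[X in measurable X]setTI; exact: mpsi.
Qed.

Lemma adapted_measurable t (x : O -> R * R) : 0 <= t ->
  (forall C : set (R * R), measurable C -> F t (x @^-1` C)) ->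
  measurable_fun setT x.
Proof.
by move=> t_ge0 hx _ C mC; rewrite setTI; apply: (filtration_measurable hF t_ge0); exact: hx.
Qed.

(** The deterministic step leaves [h] unchanged and the stochastic one keeps the same [be] at the
    price of a factor exponential in [tau]; these factors multiply to one in [t_n], uniformly in
    [tau]. *)
Lemma splitting_energy_moment (be : R) n : 0 <= be ->
  2 * be * sigma ^+ 2 <= v -> 2 * be * sigma ^+ 2 <= 1 ->
  (\int[P]_w (expR (be * coercive_hamiltonian v (Pn n w, Qn n w)))%:E <=
   (expR (be * (v * (v ^+ 4 / 8 + 1) + sigma ^+ 2) * grid tau n) *
    expR (be * coercive_hamiltonian v (p0, q0)))%:E)%E.
Proof.
move=> be0 bev be1; elim: n => [|n IH].
  rewrite (eq_integral (fun=> (expR (be * coercive_hamiltonian v (p0, q0)))%:E)).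
    by rewrite integral_probability_cst lee_fin /grid mul0r mulr0 expR0 mul1r.
  by move=> w _; have [-> ->] := splitting_init hS w.
have mh (x : O -> R * R) : measurable_fun setT x ->
    measurable_fun setT (fun w => (expR (be * coercive_hamiltonian v (x w)))%:E).
  move=> mx; apply/measurable_EFinP; apply: measurableT_comp => //.
  apply: measurable_funM => //.
  exact: (measurableT_comp (measurable_coercive_hamiltonian v) mx).
have mPn := adapted_measurable (grid_ge0 n) (@splitting_adapted n).
have mPb := adapted_measurable (grid_ge0 n) (@splitting_bar_adapted n).
have IHb : (\int[P]_w (expR (be * coercive_hamiltonian v (Pbar n w, Qbar n w)))%:E <=
   (expR (be * (v * (v ^+ 4 / 8 + 1) + sigma ^+ 2) * grid tau n) *
    expR (be * coercive_hamiltonian v (p0, q0)))%:E)%E.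
  rewrite (_ : (\int[P]_w _ = \int[P]_w
    (expR (be * coercive_hamiltonian v (Pn n w, Qn n w)))%:E)%E)//.
  apply: ge0_ae_eq_integral => //; [exact: mh|exact: mh|].
  by apply: filterS (splitting_hamiltonian hS n) => w E _; rewrite /coercive_hamiltonian/= E.
have lt_grid : grid tau n < grid tau n.+1 by rewrite gridS ltrDl.
have st1 : grid tau n.+1 - grid tau n <= 1 by rewrite gridS addrC addKr.
have := ou_exp_moment cP hF hW v0 be0 bev be1 (grid_ge0 n) lt_grid st1
  (@splitting_bar_adapted n) (splitting_stochastic hS n) IHb.
rewrite mulrA -expRD -mulrDr subrK.
apply: le_trans; rewrite le_eqVlt; apply/orP; left; apply/eqP.
by apply: eq_integral => w _; have [-> ->] := splitting_next hS n w.
Qed.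

Context (X Y : R -> O -> R) (hXY : langevin_solution P F W v sigma p0 q0 X Y).
Context (D : R) (k : nat) (D0 : 0 <= D).
Context (hcons : forall m, {ae P, forall w,
  let h := coercive_hamiltonian v (Pn m w, Qn m w) in
  [/\ `|Pbar m w - Pn m w| + `|Qbar m w - Qn m w| <= tau * (D * h ^+ k),
    `|v / 2 * Pn m w + Qn m w ^+ 3 + tau^-1 * (Pbar m w - Pn m w)| <=
      tau * (D * h ^+ k) &
    `|Pn m w + v / 2 * Qn m w - tau^-1 * (Qbar m w - Qn m w)| <= tau * (D * h ^+ k)]}).
Context (vtau : v * tau <= 1) (T : R) (T0 : 0 < T) (S : O -> R).
Context (hSup : {ae P, forall w, forall t, 0 <= t <= T -> `|W t w - W 0 w| <= S w}).

Definition splitting_error (m : nat) (w : O) : R :=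
  error_energy
    (X (grid tau m) w - Pn m w + v / 2 * sigma * area W tau m w)
    (Y (grid tau m) w - Qn m w - sigma * area W tau m w).

Definition splitting_rate (m : nat) (w : O) : R :=
  10 + 9 * (`|Qn m w| + `|Qbar m w - Qn m w| + 2 * `|Qbar m w|) ^+ 2 +
  6 * (sigma * (`|area W tau m w| + tau * (2 * S w))).

Definition splitting_forcing (m : nat) (w : O) : R :=
  let h := coercive_hamiltonian v (Pn m w, Qn m w) in
  let G := step_size_bound v sigma tau (2 * S w) (Pn m w) (Qn m w)
    (Pbar m w) (Qbar m w) (area W tau m w)
    (tau * (D * h ^+ k)) (tau * (D * h ^+ k)) in
  324 * G ^+ 8 + 2 * G ^+ 2 + 25 * (G * (Qn m w ^+ 2 + G ^+ 2)) ^+ 2 + G ^+ 4.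

Lemma splitting_error_recursion : {ae P, forall w, splitting_error 0 w = 0 /\
  forall m, grid tau m.+1 <= T ->
    splitting_error m.+1 w <= expR (splitting_rate m w * tau) *
      (splitting_error m w + splitting_forcing m w * tau)}.
Proof.
have [_ cXY eqX eqY] := hXY.
(* The steps are countably many, so one almost sure event serves all of them; from there on the
   argument is pathwise. *)
have /ae_foralln hcons' := hcons.
have /ae_foralln cPQ : forall m, {ae P, forall w,
    {within `[grid tau m, grid tau m.+1], continuous (fun t => Pt m t w)} /\
    {within `[grid tau m, grid tau m.+1], continuous (fun t => Qt m t w)}}.
  by move=> m; have [] := splitting_stochastic hS m.
have /ae_foralln eqP : forall m, {ae P, forall w, forall t,
    `[grid tau m, grid tau m.+1]%classic t -> Pt m t w = Pbar m w +
    \int[lebesgue_measure]_(s in `[grid tau m, t]) (- (v / 2) * Pt m s w) +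
    sigma * (W t w - W (grid tau m) w)}.
  by move=> m; have [] := splitting_stochastic hS m.
have /ae_foralln eqQ : forall m, {ae P, forall w, forall t,
    `[grid tau m, grid tau m.+1]%classic t -> Qt m t w = Qbar m w +
    \int[lebesgue_measure]_(s in `[grid tau m, t]) (- (v / 2) * Qt m s w)}.
  by move=> m; have [] := splitting_stochastic hS m.
apply: filterS (filterI (filterI (filterI (wiener_continuous hW) hSup)
  (filterI cXY (filterI eqX eqY))) (filterI hcons' (filterI cPQ (filterI eqP eqQ)))).
move=> w [[[cW hSw] [[cX cY] [eX eY]]] [hc [cPt [eP eQ]]]].
have sub0T : (`[0, T] : set R) `<=` `[0, +oo[.
  by move=> x /=; rewrite !in_itv/= => /andP[->].
split.
  have z0 : `[0, +oo[%classic (0 : R) by rewrite /= in_itv/= lexx.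
  rewrite /splitting_error /area !big_ord0 /grid mul0r !mulr0.
  rewrite (eX 0 z0) (eY 0 z0) set_itv1 !Rintegral_set1 subrr mulr0 !addr0.
  have [-> ->] := splitting_init hS w.
  by rewrite !subrr ?subr0 /error_energy !(mul0r, mulr0, addr0).
move=> m mT; set a := grid tau m; have a0 : 0 <= a by exact: grid_ge0.
have bE : grid tau m.+1 = a + tau by exact: gridS.
rewrite bE in mT; have ab : a <= a + tau by rewrite lerDl.
have inT t : a <= t <= a + tau -> 0 <= t <= T.
  by move=> /andP[h1 h2]; rewrite (le_trans a0)//= (le_trans h2).
pose Xc := (fun t => X t w) \o clip 0 T; pose Yc := (fun t => Y t w) \o clip 0 T.
pose Wc := (fun t => W t w) \o clip 0 T.
pose Pc := (fun t => Pt m t w) \o clip a (a + tau).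
pose Qc := (fun t => Qt m t w) \o clip a (a + tau).
have T0' := ltW T0.
have cXc : continuous Xc by apply: clip_continuous => //; exact: continuous_subspaceW cX.
have cYc : continuous Yc by apply: clip_continuous => //; exact: continuous_subspaceW cY.
have cWc : continuous Wc by apply: clip_continuous => //; exact: continuous_subspaceW cW.
have [cP1 cQ1] := cPt m; rewrite bE -/a in cP1 cQ1.
have cPc : continuous Pc by exact: clip_continuous.
have cQc : continuous Qc by exact: clip_continuous.
have cE (f : R -> R) l r t : l <= t <= r -> (f \o clip l r) t = f t.
  by move=> lr; rewrite /= clip_id.
have in0 t : 0 <= t <= T -> `[0, +oo[%classic t by move=> /andP[h _]; rewrite /= in_itv/= h.
have cfc : continuous (fun s => - v * Xc s - Yc s ^+ 3).
  move=> x; apply: cvgB; first by apply: cvgM; [exact: cvg_cst|exact: cXc].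
  by apply: (cvg_comp _ (fun z => z ^+ 3) (cYc x)); exact: exprn_continuous.
(* The exact equation is written from time 0; differences of primitives restart it at [a]. *)
have [J1 [_ JE1]] := primitive_exists 0 cfc.
have [J2 [_ JE2]] := primitive_exists 0 cXc.
have XcE t : 0 <= t <= T -> Xc t = p0 + (J1 t - J1 0) + sigma * (W t w - W 0 w).
  move=> tT; rewrite /Xc cE// (eX t (in0 t tT)) -JE1; last by rewrite lexx; case/andP: tT.
  by rewrite (eq_Rintegral_clip (fun s => - v * X s w - Y s w ^+ 3) tT).
have YcE t : 0 <= t <= T -> Yc t = q0 + (J2 t - J2 0).
  move=> tT; rewrite /Yc cE// (eY t (in0 t tT)) -JE2; last by rewrite lexx; case/andP: tT.
  by rewrite (eq_Rintegral_clip (fun s => X s w) tT).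
have aT : 0 <= a <= T by apply: inT; rewrite lexx.
have bT : 0 <= a + tau <= T by apply: inT; rewrite ab lexx.
have [_ hA hB] := hc m.
have WcE t : 0 <= t <= T -> Wc t = W t w by move=> tT; rewrite /Wc cE.
have areaE : area W tau m.+1 w = area W tau m w +
    (\int[lebesgue_measure]_(s in `[a, a + tau]) Wc s - tau * Wc a).
  rewrite /area big_ord_recr/= -/a bE WcE//; congr (_ + (_ - _)).
  apply: eq_Rintegral => s; rewrite inE/= in_itv/= => sI.
  by rewrite WcE//; exact: inT.
have [Pm1 Qm1] := splitting_next hS m w; rewrite bE in Pm1 Qm1.
have := @one_step_error R v sigma tau a (2 * S w) (Pn m w) (Qn m w) (Pbar m w) (Qbar m w)
  (area W tau m w)
  (tau * (D * coercive_hamiltonian v (Pn m w, Qn m w) ^+ k))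
  (tau * (D * coercive_hamiltonian v (Pn m w, Qn m w) ^+ k))
  Xc Yc Pc Qc Wc v0 (ltW s0) tau0 vtau cXc cYc cPc cQc cWc.
rewrite -areaE /splitting_error bE -/a Pm1 Qm1.
have -> : Pc (a + tau) = Pt m (a + tau) w by rewrite /Pc cE// ab lexx.
have -> : Qc (a + tau) = Qt m (a + tau) w by rewrite /Qc cE// ab lexx.
have -> : Xc (a + tau) = X (a + tau) w by rewrite /Xc cE.
have -> : Yc (a + tau) = Y (a + tau) w by rewrite /Yc cE.
have -> : Xc a = X a w by rewrite /Xc cE.
have -> : Yc a = Y a w by rewrite /Yc cE.
apply => //.
- move=> t tab; have tT := inT t tab; rewrite !WcE// XcE//.
  have -> : X a w = Xc a by rewrite /Xc cE.
  rewrite XcE// JE1; first by ring.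
  by rewrite a0; case/andP: tab.
- move=> t tab; have tT := inT t tab; rewrite YcE//.
  have -> : Y a w = Yc a by rewrite /Yc cE.
  rewrite YcE// JE2; first by ring.
  by rewrite a0; case/andP: tab.
- move=> t tab; have tT := inT t tab; rewrite !WcE// {1}/Pc cE//.
  rewrite (eP m t); last by rewrite /= in_itv/= bE.
  by rewrite (eq_Rintegral_clip (fun s => - (v / 2) * Pt m s w) tab).
- move=> t tab; have tT := inT t tab; rewrite {1}/Qc cE//.
  rewrite (eQ m t); last by rewrite /= in_itv/= bE.
  by rewrite (eq_Rintegral_clip (fun s => - (v / 2) * Qt m s w) tab).
- move=> t tab; have tT := inT t tab; rewrite !WcE//.
  have -> : W t w - W a w = (W t w - W 0 w) - (W a w - W 0 w) by ring.
  apply: le_trans (ler_normB _ _) _.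
  by have := hSw t tT; have := hSw a aT; lra.
Qed.
End Splitting.

(** * From moments to norms *)

Section Norms.
Context (R : realType) (d : measure_display) (O : measurableType d).
Context (P : probability O R).

Lemma powR_le_1D (x r : R) (n : nat) : 0 <= x -> 0 <= r -> r <= n%:R ->
  x `^ r <= 1 + x ^+ n.
Proof.
move=> x0 r0 rn; have [x1|x1] := leP x 1.
  apply: (@le_trans _ _ (1 `^ r)); last by rewrite powR1 lerDl exprn_ge0.
  by apply: ge0_ler_powR => //; rewrite ?nnegrE.
apply: (@le_trans _ _ (x ^+ n)); last by rewrite lerDr.
by rewrite -powR_mulrn//; apply: ler_powR => //; exact: ltW.
Qed.

(** The inequality [x^r <= 1 + x^n] compares a real exponent, possibly below 1, with an integer
    moment. It is applied after division by [tau], so the 1 does not spoil the rate. *)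
Lemma Lr_norm_le_moment (e : O -> R) (tau r C : R) (n : nat) :
  measurable_fun setT e -> (forall w, 0 <= e w) -> 0 < tau -> 0 < r -> r <= n%:R ->
  0 <= C -> (\int[P]_w ((e w / tau) ^+ n)%:E <= C%:E)%E ->
  (Lr_norm P r e <= ((1 + C) `^ r^-1 * tau)%:E)%E.
Proof.
move=> me e0 tau0 r0 rn C0 hC; rewrite /Lr_norm unlock.
have t0 := ltW tau0.
have tr0 : 0 <= tau `^ r by exact: powR_ge0.
have mp : measurable_fun setT (fun w => ((e w / tau) ^+ n)%:E).
  by apply/measurable_EFinP; apply: measurable_funX; exact: measurable_funM.
have et0 w : 0 <= e w / tau by rewrite divr_ge0.
have I : (\int[P]_w (`|(EFin \o e) w| `^ r) <= (tau `^ r * (1 + C))%:E)%E.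
  rewrite (eq_integral (fun w => (e w `^ r)%:E)); last first.
    by move=> w _; rewrite -poweR_EFin -[in RHS](ger0_norm (e0 w)).
  apply: (@le_trans _ _ (\int[P]_w ((tau `^ r)%:E * (1 + ((e w / tau) ^+ n)%:E)))%E).
    apply: ge0_le_integral => //.
    - by move=> w _; rewrite lee_fin powR_ge0.
    - by apply/measurable_EFinP; exact: (measurableT_comp (measurable_powR r) me).
    - by apply: measurable_funeM; exact: emeasurable_funD.
    - move=> w _; rewrite -EFinD -EFinM lee_fin.
      have {1}-> : e w = tau * (e w / tau) by rewrite mulrC divfK// gt_eqF.
      rewrite powRM//; apply: ler_wpM2l => //.
      by apply: powR_le_1D => //; exact: ltW.
  have m1 : measurable_fun setT (fun w => (1 + ((e w / tau) ^+ n)%:E)%E).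
    exact: emeasurable_funD.
  have p1 w : (0 <= ((e w / tau) ^+ n)%:E)%E by rewrite lee_fin exprn_ge0.
  have p2 w : (0 <= 1 + ((e w / tau) ^+ n)%:E)%E by rewrite adde_ge0.
  rewrite ge0_integralZl//.
  rewrite EFinM; apply: lee_wpmul2l; first by rewrite lee_fin.
  rewrite ge0_integralD//.
  by rewrite integral_probability_cst EFinD leeD2l.
have C1 : 0 <= 1 + C by rewrite addr_ge0.
apply: (@le_trans _ _ ((tau `^ r * (1 + C))%:E `^ r^-1)%E).
  apply: gt0_ler_poweR => //.
  - by rewrite invr_ge0 ltW.
  - by rewrite in_itv/= leey andbT; apply: integral_ge0 => w _; rewrite lee_fin powR_ge0.
  - by rewrite in_itv/= leey andbT lee_fin mulr_ge0.
rewrite poweR_EFin lee_fin powRM// -powRrM mulfV ?gt_eqF// powRr1//.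
by rewrite mulrC.
Qed.

(** The sum is at most three times the largest term. This separates dependent factors in place of
    Hölder's inequality, at the price of tripled exponents. *)
Lemma expR_third_le (x y z : R) : expR (x + (y + z)) <=
  expR (3 * x) + (expR (3 * y) + expR (3 * z)).
Proof.
have X := expR_gt0 (3 * x); have Y := expR_gt0 (3 * y); have Z := expR_gt0 (3 * z).
have [xy|yx] := leP x y; [have [yz|zy] := leP y z|have [xz|zx] := leP x z].
- by apply: (@le_trans _ _ (expR (3 * z))); [rewrite ler_expR; lra|lra].
- by apply: (@le_trans _ _ (expR (3 * y))); [rewrite ler_expR; lra|lra].
- by apply: (@le_trans _ _ (expR (3 * z))); [rewrite ler_expR; lra|lra].
- by apply: (@le_trans _ _ (expR (3 * x))); [rewrite ler_expR; lra|lra].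
Qed.

Lemma integral_potential_le (be c Mh Mz Ms : R) (h ze S : O -> R) :
  measurable_fun setT h -> measurable_fun setT ze -> measurable_fun setT S ->
  (\int[P]_w (expR (3 * be * h w))%:E <= Mh%:E)%E ->
  (\int[P]_w (expR (3 * c * ze w))%:E <= Mz%:E)%E ->
  (\int[P]_w (expR (- (3 * c) * ze w))%:E <= Mz%:E)%E ->
  (\int[P]_w (expR (3 * c * S w))%:E <= Ms%:E)%E ->
  (\int[P]_w (expR (be * h w + c * (`|ze w| + S w)))%:E <= (Mh + (Mz + Mz + Ms))%:E)%E.
Proof.
move=> mh mz ms Hh Hz Hz' Hs.
have mE (f : O -> R) (a : R) : measurable_fun setT f ->
    measurable_fun setT (fun w => (expR (a * f w))%:E).
  move=> mf; apply/measurable_EFinP; apply: measurableT_comp => //.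
  exact: measurable_funM.
have eE0 (f : O -> R) (a : R) w : (0 <= (expR (a * f w))%:E)%E by rewrite lee_fin expR_ge0.
apply: (@le_trans _ _ (\int[P]_w ((expR (3 * be * h w))%:E +
  (((expR (3 * c * ze w))%:E + (expR (- (3 * c) * ze w))%:E) +
   (expR (3 * c * S w))%:E)))%E).
  apply: ge0_le_integral => //.
  - apply/measurable_EFinP; apply: measurableT_comp => //.
    apply: measurable_funD; apply: measurable_funM => //.
    by apply: measurable_funD => //; exact: measurableT_comp.
  - by apply: emeasurable_funD; [exact: mE|apply: emeasurable_funD;
      [apply: emeasurable_funD; exact: mE|exact: mE]].
  - move=> w _; rewrite -!EFinD lee_fin mulrDr.
    apply: le_trans (expR_third_le _ _ _) _; rewrite !mulrA lerD2l lerD2r.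
    case: (ger0P (ze w)) => _; first by rewrite lerDl expR_ge0.
    by rewrite mulrN mulNr lerDr expR_ge0.
have m1 := mE _ (3 * be) mh; have m2 := mE _ (3 * c) mz.
have m3 := mE _ (- (3 * c)) mz; have m4 := mE _ (3 * c) ms.
have m23 := emeasurable_funD m2 m3; have m234 := emeasurable_funD m23 m4.
have p23 w : (0 <= (expR (3 * c * ze w))%:E + (expR (- (3 * c) * ze w))%:E)%E.
  exact: adde_ge0.
have p234 w : (0 <= (expR (3 * c * ze w))%:E + (expR (- (3 * c) * ze w))%:E +
    (expR (3 * c * S w))%:E)%E by exact: adde_ge0.
by rewrite ge0_integralD// ge0_integralD// ge0_integralD// !EFinD; do 3 ?apply: leeD.
Qed.

Lemma integral_mean_le (f : nat -> O -> R) (m : nat) (M : R) : 0 <= M ->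
  (forall j, measurable_fun setT (f j)) -> (forall j w, 0 <= f j w) ->
  (forall j, (j < m)%N -> (\int[P]_w (f j w)%:E <= M%:E)%E) ->
  (\int[P]_w ((\sum_(j < m) f j w) / m%:R)%:E <= M%:E)%E.
Proof.
move=> M0 mf f0 hM; case: m hM => [|m] hM.
  rewrite (eq_integral (cst 0%E)); first by rewrite integral0 lee_fin.
  by move=> w _; rewrite big_ord0 mul0r.
under eq_integral do rewrite mulrC EFinM -sumEFin.
have mF j : measurable_fun setT (fun w => (f j w)%:E) by exact/measurable_EFinP.
have F0 j w : (0 <= (f j w)%:E)%E by rewrite lee_fin.
have mS : measurable_fun setT (fun w => (\sum_(j < m.+1) (f j w)%:E)%E).
  by apply: emeasurable_sum => j; exact: mF.
have S0 w : (0 <= \sum_(j < m.+1) (f j w)%:E)%E by exact: sume_ge0.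
rewrite ge0_integralZl//.
rewrite ge0_integral_sum//.
have -> : M%:E = ((m.+1%:R^-1)%:E * (\sum_(j < m.+1) M%:E))%E.
  by rewrite sumEFin -EFinM sumr_const card_ord -[M *+ _]mulr_natl mulKf.
apply: lee_wpmul2l; first by rewrite lee_fin.
by apply: lee_sum => j _; exact: hM.
Qed.
End Norms.

(** Undoes the shift by [N], which is itself of size [tau]. *)
Lemma euclid_norm_sqr_le (R : realType) (v sigma x y N : R) :
  euclid_norm (x, y) ^+ 2 <=
  4 * error_energy (x + v / 2 * sigma * N) (y - sigma * N) +
  (v ^+ 2 / 2 + 2) * sigma ^+ 2 * N ^+ 2.
Proof.
rewrite /euclid_norm sqr_sqrtr ?addr_ge0 ?sqr_ge0//= /error_energy.
set u := x + _; set r := y - _.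
have -> : x = u - v / 2 * sigma * N by rewrite /u; ring.
have -> : y = r + sigma * N by rewrite /r; ring.
have := sqr_ge0 (u + v / 2 * sigma * N); have := sqr_ge0 (r - sigma * N).
have := sqr_ge0 (r * r); lra.
Qed.

Lemma expr_addn_le (R : realType) (x y : R) (n : nat) : 0 <= x -> 0 <= y ->
  (x + y) ^+ n <= 2 ^+ n * (x ^+ n + y ^+ n).
Proof.
move=> x0 y0; have xn := exprn_ge0 n x0; have yn := exprn_ge0 n y0.
have n2 : 0 <= 2 ^+ n :> R by exact: exprn_ge0.
wlog xy : x y x0 y0 xn yn / x <= y.
  move=> H; have [xy|/ltW yx] := leP x y; first exact: H.
  by rewrite addrC [x ^+ n + _]addrC; exact: H.
apply: (@le_trans _ _ ((2 * y) ^+ n)).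
  by apply: lerXn2r; rewrite ?nnegrE ?addr_ge0 ?mulr_ge0//; lra.
by rewrite exprMn; apply: ler_wpM2l => //; rewrite lerDr.
Qed.

Lemma measurable_euclid_norm (R : realType) :
  measurable_fun setT (@euclid_norm R).
Proof.
apply: measurableT_comp; last first.
  by apply: measurable_funD; apply: measurable_funX.
by apply: continuous_measurable_fun; exact: sqrt_continuous.
Qed.

(** * Even moments of the error *)

Section FinalStep.
Context (R : realType) (d : measure_display) (O : measurableType d).
Context (P : probability O R) (cP : measure_is_complete P).
Context (F : R -> set (set O)) (hF : filtration F).
Context (W : R -> O -> R) (hW : wiener_process P F W).
Context (v sigma p0 q0 : R) (v0 : 0 < v) (s0 : 0 < sigma).
Context (X Y : R -> O -> R) (hXY : langevin_solution P F W v sigma p0 q0 X Y).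
Context (D : R) (k : nat) (D0 : 0 <= D) (T : R) (T0 : 0 < T).

(** The constant is chosen before the step size and the maps of the method, which makes the bound
    uniform in them. *)
Lemma splitting_error_moment (n : nat) : (0 < n)%N -> exists2 C : R, 0 <= C &
  forall (tau : R) (A B : R * R -> R * R -> R) (psi phi : R * R -> R)
    (Pn Qn Pbar Qbar : nat -> O -> R) (Pt Qt : nat -> R -> O -> R),
  0 < tau -> tau <= 1 -> v * tau <= 1 ->
  splitting_method P F W v sigma p0 q0 tau A B psi phi Pn Qn Pbar Qbar Pt Qt ->
  (forall m, {ae P, forall w,
    let h := coercive_hamiltonian v (Pn m w, Qn m w) in
    [/\ `|Pbar m w - Pn m w| + `|Qbar m w - Qn m w| <= tau * (D * h ^+ k),
      `|v / 2 * Pn m w + Qn m w ^+ 3 + tau^-1 * (Pbar m w - Pn m w)| <=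
        tau * (D * h ^+ k) &
      `|Pn m w + v / 2 * Qn m w - tau^-1 * (Qbar m w - Qn m w)| <=
        tau * (D * h ^+ k)]}) ->
  forall m, grid tau m <= T ->
  let e w := euclid_norm (X (grid tau m) w - Pn m w, Y (grid tau m) w - Qn m w) in
  measurable_fun setT e /\
  (\int[P]_w ((e w / tau) ^+ (2 * n))%:E <= C%:E)%E.
Proof.
move=> n0; pose mv := Num.min v 1.
have mv0 : 0 < mv by rewrite lt_min v0 ltr01.
have ss0 : 0 < sigma ^+ 2 by rewrite exprn_gt0.
(* The exponents are tripled when the three factors are separated, so [3 * be] must satisfy the
   smallness conditions of the energy moment. *)
pose be := mv / (6 * sigma ^+ 2).
have be0 : 0 < be by rewrite divr_gt0// mulr_gt0.
have beE : 2 * (3 * be) * sigma ^+ 2 = mv.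
  by rewrite /be; field; rewrite gt_eqF.
have bev : 2 * (3 * be) * sigma ^+ 2 <= v by rewrite beE ge_min lexx.
have be1 : 2 * (3 * be) * sigma ^+ 2 <= 1 by rewrite beE ge_min lexx orbT.
have be30 : 0 <= 3 * be by rewrite mulr_ge0// ltW.
have nR0 : 0 < n%:R :> R by rewrite ltr0n.
pose del := be / (2 * n%:R * T).
have nT0 : 0 < 2 * n%:R * T by rewrite !mulr_gt0.
have del0 : 0 < del by rewrite divr_gt0.
have hdel : 2 * n%:R * T * del <= be by rewrite /del mulrC divfK// gt_eqF.
have [c0 c00 hrate] := step_rate_le v (ltW s0) del0.
have [D' [ka [D'0 hforc]]] := step_forcing_le k v0 (ltW s0) D0.
have [C [c [C0 cge0 hbound]]] := error_moment_bound ka T0 be0 c00 D'0 n0 hdel.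
have [C4 C40 hC4] := pow_le_expR (2 * n) (ltr01 : (0 : R) < 1).
have [S [mS S0 hS hSexp]] := wiener_sup_exp_moment cP hF hW T0.
pose Mh := expR (3 * be * (v * (v ^+ 4 / 8 + 1) + sigma ^+ 2) * T) *
  expR (3 * be * coercive_hamiltonian v (p0, q0)).
pose Mz c := expR (9 * c ^+ 2 * T) : R.
pose M c := Mh + (Mz c + Mz c + 4 * expR (4 * (3 * c) ^+ 2 * T)).
have kap0 : 0 <= 3 * be * (v * (v ^+ 4 / 8 + 1) + sigma ^+ 2).
  apply: (mulr_ge0 be30); apply: addr_ge0; last exact: sqr_ge0.
  apply: (mulr_ge0 (ltW v0)); apply: addr_ge0 => //.
  by rewrite divr_ge0// exprn_even_ge0.
have M0 x : 0 <= M x.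
  by rewrite !addr_ge0 ?mulr_ge0 ?expR_ge0.
pose c3 := (v ^+ 2 / 2 + 2) * sigma ^+ 2.
have c30 : 0 <= c3 by rewrite mulr_ge0 ?sqr_ge0// addr_ge0// divr_ge0// sqr_ge0.
pose K1 := 2 ^+ n * (4 ^+ n * C); pose K2 := 2 ^+ n * (c3 ^+ n * C4).
have K10 : 0 <= K1 by rewrite !mulr_ge0 ?exprn_ge0.
have K20 : 0 <= K2 by rewrite !mulr_ge0 ?exprn_ge0.
exists (K1 * M c + K2 * M 1).
  by apply: addr_ge0; apply: mulr_ge0 => //; exact: M0.
move=> tau A B psi phi Pn Qn Pbar Qbar Pt Qt tau0 tau1 vtau hsp hcons m mT.
pose h j w := coercive_hamiltonian v (Pn j w, Qn j w).
pose ze j w := area W tau j w / tau.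
have mPQ j : measurable_fun setT (fun w => (Pn j w, Qn j w)).
  exact: (adapted_measurable hF (grid_ge0 tau0 j)
    (@splitting_adapted R d O P F hF W v sigma p0 q0 tau tau0 A B psi phi
      Pn Qn Pbar Qbar Pt Qt hsp j)).
have mP j : measurable_fun setT (Pn j) := measurableT_comp measurable_fst (mPQ j).
have mQ j : measurable_fun setT (Qn j) := measurableT_comp measurable_snd (mPQ j).
have mh j : measurable_fun setT (h j).
  exact: (measurableT_comp (measurable_coercive_hamiltonian v) (mPQ j)).
have marea j := (area_exp_moment cP hF hW j tau0).1.
have mze j : measurable_fun setT (ze j) by exact: measurable_funM.
have [[aX aY] _ _ _] := hXY.
have gI j : `[0, +oo[%classic (grid tau j) by rewrite /= in_itv/= grid_ge0.
have mXY Z j : adapted F `[0, +oo[ Z -> measurable_fun setT (Z (grid tau j)).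
  move=> aZ _ C' mC; rewrite setTI.
  by apply: (filtration_measurable hF (grid_ge0 tau0 j)); exact: aZ (gI j) _ mC.
set e := fun w => _.
have me : measurable_fun setT e.
  apply: (measurableT_comp (@measurable_euclid_norm R)).
  by apply: measurable_fun_pair; apply: measurable_funB => //; exact: mXY.
split => //.
have gridle j : (j <= m)%N -> grid tau j <= T.
  by move=> jm; apply: le_trans mT; rewrite /grid ler_wpM2r ?(ltW tau0)// ler_nat.
pose psi' x j w := expR (be * h j w + x * (`|ze j w| + S w)).
have mpsi x j : measurable_fun setT (psi' x j).
  apply: measurableT_comp => //; apply: measurable_funD; apply: measurable_funM => //.
  by apply: measurable_funD => //; exact: measurableT_comp.
have psi0 x j w : 0 <= psi' x j w by exact: expR_ge0.
have psiM x j : 0 <= x -> (j <= m)%N -> (\int[P]_w (psi' x j w)%:E <= (M x)%:E)%E.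
  move=> x0 jm; have gT := gridle j jm.
  (* Both signs of [y] are needed to bound the exponential of an absolute value; [tau] cancels
     between [ze] and the moment of [area]. *)
  have hz y : y ^+ 2 = (3 * x) ^+ 2 -> (\int[P]_w (expR (y * ze j w))%:E <= (Mz x)%:E)%E.
    move=> yx; rewrite (eq_integral (fun w => (expR (y / tau * area W tau j w))%:E)).
      apply: le_trans ((area_exp_moment cP hF hW j tau0).2 _) _.
      rewrite lee_fin ler_expR expr_div_n yx divfK ?gt_eqF ?exprn_gt0//.
      rewrite exprMn -natrX; apply: ler_pM => //; [|exact: grid_ge0].
      by rewrite mulr_ge0// sqr_ge0.
    by move=> w _; rewrite /ze mulrA mulrAC.
  apply: integral_potential_le => //; [|exact: hz|by apply: hz; rewrite sqrrN|].
    apply: le_trans (splitting_energy_moment cP hF hW v0 tau0 tau1 hsp j be30 bev be1) _.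
    rewrite lee_fin; apply: ler_wpM2r; first exact: expR_ge0.
    by rewrite ler_expR; exact: ler_wpM2l kap0 _ _ gT.
  by apply: hSexp; rewrite mulr_ge0.
pose mean w := (\sum_(j < m) psi' c j w) / m%:R.
have mean0 w : 0 <= mean w by rewrite divr_ge0// sumr_ge0.
have mmean : measurable_fun setT mean.
  by apply: measurable_funM => //; exact: measurable_sum.
have bound : {ae P, forall w, (e w / tau) ^+ (2 * n) <= K1 * mean w + K2 * psi' 1 m w}.
  have rec := splitting_error_recursion hW v0 s0 tau0 hsp hXY hcons vtau T0 hS.
  have /ae_foralln hcons' := hcons.
  have /ae_foralln hham := splitting_hamiltonian hsp.
  apply: filterS (filterI rec (filterI hcons' hham)) => w [[E00 Erec] [hc hH]].
  have Eh j : coercive_hamiltonian v (Pbar j w, Qbar j w) = h j w.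
    by rewrite /h /coercive_hamiltonian/= hH.
  pose E j := splitting_error W v sigma tau Pn Qn X Y j w.
  have E0 j : 0 <= E j.
    rewrite /E /splitting_error /error_energy -!expr2.
    by rewrite !addr_ge0// divr_ge0// sqr_ge0.
  have t2 : 0 < tau ^+ 2 by rewrite exprn_gt0.
  have Emean : (E m / tau ^+ 2) ^+ n <= C * mean w.
    (* The mean over no step is 0 by convention, and so is the initial error. *)
    have [->|m0] := posnP m.
      by rewrite /E E00 mul0r expr0n gtn_eqF// mulr_ge0.
    apply: le_trans (hbound tau (S w) m (h ^~ w) (fun j => `|area W tau j w| / tau) E
      (fun j => splitting_rate W sigma tau Qn Qbar S j w)
      (fun j => splitting_forcing W v sigma tau Pn Qn Pbar Qbar D k S j w)
      tau0 m0 mT (S0 w) _ _ E00 (E0 m) _ _ _) _.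
    - by move=> j; have [h1 _ _] := coercive_hamiltonian_abs_le v (Pn j w, Qn j w);
        exact: le_trans h1.
    - by move=> j; rewrite divr_ge0// ltW.
    - by move=> j jm; apply: Erec; exact: gridle.
    - by move=> j jm; exact: hrate.
    - move=> j jm; have [hAB _ _] := hc j.
      exact: (hforc tau (S w) _ _ _ _ _ tau0 tau1 (S0 w) (Eh j) hAB _ erefl).
    - apply: ler_wpM2l => //; rewrite /mean le_eqVlt; apply/orP; left; apply/eqP.
      congr (_ / _); apply: eq_bigr => j _.
      by rewrite /psi' /ze normrM normfV (gtr0_norm tau0).
  have ze2 : (ze m w ^+ 2) ^+ n <= C4 * psi' 1 m w.
    have -> : (ze m w ^+ 2) ^+ n = `|ze m w| ^+ (2 * n).
      by rewrite exprM real_normK ?num_real.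
    apply: le_trans (hC4 _ (normr_ge0 _)) _.
    apply: ler_wpM2l => //; rewrite ler_expR !mul1r.
    have [h1 _ _] := coercive_hamiltonian_abs_le v (Pn m w, Qn m w).
    have bh : 0 <= be * h m w by rewrite mulr_ge0 ?(ltW be0)//; exact: le_trans h1.
    by rewrite addrCA lerDl addr_ge0.
  have -> : (e w / tau) ^+ (2 * n) = (e w ^+ 2 / tau ^+ 2) ^+ n.
    by rewrite -expr_div_n -exprM.
  have e2 : e w ^+ 2 / tau ^+ 2 <= 4 * (E m / tau ^+ 2) + c3 * ze m w ^+ 2.
    rewrite ler_pdivrMr//.
    apply: le_trans (euclid_norm_sqr_le v sigma _ _ (area W tau m w)) _.
    rewrite -/(splitting_error W v sigma tau Pn Qn X Y m w) -/(E m) -/c3.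
    rewrite /ze expr_div_n le_eqVlt; apply/orP; left; apply/eqP; field.
    by rewrite gt_eqF.
  have z20 : 0 <= c3 * ze m w ^+ 2 by rewrite mulr_ge0 ?sqr_ge0.
  have Et0 : 0 <= 4 * (E m / tau ^+ 2) by rewrite mulr_ge0// divr_ge0// ltW.
  apply: (@le_trans _ _ ((4 * (E m / tau ^+ 2) + c3 * ze m w ^+ 2) ^+ n)).
    by apply: lerXn2r; rewrite ?nnegrE ?addr_ge0// divr_ge0 ?sqr_ge0// ltW.
  apply: le_trans (expr_addn_le n Et0 z20) _.
  rewrite (_ : K1 * mean w + K2 * psi' 1 m w =
    2 ^+ n * (4 ^+ n * (C * mean w) + c3 ^+ n * (C4 * psi' 1 m w))); last first.
    by rewrite /K1 /K2; ring.
  apply: ler_wpM2l; first exact: exprn_ge0.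
  rewrite [(4 * _) ^+ n]exprMn [(c3 * _) ^+ n]exprMn; apply: lerD.
    exact: (ler_wpM2l (exprn_ge0 n (ler0n _ 4)) Emean).
  exact: (ler_wpM2l (exprn_ge0 n c30) ze2).
have mK1 : measurable_fun setT (fun w => (K1%:E * (mean w)%:E)%E).
  by apply: measurable_funeM; exact/measurable_EFinP.
have mK2 : measurable_fun setT (fun w => (K2%:E * (psi' 1 m w)%:E)%E).
  by apply: measurable_funeM; apply/measurable_EFinP; exact: mpsi.
have p1 w : (0 <= K1%:E * (mean w)%:E)%E by rewrite -EFinM lee_fin mulr_ge0.
have p2 w : (0 <= K2%:E * (psi' 1 m w)%:E)%E by rewrite -EFinM lee_fin mulr_ge0.
apply: (@le_trans _ _ (\int[P]_w (K1%:E * (mean w)%:E + K2%:E * (psi' 1 m w)%:E))%E).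
  apply: ae_ge0_le_integral => //.
  - by move=> w _; rewrite lee_fin exprn_ge0// divr_ge0 ?sqrtr_ge0// ltW.
  - by apply/measurable_EFinP; apply: measurable_funX; exact: measurable_funM.
  - by move=> w _; exact: adde_ge0.
  - exact: emeasurable_funD.
  - by apply: filterS bound => w hw _; rewrite -!EFinM -EFinD lee_fin.
have p3 w : (0 <= (mean w)%:E)%E by rewrite lee_fin.
have p4 w : (0 <= (psi' 1 m w)%:E)%E by rewrite lee_fin.
have m3 : measurable_fun setT (fun w => (mean w)%:E) by exact/measurable_EFinP.
have m4 : measurable_fun setT (fun w => (psi' 1 m w)%:E).
  by apply/measurable_EFinP; exact: mpsi.
rewrite ge0_integralD// ge0_integralZl// ge0_integralZl// EFinD !EFinM.
apply: leeD; apply: lee_wpmul2l; rewrite ?lee_fin//.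
  by apply: integral_mean_le => // j jm; apply: psiM => //; exact: ltnW.
exact: psiM.
Qed.
End FinalStep.

Theorem theorem3p1 (R : realType) (d : measure_display) (O : measurableType d)
  (P : probability O R) (hcomplete : measure_is_complete P)
  (F : R -> set (set O)) (hF : filtration F)
  (W : R -> O -> R) (hW : wiener_process P F W)
  (upsilon sigma p0 q0 : R) (hupsilon : 0 < upsilon) (hsigma : 0 < sigma)
  (X Y : R -> O -> R)
  (hXY : langevin_solution P F W upsilon sigma p0 q0 X Y)
  (A B : R -> R * R -> R * R -> R) (psi phi : R -> R * R -> R)
  (Pn Qn Pbar Qbar : R -> nat -> O -> R) (Pt Qt : R -> nat -> R -> O -> R)
  (hsplit : forall tau : R, 0 < tau < 1 ->
    splitting_method P F W upsilon sigma p0 q0 tau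
      (A tau) (B tau) (psi tau) (phi tau)
      (Pn tau) (Qn tau) (Pbar tau) (Qbar tau) (Pt tau) (Qt tau))
  (a b : R) (hab : 1 <= Num.min a b)
  (Theta1 Theta2 : R * R -> R * R -> R)
  (hTheta1 : polynomial_growth Theta1) (hTheta2 : polynomial_growth Theta2)
  (C1 C2 : R) (hC1 : 0 < C1) (hC2 : 0 < C2)
  (hA : forall tau : R, 0 < tau < 1 -> forall m : nat, {ae P, forall w,
    `|upsilon / 2 * Pn tau m w + Qn tau m w ^+ 3 + tau^-1 *
        along_step (A tau) (Pn tau) (Qn tau) (Pbar tau) (Qbar tau) m w|
    <= C1 * (`|Pbar tau m w - Pn tau m w| `^ a +
             `|Qbar tau m w - Qn tau m w| `^ b) *
       along_step Theta1 (Pn tau) (Qn tau) (Pbar tau) (Qbar tau) m w})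
  (hB : forall tau : R, 0 < tau < 1 -> forall m : nat, {ae P, forall w,
    `|Pn tau m w + upsilon / 2 * Qn tau m w - tau^-1 *
        along_step (B tau) (Pn tau) (Qn tau) (Pbar tau) (Qbar tau) m w|
    <= C2 * (`|Pbar tau m w - Pn tau m w| `^ a +
             `|Qbar tau m w - Qn tau m w| `^ b) *
       along_step Theta2 (Pn tau) (Qn tau) (Pbar tau) (Qbar tau) m w})
  (p T : R) (hp : 0 < p) (hT : 0 < T)
  (C3 : R) (hC3 : 0 < C3)
  (hAB : forall tau : R, 0 < tau < 1 ->
    (ereal_sup [set
       Lr_norm P (6 * p * a) (fun w => tau^-1 *
         along_step (A tau) (Pn tau) (Qn tau) (Pbar tau) (Qbar tau) n w)%R +
       Lr_norm P (6 * p * b) (fun w => tau^-1 *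
         along_step (B tau) (Pn tau) (Qn tau) (Pbar tau) (Qbar tau) n w)%R
       | n in [set n : nat | grid tau n <= T]%R]
     <= C3%:E)%E) :
  exists tau0 C : R, [/\ 0 < tau0 < 1, 0 < C &
    forall tau : R, 0 < tau < tau0 ->
      (ereal_sup [set
         Lr_norm P (2 * p) (fun w => euclid_norm
           (X (grid tau m) w - Pn tau m w, Y (grid tau m) w - Qn tau m w)%R)
         | m in [set m : nat | grid tau m <= T]%R]
       <= (C * tau)%:E)%E].
Proof.
move: hab; rewrite le_min => /andP[a1 b1].
have [D [k [D0 hDk]]] := step_consistency hupsilon hC1 hC2 a1 b1 hTheta1 hTheta2.
(* An integer above [p], so that the norm of exponent [2 * p] is controlled by the moment of order
   [2 * n]. *)
pose n := (Num.truncn p).+1.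
have [C C0 hC] := splitting_error_moment hcomplete hF hW hupsilon hsigma hXY k D0 hT
  (ltn0Sn (Num.truncn p)).
have p20 : 0 < 2 * p by rewrite mulr_gt0.
have pn : 2 * p <= (2 * n)%:R.
  by rewrite natrM ler_pM2l// ltW// truncnS_gt.
(* The bound [upsilon^-1] ensures [upsilon * tau <= 1], used to control the stochastic flow within a
   step; [2^-1] keeps the threshold below 1. *)
exists (Num.min 2^-1 upsilon^-1), ((1 + C) `^ (2 * p)^-1); split.
- by rewrite lt_min !invr_gt0 hupsilon ltr0n gt_min invf_lt1// ltr1n.
- by rewrite powR_gt0// ltr_wpDr.
move=> tau /andP[tau0]; rewrite lt_min => /andP[tau2 tauv].
have tau1 : tau < 1 by apply: lt_trans tau2 _; rewrite invf_lt1// ltr1n.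
have tau01 : 0 < tau < 1 by rewrite tau0.
have vtau : upsilon * tau <= 1.
  by rewrite -ler_pdivlMl// mulr1 ltW.
have hsp := hsplit tau tau01.
apply: ge_ereal_sup => _ [m mT <-].
have [|me hm] := hC tau _ _ _ _ _ _ _ _ _ _ tau0 (ltW tau1) vtau hsp _ m mT.
  move=> j; apply: filterS (filterI (splitting_one_step hsp j)
    (filterI (splitting_hamiltonian hsp j) (filterI (hA tau tau01 j) (hB tau tau01 j)))).
  move=> w [[PE QE] [HE [hAw hBw]]] /=.
  have AE : along_step (A tau) (Pn tau) (Qn tau) (Pbar tau) (Qbar tau) j w =
    Pbar tau j w - Pn tau j w by rewrite PE addrC addKr.
  have BE : along_step (B tau) (Pn tau) (Qn tau) (Pbar tau) (Qbar tau) j w =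
    Qbar tau j w - Qn tau j w by rewrite QE addrC addKr.
  rewrite AE in hAw; rewrite BE in hBw.
  apply: (hDk tau _ _ _ _ tau0 _ hAw hBw).
  by rewrite /coercive_hamiltonian/= HE.
by apply: Lr_norm_le_moment me _ tau0 p20 pn C0 hm => w; exact: sqrtr_ge0.
Qed.
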